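(* Let $d\in\mathbb{N}$, $\beta>0$, $a>0$, $\mu\le 0$ and $\mathrm{bc}\in\{\emptyset,\mathrm{Dir},\mathrm{per}\}$. Then the sequence $(\nu_{N,\mu}^{\mathrm{CMF}})_{N\ge1}$ satisfies a large deviation principle on $\ell_1(\mathbb{R})$ with rate $|\Lambda_N|$ and rate function $$I_\mu^{\mathrm{CMF}}(x)=\beta H^{\mathrm{CMF}}(x)+I_\mu(x)-\inf_{y\in\ell_1(\mathbb{R})}\{\beta H^{\mathrm{CMF}}(y)+I_\mu(y)\}.$$
   Context: $\Lambda_N=[-N,N]^d$, $|\Lambda_N|=(2N)^d$. For $\mu\le 0$ and $k\in\mathbb{N}$ put $q_k^{(\mu)}=\frac{e^{\beta\mu k}}{(4\pi\beta)^{d/2}k^{1+d/2}}$ and $\bar q^{(\mu)}=\sum_{k\ge1}q_k^{(\mu)}$. Let $g_t(x,y)=(4\pi t)^{-d/2}e^{-|x-y|^2/(4t)}$; let $g_t^{(\mathrm{per})}(x,y)=\sum_{z\in\mathbb{Z}^d}g_t(x,y+2Nz)$; let $g_t^{(\mathrm{Dir})}(x,y)$ be the transition density of Brownian motion with generator $\Delta$ killed on leaving $\Lambda_N$. For $\mathrm{bc}=\emptyset$ set $q_k^{(\mathrm{bc},\mu)}=q_k^{(\mu)}$ for all $k$; for $\mathrm{bc}\in\{\mathrm{per},\mathrm{Dir}\}$ set $q_k^{(\mathrm{bc},\mu)}=\frac{e^{\beta\mu k}}{k|\Lambda_N|}\int_{\Lambda_N}g^{(\mathrm{bc})}_{k\beta}(x,x)\,dx$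 for $k\le N$ and $0$ for $k>N$. Let $(\mathcal{N}_k)_{k}$ be independent Poisson random variables with means $|\Lambda_N|q_k^{(\mathrm{bc},\mu)}$, and let $\nu_{N,\mu}^{(\mathrm{bc})}$ be the law of $(\mathcal{N}_k/|\Lambda_N|)_{k\in\mathbb{N}}$ on $\ell_1(\mathbb{R}_+)\subset\ell_1(\mathbb{R})$ (norm topology). $I_\mu(x)=\sum_{k\ge1}x_k(\log\frac{x_k}{q_k^{(\mu)}}-1)+\bar q^{(\mu)}$ for $x\in\ell_1(\mathbb{R}_+)$ and $I_\mu(x)=+\infty$ otherwise ($0\log0=0$). Cycle-mean-field (CMF) model: $H^{\mathrm{CMF}}(x)=\frac a2\big(\sum_{k=1}^\infty x_k\big)^2$, and $\nu_{N,\mu}^{\mathrm{CMF}}(dx)=\frac{\exp(-|\Lambda_N|\beta H^{\mathrm{CMF}}(x))}{Z_N}\,\nu_{N,\mu}^{(\mathrm{bc})}(dx)$, where $Z_N$ is the normalising constant making this a probability measure. *)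

(* Defs.v *)
From HB Require Import structures.
From mathcomp Require Import all_boot all_order all_algebra.
From mathcomp Require Import all_classical all_reals all_analysis.

Set Implicit Arguments.
Unset Strict Implicit.
Unset Printing Implicit Defensive.

Import Order.TTheory GRing.Theory Num.Theory.
Import numFieldNormedType.Exports.

Local Open Scope classical_set_scope.
Local Open Scope ring_scope.

Section ell1_type.
Context {R : realType}.

Definition in_ell1 : {pred nat -> R} :=
  fun x => `[< cvgn (series (fun k => `|x k|)) >].

Lemma in_ell1P (x : nat -> R) :
  x \in in_ell1 <-> cvgn (series (fun k => `|x k|)).
Proof. by split=> [/asboolP|h]; [|apply/asboolP]. Qed.

Lemma ell1_submod_closed : submod_closed in_ell1.
Proof.
split=> [|a x y /in_ell1P cx /in_ell1P cy]; apply/in_ell1P.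
  rewrite (_ : series _ = cst 0); first exact: is_cvg_cst.
  apply/funext => n; rewrite /series /= big1// => i _.
  by rewrite /GRing.zero /= normr0.
apply: (@series_le_cvg _ _ (fun k => `|a| * `|x k| + `|y k|)).
- by move=> n.
- by move=> n; rewrite addr_ge0// mulr_ge0.
- move=> n; apply: (le_trans (ler_normD _ _)).
  by rewrite lerD2r normrM.
- rewrite (_ : series _ = (fun n => `|a| * series (fun k => `|x k|) n
      + series (fun k => `|y k|) n)).
    by apply: is_cvgD => //; apply: is_cvgMr.
  apply/funext => n; rewrite /series /= big_split /=.
  by rewrite -mulr_sumr.
Qed.

HB.instance Definition _ :=
  GRing.isSubmodClosed.Build R (nat -> R) in_ell1 ell1_submod_closed.

Record ell1 := Ell1 { ell1_val :> nat -> R; ell1P : ell1_val \in in_ell1 }.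
HB.instance Definition _ := [isSub of ell1 for ell1_val].
HB.instance Definition _ := [Choice of ell1 by <:].
HB.instance Definition _ := [SubChoice_isSubLmodule of ell1 by <:].

Definition ell1_norm (x : ell1) : R := limn (series (fun k => `|x k|)).

Lemma ell1_cvg (x : ell1) : cvgn (series (fun k => `|x k|)).
Proof. by apply/in_ell1P; exact: ell1P. Qed.

Lemma ell1_normD x y : ell1_norm (x + y) <= ell1_norm x + ell1_norm y.
Proof.
rewrite /ell1_norm -limD; [|exact: ell1_cvg..].
apply: ler_lim; first exact: ell1_cvg.
  by apply: is_cvgD; exact: ell1_cvg.
near=> n; rewrite [leRHS](_ : _ = \sum_(0 <= k < n) (`|x k| + `|y k|)).
  by apply: ler_sum => i _; exact: ler_normD.
by rewrite big_split.
Unshelve. all: by end_near. Qed.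

Lemma ell1_normZ (a : R) x : ell1_norm (a *: x) = `|a| * ell1_norm x.
Proof.
rewrite /ell1_norm -[RHS]limZr; last exact: ell1_cvg.
congr (limn _); apply/funext => n.
rewrite [RHS](_ : _ = `|a| * series (fun k => `|x k|) n) //.
by rewrite /series /= mulr_sumr; apply: eq_bigr => i _; exact: normrM.
Qed.

Lemma ell1_norm_eq0 x : ell1_norm x = 0 -> x = 0.
Proof.
move=> x0; apply/val_inj/funext => k /=.
apply/eqP; rewrite -normr_eq0 eq_le normr_ge0 andbT -x0.
have nd : nondecreasing_seq (series (fun k => `|x k|)).
  by apply: nondecreasing_series.
apply: (le_trans _ (nondecreasing_cvgn_le nd (@ell1_cvg x) k.+1)).
by rewrite /series /= big_nat_recr//= lerDr sumr_ge0.
Qed.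

HB.instance Definition _ := @Lmodule_isNormed.Build R ell1
  ell1_norm ell1_normD ell1_normZ ell1_norm_eq0.

End ell1_type.
Arguments ell1 R : clear implicits.

Definition ell1_borel (R : realType) := g_sigma_algebraType (@open (ell1 R)).

Section lebesgue_tuple.
Context {R : realType}.
Local Open Scope ereal_scope.

Fixpoint lebesgue_tuple n : set (n.-tuple R) -> \bar R :=
  match n with
  | 0 => \d_[tuple]
  | m.+1 => pushforward (lebesgue_measure \x @lebesgue_tuple m)
              (fun p : R * m.-tuple R => [tuple of p.1 :: p.2])
  end.


Let lebesgue_tuple_measure n :
  exists m : {sigma_finite_measure set (n.-tuple R) -> \bar R},
    m = @lebesgue_tuple n :> (set _ -> _).
Proof.
elim: n => [|n [m mE]].
  by exists (@dirac _ (0.-tuple R) [tuple] R).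
pose f := fun p : measurableTypeR R * n.-tuple R =>
  [tuple of p.1 :: p.2] : n.+1.-tuple R.
have mf : measurable_fun setT f.
  by apply: measurable_cons; [exact: measurable_fst|exact: measurable_snd].
pose g := fun t : n.+1.-tuple R =>
  (thead t : measurableTypeR R, [tuple of behead t] : n.-tuple R).
have mg : measurable_fun setT g.
  apply/measurable_fun_pair; last exact: measurable_behead.
  exact: (measurable_tnth ord0).
have fg : cancel f g.
  by move=> [x t]; rewrite /f /g /= theadE; congr pair; apply/val_inj.
pose prod : {measure set _ -> \bar R} := (@lebesgue_measure R \x m)%E.
pose nu : {measure set _ -> \bar R} :=
  measure_function_pushforward__canonical__measure_function_Measure prod mf.
have [F TF Foo] : exists2 F : (set (measurableTypeR R * n.-tuple R))^nat,
    setT = \bigcup_k F k & forall k, measurable (F k) /\ prod (F k) < +oo.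
  have /sigma_finiteP[F [TF ndF Foo]] :=
    sigma_finiteT (@lebesgue_measure R : {sigma_finite_measure set _ -> \bar R}).
  have /sigma_finiteP[G [TG ndG Goo]] := sigma_finiteT m.
  exists (fun k => F k `*` G k); first last.
    move=> k; have [? ?] := Foo k; have [? ?] := Goo k.
    split; first exact: measurableX.
    by rewrite /prod /= product_measure1E// lte_mul_pinfty// ge0_fin_numE.
  rewrite -setXTT TF TG predeqE => -[x y]; split=> [|[k _ []]]; last first.
    by move=> *; split; exists k.
  move=> [/= [k _ Fkx] [j _ Gjy]]; exists (maxn k j) => //; split.
    by move: x Fkx; exact/subsetPset/ndF/leq_maxl.
  by move: y Gjy; exact/subsetPset/ndG/leq_maxr.
have snu : sigma_finite setT nu.
  exists (fun k => g @^-1` F k).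
    by rewrite -preimage_bigcup -TF preimage_setT.
  move=> k; have [mF Fy] := Foo k; split.
    by rewrite -[X in measurable X]setTI; exact: mg.
  rewrite /nu /= /pushforward -comp_preimage.
  by rewrite (_ : g \o f = id)//; apply/funext => x; exact: fg.
pose snu' := isSigmaFinite.Build _ _ _ nu snu.
pose snu'' := isSFinite.Build _ _ _ nu (sfinite_measure_sigma_finite snu).
pose nuS : {sigma_finite_measure set _ -> \bar R} :=
  HB.pack (nu : set _ -> \bar R) (Measure.class nu) snu' snu''.
exists nuS; rewrite /=.
by rewrite /nuS /= -mE.
Qed.

Let lebesgue_tuple0 n : @lebesgue_tuple n set0 = 0.
Proof. by have [m <-] := lebesgue_tuple_measure n; exact: measure0. Qed.

Let lebesgue_tuple_ge0 n A : 0 <= @lebesgue_tuple n A.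
Proof. by have [m <-] := lebesgue_tuple_measure n; exact: measure_ge0. Qed.

Let lebesgue_tuple_additive n : semi_sigma_additive (@lebesgue_tuple n).
Proof.
have [m <-] := lebesgue_tuple_measure n.
exact: measure_semi_sigma_additive.
Qed.

HB.instance Definition _ n := isMeasure.Build _ _ _ (@lebesgue_tuple n)
  (@lebesgue_tuple0 n) (@lebesgue_tuple_ge0 n) (@lebesgue_tuple_additive n).

Let lebesgue_tuple_sigma_finite n : sigma_finite setT (@lebesgue_tuple n).
Proof. by have [m <-] := lebesgue_tuple_measure n; exact: sigma_finiteT. Qed.

HB.instance Definition _ n := Measure_isSigmaFinite.Build _ _ _
  (@lebesgue_tuple n) (@lebesgue_tuple_sigma_finite n).

End lebesgue_tuple.

Section independence.
Context {dO} {O : measurableType dO} {R : realType} (P : probability O R).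

Definition mutually_independent {dT} {T : measurableType dT} {I : eqType}
    (X : I -> O -> T) :=
  forall (J : seq I) (A : I -> set T), uniq J ->
    (forall i, measurable (A i)) ->
    P (\bigcap_(i in [set` J]) (X i @^-1` A i)) =
    (\prod_(i <- J) P (X i @^-1` A i))%E.

(* Brownian motion on R^d started at 0, with generator Laplacian (not half of
   it): the coordinates of W t - W s are N(0, 2(t - s)). *)
Definition brownian_motion d (W : R -> O -> d.-tuple R) :=
  [/\ forall t, 0 <= t -> measurable_fun setT (W t),
      forall w i, tnth (W 0 w) i = 0,
      forall w i,
        {within [set t | 0 <= t], continuous (fun t => tnth (W t w) i)}
    & forall t : nat -> R, 0 <= t 0%N -> (forall j, t j < t j.+1) ->
        let incr (p : nat * 'I_d) w :=
          tnth (W (t p.1.+1) w) p.2 - tnth (W (t p.1) w) p.2 in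
        mutually_independent incr /\
        forall p (A : set R), measurable A ->
          P (incr p @^-1` A) =
          normal_prob 0 (Num.sqrt (2 * (t p.1.+1 - t p.1))) A].

End independence.

Section boxes_and_kernels.
Context {R : realType} {d : nat}.
Implicit Types (N : nat) (t : R) (x y : d.-tuple R).

Definition box N : set (d.-tuple R) :=
  [set x | forall i, - N%:R <= tnth x i <= N%:R].

Definition translate x y : d.-tuple R := [tuple tnth x i + tnth y i | i < d].

Definition gauss_kernel t x y : R :=
  (4 * pi * t) `^ (- (d%:R / 2)) *
  expR (- (\sum_(i < d) (tnth x i - tnth y i) ^+ 2) / (4 * t)).

Definition periodic_kernel N t x y : R :=
  fine (\esum_(z in [set: d.-tuple int])
    (gauss_kernel t x
       (translate y [tuple 2 * N%:R * (tnth z i)%:~R | i < d]))%:E)%E.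

Definition tuple_of_row (u : 'rV[R]_d) : d.-tuple R := [tuple u 0 i | i < d].

(* g t x is the density of the position at time t of a Brownian motion started
   at x in the box and killed when it leaves it.  A density is only defined up
   to null sets; as the values g t x x are integrated below, the jointly
   continuous version is required. *)
Definition killed_density N (g : R -> d.-tuple R -> d.-tuple R -> R) :=
  exists dO (O : measurableType dO) (P : probability O R)
    (W : R -> O -> d.-tuple R),
  brownian_motion P W /\
  forall t, 0 < t ->
    {within [set p : 'rV[R]_d * 'rV[R]_d |
               box N (tuple_of_row p.1) /\ box N (tuple_of_row p.2)],
       continuous (fun p => g t (tuple_of_row p.1) (tuple_of_row p.2))} /\
    forall x (A : set (d.-tuple R)), box N x -> measurable A ->
      P [set w | A (translate x (W t w)) /\
                 forall s, 0 <= s <= t -> box N (translate x (W s w))] =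
      (\int[@lebesgue_tuple R d]_(y in A `&` box N) (g t x y)%:E)%E.

End boxes_and_kernels.

(* Free is the boundary condition written as the empty set. *)
Inductive boundary := Free | Per | Dir.

(* Cycle lengths start at 1 while sequences are indexed by nat: the entry of
   index k of an element of ell1 belongs to cycles of length k.+1. *)
Section model.
Context {R : realType}.
Variables (d : nat) (beta mu a : R).
Implicit Types (N k : nat).

Definition volume N : R := (2 * N%:R) ^+ d.

Definition free_weight k : R :=
  expR (beta * mu * k%:R) /
  ((4 * pi * beta) `^ (d%:R / 2) * k%:R `^ (1 + d%:R / 2)).

Definition total_free_weight : R := limn (series (fun k => free_weight k.+1)).

Definition loop_weight N (g : R -> d.-tuple R -> d.-tuple R -> R) k : R :=
  if (k <= N)%N then
    expR (beta * mu * k%:R) / (k%:R * volume N) *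
    \int[@lebesgue_tuple R d]_(x in box N) g (k%:R * beta) x x
  else 0.

Definition bc_weight (bc : boundary)
    (gDir : nat -> R -> d.-tuple R -> d.-tuple R -> R) N k : R :=
  match bc with
  | Free => free_weight k
  | Per => loop_weight N (periodic_kernel N) k
  | Dir => loop_weight N (gDir N) k
  end.

(* The second argument of poisson_prob is a dummy. *)
Definition cycle_density_law (q : nat -> R) N
    (nu : probability (ell1_borel R) R) :=
  exists dO (O : measurableType dO) (P : probability O R)
    (Nk : nat -> {mfun O >-> nat}) (X : {mfun O >-> ell1_borel R}),
  [/\ mutually_independent P (fun k => Nk k : O -> nat),
      forall k A, distribution P (Nk k) A =
                  poisson_prob (volume N * q k.+1) 0 A,
      {ae P, forall w, forall k,
         (X w : ell1 R) k = (Nk k w)%:R / volume N}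
    & forall A, measurable A -> nu A = distribution P X A].

(* mathcomp's ln 0 = 0, so the terms with x k = 0 vanish. *)
Definition rate_free (x : ell1 R) : \bar R :=
  if `[< forall k, 0 <= x k >] then
    (\sum_(0 <= k <oo) (x k * (ln (x k / free_weight k.+1) - 1))%:E
     + total_free_weight%:E)%E
  else +oo%E.

Definition H_CMF (x : ell1 R) : R := a / 2 * limn (series x) ^+ 2.

Definition nu_CMF (nu : nat -> probability (ell1_borel R) R) N
    (A : set (ell1 R)) : \bar R :=
  let w (x : ell1_borel R) := (expR (- (volume N * beta * H_CMF x)))%:E in
  ((\int[nu N]_(x in (A : set (ell1_borel R))) w x) / \int[nu N]_x w x)%E.

Definition rate_CMF (x : ell1 R) : \bar R :=
  ((beta * H_CMF x)%:E + rate_free x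
   - ereal_inf [set (beta * H_CMF y)%:E + rate_free y | y in [set: ell1 R]])%E.

End model.

Definition large_deviation_principle {R : realType} {E : topologicalType}
    (P : nat -> set E -> \bar R) (speed : nat -> R) (I : E -> \bar R) :=
  [/\ speed @ \oo --> +oo,
      (forall x, 0 <= I x)%E /\ lower_semicontinuous I,
      forall F : set E, closed F ->
        (limn_esup (fun n => (speed n)^-1%:E * lne (P n F))
         <= - ereal_inf (I @` F))%E
    & forall G : set E, open G ->
        (- ereal_inf (I @` G)
         <= limn_einf (fun n => (speed n)^-1%:E * lne (P n G)))%E].

(* Main.v *)
(* Put v = |Lambda_N|.  An exponential tilt (Chernoff) turns the Poisson law of
   mean v q into the one of mean v q e^th; this gives upper and lower estimates
   exp(- v (x log (x / q) - x + q)) for one rescaled entry to be near x.  By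
   independence they extend to finitely many entries, and the entries beyond an
   index K have a Poisson sum of mean v (q_K + q_(K+1) + ...), which is
   negligible for K large.  Since I_mu is the supremum of continuous Legendre
   functionals depending on finitely many entries, each point has a
   neighbourhood with the right upper bound; the sets defined by uniform tail
   bounds are compact in l1 and carry all but an exponentially small mass, so
   the bound extends to closed sets.  The density exp(- v beta H) is a bounded
   continuous tilt, which is carried along in the local estimates.

   Only two facts on the weights are needed: q_k^(bc) <= C q_k for all k, and
   q_k^(bc) -> q_k for each k as N -> oo.  For periodic boundary conditions the
   images z <> 0 contribute at most O(exp(- N^2 / (k beta))) with k <= N.  For
   Dirichlet ones the kernel on the diagonal is at most the free one, and it is
   almost equal to it far from the boundary: the probability that a Brownian
   motion ends in a small cube of side rho and leaves the box before is bounded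
   by chaining over dyadic times, each increment being conditioned on the
   endpoint through an independent increment over a time t / 2, which keeps the
   factor rho^d. *)

Require Import Defs.
From mathcomp Require Import all_boot all_order all_algebra.
From mathcomp Require Import all_classical all_reals all_analysis.
From mathcomp Require Import measurable_realfun ring lra.

Set Implicit Arguments.
Unset Strict Implicit.
Unset Printing Implicit Defensive.

Import Order.TTheory GRing.Theory Num.Theory.
Import numFieldNormedType.Exports.

Local Open Scope classical_set_scope.
Local Open Scope ring_scope.

(** * Poisson estimates *)

(** The large deviations are proved for abstract weights [qN], a scale [v] and a nonnegative
    continuous [phi]; the kernels enter only through [bc_weights]. The normalising constant is the
    mass of the whole space, which is both open and closed, so the two bounds apply to it as they
    stand and produce the infimum in the rate function. The local upper bound is uniform over all
    measurable subsets of a neighbourhood, because the finite cover extracted by compactness is made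
    disjoint before integrating. The Dirichlet kernel is known only through its integrals and its
    continuity. Its value at (x, x) is recovered by dividing the probability of ending in a cube of
    side rho at x by rho^d and letting rho tend to 0. An exit estimate without the factor rho^d
    would blow up in this division, which is why the endpoint has to be kept in every event of the
    chaining argument. *)

Section poisson_estimates.
Context {R : realType}.
Implicit Types (lam th c x q del : R) (A : set nat).

Lemma nat_esumZl A (f : nat -> R) c : 0 <= c -> (forall n, 0 <= f n) ->
  (\esum_(n in A) (c * f n)%:E = c%:E * \esum_(n in A) (f n)%:E)%E.
Proof.
move=> c0 f0; rewrite (esum_mkcond A) [in RHS]esum_mkcond.
have g0 n : (0 <= if n \in A then (f n)%:E else 0)%E.
  by case: ifP => _ //; rewrite lee_fin.
rewrite -!nneseries_esumT//; last first.
  by move=> n; case: ifP => _ //; rewrite lee_fin mulr_ge0.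
rewrite -nneseriesZl//.
by apply: eq_eseriesr => n _; case: ifP => _; rewrite ?mule0.
Qed.

Lemma poisson_pmf_tilt lam th n : 0 < lam ->
  poisson_pmf lam n = expR (lam * (expR th - 1)) *
    (expR (- (th * n%:R)) * poisson_pmf (lam * expR th) n).
Proof.
move=> lam0; rewrite /poisson_pmf lam0 mulr_gt0// ?expR_gt0//.
rewrite exprMn -expRM_natr expRN mulrBr mulr1 expRD !expRN.
have := expR_gt0 (th * n%:R); have := expR_gt0 (lam * expR th).
by move=> h1 h2; field; rewrite ?gt_eqF ?expR_gt0 ?ltr0n ?fact_gt0.
Qed.

(* Chernoff's bound: the weight [expR (th * n)] turns the Poisson law of
   parameter [lam] into a multiple of that of parameter [lam * expR th]. *)
Lemma poisson_tilt_le lam th c A : 0 <= lam ->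
  (forall n, A n -> c <= th * n%:R) ->
  (poisson_prob lam 0 A <= (expR (lam * (expR th - 1) - c))%:E)%E.
Proof.
rewrite le_eqVlt => /predU1P[<-|lam0] Ac.
  (* At parameter 0 [poisson_prob] is the Dirac mass at its second argument, here 0, and [Ac] at n =
     0 gives c <= 0. *)
  rewrite /poisson_prob ltxx mul0r sub0r diracE lee_fin.
  case: (boolP (0%N \in A)) => [|_]; last by rewrite expR_ge0.
  by move=> /set_mem/Ac; rewrite mulr0 => c0; rewrite -expR0 ler_expR lerNr oppr0.
rewrite /poisson_prob lam0.
have lam1 : 0 < lam * expR th by rewrite mulr_gt0 ?expR_gt0.
apply: (@le_trans _ _ (\esum_(n in A)
    (expR (lam * (expR th - 1) - c) * poisson_pmf (lam * expR th) n)%:E)%E).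
  apply: le_esum => n An; rewrite lee_fin (poisson_pmf_tilt th n lam0) mulrA -expRD.
  by rewrite ler_wpM2r ?poisson_pmf_ge0// ler_expR lerD2l lerN2 Ac.
rewrite nat_esumZl ?expR_ge0//; last by move=> n; exact: poisson_pmf_ge0.
rewrite -[leRHS]mule1 lee_pmul2l ?lte_fin ?expR_gt0//.
have : (poisson_prob (lam * expR th) 0 A <= 1)%E by exact: probability_le1.
by rewrite /poisson_prob lam1.
Qed.

(** The same change of measure, bounded below on A. It is useful when A is a window around the mean
    of the tilted law, where the probability on the left does not vanish. *)
Lemma poisson_tilt_ge lam th c A : 0 < lam ->
  (forall n, A n -> th * n%:R <= c) ->
  ((expR (lam * (expR th - 1) - c))%:E * poisson_prob (lam * expR th) 0 A <=
    poisson_prob lam 0 A)%E.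
Proof.
move=> lam0 Ac; rewrite /poisson_prob lam0 mulr_gt0 ?expR_gt0//.
rewrite -nat_esumZl ?expR_ge0//; last by move=> n; exact: poisson_pmf_ge0.
apply: le_esum => n An; rewrite lee_fin (poisson_pmf_tilt th n lam0) mulrA -expRD.
by rewrite ler_wpM2r ?poisson_pmf_ge0// ler_expR lerD2l lerN2 Ac.
Qed.

(** From 1 - x <= exp(-x) one gets exp(x) (1 - x) <= 1, while (1 + x + 2 x^2)(1 - x) = 1 + x^2 (1 -
    2 x) >= 1. *)
Lemma expR_le_quad x : x <= 2^-1 -> expR x <= 1 + x + 2 * x ^+ 2.
Proof.
move=> x12; have h := expR_ge1Dx (- x).
have e0 := expR_gt0 x.
have : expR x * (1 - x) <= 1.
  by rewrite -[leRHS](expRxMexpNx_1 x) ler_pM2l.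
move=> h2; have x1 : 0 < 1 - x by lra.
rewrite -(ler_pM2r x1); apply: (le_trans h2).
have : 0 <= x ^+ 2 * (1 - 2 * x) by rewrite mulr_ge0 ?sqr_ge0//; lra.
move=> h3; apply: le_trans (_ : 1 + x ^+ 2 * (1 - 2 * x) <= _); first lra.
by rewrite le_eqVlt; apply/orP; left; apply/eqP; ring.
Qed.

(** A constant lower bound is enough, since it disappears at exponential scale. Chernoff's bound
    with slopes t and -t leaves at most 1/4 on each side. *)
Lemma poisson_concentration x del : 0 < x -> 0 < del ->
  exists2 v0 : R, 0 < v0 & forall v, v0 <= v ->
    (2^-1%:E <= poisson_prob (v * x) 0 [set n : nat | (`|n%:R / v - x| < del)%R])%E.
Proof.
(* The bound 1/2 allows [expR_le_quad] for both signs; del / (4 x) makes the error 2 x t^2 at most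
   half of the gain t del. The other half, multiplied by v, reaches ln 4 from the threshold below
   on. *)
move=> x0 del0; pose t := Num.min 2^-1 (del / (4 * x)).
have t0 : 0 < t by rewrite lt_min invr_gt0 ltr0n/= divr_gt0// mulr_gt0.
have t2 : t <= 2^-1 by rewrite ge_min lexx.
have tx : t * (4 * x) <= del.
  by rewrite -ler_pdivlMr ?mulr_gt0// ge_min lexx orbT.
have td0 : 0 < t * del by rewrite mulr_gt0.
exists (2 * ln 4 / (t * del)).
  by rewrite divr_gt0// mulr_gt0// ln_gt0// ltr1n.
move=> v vge.
have l4 : 0 < ln (4 : R) by rewrite ln_gt0// ltr1n.
have v0 : 0 < v by rewrite (lt_le_trans _ vge)// divr_gt0// mulr_gt0.
have vx0 : 0 <= v * x by rewrite mulr_ge0 ?ltW.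
have half (s : R) (e : R) : s ^+ 2 = 1 -> e = v * x * (expR (s * t) - 1)
     - v * (s * t * x + t * del) -> expR e <= 4^-1.
  move=> s1 ->; rewrite -[leRHS]lnK ?posrE ?invr_gt0// ler_expR lnV ?posrE//.
  have sb : s * t <= 2^-1.
    have : `|s| = 1 by apply/eqP; rewrite -(@eqrXn2 _ 2)// ?real_normK ?s1 ?expr1n// num_real.
    by have := ler_norm s => h h'; apply: le_trans t2; rewrite -[leRHS]mul1r ler_pM2r// -h'.
  have := expR_le_quad sb; rewrite exprMn s1 mul1r => he.
  have : t * del * v >= 2 * ln 4.
    by move: vge; rewrite ler_pdivrMr// [leRHS]mulrC.
  move=> hv.
  have h1 : v * x * (expR (s * t) - 1) <= v * x * (s * t + 2 * t ^+ 2).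
    by rewrite ler_wpM2l//; lra.
  have h2 : v * t * (t * (4 * x)) <= v * t * del.
    by rewrite ler_wpM2l// mulr_ge0// ltW.
  by move: hv h1 h2; lra.
have up : (poisson_prob (v * x) 0 [set n : nat | (x + del <= n%:R / v)%R] <= (4^-1)%:E)%E.
  apply: (le_trans (@poisson_tilt_le _ t (v * (t * x + t * del)) _ vx0 _)).
    move=> n /=; rewrite ler_pdivlMr// => h.
    by rewrite -mulrDr mulrCA ler_pM2l// mulrC.
  by rewrite lee_fin; apply: (half 1); rewrite ?expr1n ?mul1r.
have down : (poisson_prob (v * x) 0 [set n : nat | (n%:R / v <= x - del)%R] <= (4^-1)%:E)%E.
  apply: (le_trans (@poisson_tilt_le _ (- t) (v * (- t * x + t * del)) _ vx0 _)).
    move=> n /=; rewrite ler_pdivrMr// => h.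
    by have := ler_wpM2l (ltW t0) h; lra.
  by rewrite lee_fin; apply: (half (-1)); rewrite ?sqrrN ?expr1n ?mulN1r.
pose B := [set n : nat | x + del <= n%:R / v] `|` [set n : nat | n%:R / v <= x - del].
rewrite (_ : [set n | _] = ~` B); last first.
  apply/seteqP; split => n /=; rewrite ltr_norml /B /=.
    by move=> /andP[h1 h2] []; lra.
  by move=> /not_orP[/negP h1 /negP h2]; rewrite -!ltNge in h1 h2; lra.
rewrite [leRHS](_ : _ = 1 - poisson_prob (v * x) 0 B)%E; last first.
  by rewrite -(@probability_setC _ _ _ (poisson_prob (v * x) 0)).
have hB : (poisson_prob (v * x) 0 B <= 2^-1%:E)%E.
  apply: (le_trans (measureU2 (poisson_prob (v * x) 0) _ _)) => //.
  apply: (le_trans (leeD up down)); rewrite -EFinD lee_fin; lra.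
have fB : poisson_prob (v * x) 0 B \is a fin_num.
  by apply: (@fin_num_measure _ _ _ (poisson_prob (v * x) 0)).
rewrite -(fineK fB) in hB *; rewrite -EFinB lee_fin.
by rewrite lee_fin in hB; lra.
Qed.

End poisson_estimates.

(** The Cramer rate function of the Poisson law of mean q, that is x log(x / q) - x + q. At x = 0 it
    equals q. *)
Definition entropy {R : realType} (q x : R) : R := x * (ln (x / q) - 1) + q.

Section poisson_local.
Context {R : realType} (q : R) (qn v : nat -> R).
Hypotheses (q0 : 0 < q) (qnq : qn @ \oo --> q) (vy : v @ \oo --> +oo).

Local Notation window n x del :=
  [set k : nat | (`|k%:R / v n - x| < del)%R].

Implicit Types x th m del : R.

Let qn_gt0 : \forall n \near \oo, 0 < qn n.
Proof. by apply: (cvgr_gt q). Qed.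

Let v_gt0 : \forall n \near \oo, 0 < v n.
Proof. by move/cvgryPgt : vy; exact. Qed.

(** Stated with an arbitrary slope instead of the entropy, so that it also covers x = 0, where no
    slope is optimal, and x < 0, where the rate is infinite. *)
Lemma poisson_local_upper x th m : m < th * x - q * (expR th - 1) ->
  exists2 del : R, 0 < del & \forall n \near \oo,
    (poisson_prob (v n * qn n) 0 (window n x del)
      <= (expR (- (v n * m)))%:E)%E.
Proof.
move=> hm; pose g := th * x - q * (expR th - 1) - m.
have g0 : 0 < g by rewrite subr_gt0.
have th1 : 0 < 2 * (`|th| + 1) by rewrite mulr_gt0// ltr_wpDl.
(* In this window th k / v differs from th x by at most g / 2; the other half of the gap g pays for
   replacing [qn n] by q. *)
exists (g / (2 * (`|th| + 1))); first by rewrite divr_gt0.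
have hq : \forall n \near \oo, qn n * (expR th - 1) < q * (expR th - 1) + g / 2.
  apply: (cvgr_lt (q * (expR th - 1))); last by rewrite ltrDl divr_gt0.
  by apply: cvgMl.
near=> n.
have vn : 0 < v n by near: n; exact: v_gt0.
have qn0 : 0 < qn n by near: n; exact: qn_gt0.
have lam0 : 0 <= v n * qn n by rewrite mulr_ge0 ?ltW.
apply: (le_trans (@poisson_tilt_le _ _ th (v n * (th * x - g / 2)) _ lam0 _)).
  move=> k /= hk.
  have k1 : `|th * (k%:R / v n - x)| <= g / 2.
    rewrite normrM (le_trans (ler_wpM2l _ (ltW hk)))//.
    rewrite -subr_ge0 [leRHS](_ : _ = g / (2 * (`|th| + 1))); last first.
      by field; rewrite gt_eqF// ltr_wpDl.
    by rewrite divr_ge0 ?ltW.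
  have -> : th * k%:R = v n * (th * x + th * (k%:R / v n - x)).
    by field; rewrite gt_eqF.
  rewrite ler_pM2l//; move: k1; rewrite ler_norml => /andP[]; lra.
rewrite lee_fin ler_expR -[leRHS]mulrN.
rewrite [leLHS](_ : _ = v n * (qn n * (expR th - 1) - (th * x - g / 2))); last by ring.
rewrite ler_pM2l//.
have : qn n * (expR th - 1) < q * (expR th - 1) + g / 2 by near: n.
by rewrite /g; lra.
Unshelve. all: by end_near. Qed.

(** For x > 0 the slope ln (x / qn) makes the tilted mean exactly v x, so that
    [poisson_concentration] applies. At x = 0 this slope would be infinite, but the atom at 0
    already has mass exp(- v qn). *)
Lemma poisson_local_lower x m del : 0 <= x -> entropy q x < m -> 0 < del ->
  \forall n \near \oo, ((expR (- (v n * m)))%:E <=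
    poisson_prob (v n * qn n) 0 (window n x del))%E.
Proof.
rewrite le_eqVlt => /predU1P[<-|x0] hm del0.
  rewrite /entropy mul0r add0r in hm.
  near=> n.
  have vn : 0 < v n by near: n; exact: v_gt0.
  have qn0 : 0 < qn n by near: n; exact: qn_gt0.
  have lam0 : 0 < v n * qn n by rewrite mulr_gt0.
  rewrite /poisson_prob lam0; apply: esum_ge.
  exists [set 0%N].
    by split; [exact: finite_set1|move=> k ->; rewrite /= mul0r subrr normr0].
  rewrite fsbig_set1 /poisson_pmf lam0.
  rewrite fact0 invr1 mulr1 expr0 mul1r lee_fin ler_expR lerN2 ler_pM2l//.
  by near: n; apply: (cvgr_le q).
pose th := ln (x / q); pose g := m - entropy q x.
have g0 : 0 < g by rewrite subr_gt0.
pose thn n := ln (x / qn n).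
have thnth : thn @ \oo --> th.
  apply: continuous_cvg; first by apply: continuous_ln; rewrite divr_gt0.
  by apply: cvgM; [exact: cvg_cst|apply: cvgV => //; rewrite gt_eqF].
have entn : (fun n => entropy (qn n) x) @ \oo --> entropy q x.
  apply: cvgD => //; apply: cvgM; first exact: cvg_cst.
  by apply: cvgB => //; exact: cvg_cst.
(* The gap g is spent as g / 4 on the window, g / 4 on the convergence of the entropies, and g / 2
   on the factor 1/2 of the concentration bound. *)
pose del' := Num.min del (g / (4 * (`|th| + 1))).
have th1 : 0 < `|th| + 1 by rewrite ltr_wpDl.
have del'0 : 0 < del' by rewrite lt_min del0/= divr_gt0// mulr_gt0.
have [v0 v00 hv0] := poisson_concentration x0 del'0.
have vbig : \forall n \near \oo, v0 + ln 2 / (g / 2) <= v n.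
  by move/cvgryPge : vy; exact.
have hn1 : \forall n \near \oo, `|thn n| < `|th| + 1.
  by apply: (cvgr_lt `|th|); [exact: cvg_norm|rewrite ltrDl].
near=> n.
have vn : 0 < v n by near: n; exact: v_gt0.
have qn0 : 0 < qn n by near: n; exact: qn_gt0.
have lam0 : 0 < v n * qn n by rewrite mulr_gt0.
have l2 : 0 < ln 2 / (g / 2) by rewrite divr_gt0 ?divr_gt0// ln_gt0// ltr1n.
have vnb : v0 + ln 2 / (g / 2) <= v n by near: n.
apply: (@le_trans _ _ (poisson_prob (v n * qn n) 0 (window n x del'))); last first.
  apply: (le_measure (poisson_prob (v n * qn n) 0)); rewrite ?inE//.
  by move=> k /= /lt_le_trans; apply; rewrite ge_min lexx.
have e1 : expR (thn n) = x / qn n by rewrite lnK// posrE divr_gt0.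
apply: le_trans (@poisson_tilt_ge _ _ (thn n) (v n * (thn n * x + g / 4)) _ lam0 _); last first.
  move=> k /= hk.
  have k1 : `|thn n * (k%:R / v n - x)| <= g / 4.
    rewrite normrM; have h1 : `|k%:R / v n - x| <= g / (4 * (`|th| + 1)).
      by rewrite (le_trans (ltW hk))// ge_min lexx orbT.
    have h2 : `|thn n| <= `|th| + 1 by apply: ltW; near: n.
    rewrite (le_trans (ler_pM _ _ h2 h1))//.
    by rewrite le_eqVlt; apply/orP; left; apply/eqP; field; rewrite gt_eqF.
  have -> : thn n * k%:R = v n * (thn n * x + thn n * (k%:R / v n - x)).
    by field; rewrite gt_eqF.
  by rewrite ler_pM2l//; move: k1; rewrite ler_norml => /andP[]; lra.
have -> : v n * qn n * expR (thn n) = v n * x.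
  by rewrite e1; field; rewrite gt_eqF.
apply: (@le_trans _ _ ((expR (v n * qn n * (expR (thn n) - 1) -
    v n * (thn n * x + g / 4)))%:E * 2^-1%:E)%E); last first.
  rewrite lee_pmul2l ?lte_fin ?expR_gt0//; apply: hv0.
  by apply: le_trans vnb; rewrite lerDl ltW.
rewrite -EFinM lee_fin -[X in _ <= _ * X^-1](@lnK _ 2) ?posrE// -expRN -expRD ler_expR.
have h3 : entropy (qn n) x <= entropy q x + g / 4.
  by near: n; apply: (cvgr_le (entropy q x)) => //; rewrite ltrDl divr_gt0.
have h4 : ln 2 <= v n * (g / 2).
  by rewrite -ler_pdivrMr ?divr_gt0//; apply: le_trans vnb; rewrite lerDr ltW.
have h5 : v n * qn n * (expR (thn n) - 1) - v n * (thn n * x + g / 4) =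
   - (v n * (entropy (qn n) x + g / 4)).
  by rewrite e1 /entropy -/(thn n); field; rewrite gt_eqF.
rewrite h5; have : v n * entropy (qn n) x <= v n * (entropy q x + g / 4).
  by rewrite ler_pM2l.
by rewrite /g in h4 *; lra.
Unshelve. all: by end_near. Qed.

End poisson_local.

Section entropy.
Context {R : realType}.
Implicit Types q x th m : R.

(** Young's inequality: multiply 1 + u <= exp(u) by x, at u = th - ln (x / q). *)
Lemma entropy_ge q x th : 0 < q -> 0 <= x ->
  th * x - q * (expR th - 1) <= entropy q x.
Proof.
move=> q0; rewrite le_eqVlt => /predU1P[<-|x0]; rewrite /entropy.
  by rewrite mul0r mulr0; have := expR_gt0 th; nra.
have h := expR_ge1Dx (th - ln (x / q)).
have : x * (1 + (th - ln (x / q))) <= x * expR (th - ln (x / q)).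
  by rewrite ler_pM2l.
rewrite expRB lnK ?posrE ?divr_gt0//.
have -> : x * (expR th / (x / q)) = q * expR th by field; rewrite !gt_eqF.
by lra.
Qed.

Lemma entropy_ge0 q x : 0 < q -> 0 <= x -> 0 <= entropy q x.
Proof.
by move=> q0 x0; apply: le_trans (entropy_ge 0 q0 x0); rewrite expR0 mul0r subrr mulr0 subr0.
Qed.

Lemma lt_entropy q x m : 0 < q -> 0 <= x -> m < entropy q x ->
  exists th, m < th * x - q * (expR th - 1).
Proof.
move=> q0; rewrite le_eqVlt => /predU1P[<-|x0]; rewrite /entropy.
  rewrite mul0r add0r => mq.
  (* At x = 0 the supremum q is only approached as th tends to minus infinity; this slope gives (q +
     m) / 2, halfway from m to q. *)
  exists (ln ((q - m) / (2 * q))).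
  rewrite mulr0 lnK ?posrE ?divr_gt0 ?mulr_gt0// ?subr_gt0//.
  have -> : q * ((q - m) / (2 * q) - 1) = (q - m) / 2 - q by field; rewrite gt_eqF.
  by lra.
exists (ln (x / q)); rewrite lnK ?posrE ?divr_gt0//.
have -> : q * (x / q - 1) = x - q by field; rewrite gt_eqF.
by lra.
Qed.

(** A steep negative slope makes th x as large as desired while the other term stays nonnegative.
    Hence the Legendre functionals also detect a negative entry, where the rate is infinite. *)
Lemma lt_neg_tilt q x m : 0 < q -> x < 0 ->
  exists th, m < th * x - q * (expR th - 1).
Proof.
move=> q0 x0; pose t := (`|m| + 1) / x.
have t0 : t <= 0 by rewrite /t pmulr_rle0 ?invr_le0 ?ltW// ltr_wpDl.
exists t; rewrite /t divfK ?lt_eqF// -/t.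
have : q * (expR t - 1) <= 0 by rewrite pmulr_rle0// subr_le0 expR_le1.
by have := ler_norm m; lra.
Qed.

End entropy.

(** * The rate function on l1 *)

Section ell1_functionals.
Context {R : realType}.
Implicit Types (x y : ell1 R) (k K : nat).

Lemma ell1_sum_cvg x : cvgn (series x).
Proof. exact: (@normed_cvg _ R^o x (@ell1_cvg _ x)). Qed.

Lemma ell1_partial_le x K M : \sum_(K <= k < M) `|x k| <= `|x|.
Proof.
apply: le_trans (nondecreasing_cvgn_le _ (@ell1_cvg _ x) (maxn K M)).
  rewrite /series /= [leRHS](big_cat_nat (n := K))//= ?leq_maxl//.
  rewrite -[leLHS]add0r lerD ?sumr_ge0//.
  case: (leqP K M) => KM //; last by rewrite big_geq ?sumr_ge0// ltnW.
by apply: nondecreasing_series => n _ _.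
Qed.

Lemma ell1_coord_le x k : `|x k| <= `|x|.
Proof. by have := ell1_partial_le x k k.+1; rewrite big_nat1. Qed.

Lemma ell1_norm_le x (c : R) : (forall M, \sum_(0 <= k < M) `|x k| <= c) -> `|x| <= c.
Proof.
move=> h; apply: limr_le; first exact: (@ell1_cvg _ x).
by near=> M; exact: h.
Unshelve. all: by end_near. Qed.

Definition ell1_sum x : R := limn (series x).

Lemma ell1_sumB x y : ell1_sum (x - y) = ell1_sum x - ell1_sum y.
Proof.
rewrite /ell1_sum -limB; [|exact: ell1_sum_cvg..].
congr (limn _); apply/funext => n; rewrite /series/= fctE -sumrB.
by apply: eq_bigr.
Qed.

Lemma ell1_sum_le x : `|ell1_sum x| <= `|x|.
Proof. exact: (@lim_series_norm _ R^o x (@ell1_cvg _ x)). Qed.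

Lemma lipschitz1_continuous (f : ell1 R -> R) :
  (forall x y, `|f x - f y| <= `|x - y|) -> continuous f.
Proof.
move=> fl x.
apply: (proj2 (@cvgrPdist_lt _ _ _ (nbhs x) (nbhs_filter x) f (f x))) => e e0.
near=> y; apply: (le_lt_trans (fl _ _)).
by near: y; apply: cvgr_dist_lt e0.
Unshelve. all: by end_near. Qed.

Lemma coord_continuous k : continuous (fun x : ell1 R => x k).
Proof. by apply: lipschitz1_continuous => x y; exact: (ell1_coord_le (x - y)). Qed.

Lemma ell1_sum_continuous : continuous ell1_sum.
Proof.
by apply: lipschitz1_continuous => x y; rewrite -ell1_sumB ell1_sum_le.
Qed.

End ell1_functionals.

(** [rate_free] for an arbitrary weight sequence; at the free weights the two are convertible. *)
Definition poisson_rate {R : realType} (q : nat -> R) (x : ell1 R) : \bar R :=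
  if `[< forall k, 0 <= x k >] then
    (\sum_(0 <= k <oo) (x k * (ln (x k / q k) - 1))%:E
     + (limn (series q))%:E)%E
  else +oo%E.

(* [poisson_rate] is the supremum of these functionals (Legendre duality). *)
Definition legendre {R : realType} (q th : nat -> R) (K : nat) (x : ell1 R) : R :=
  \sum_(0 <= k < K) (th k * x k - q k * (expR (th k) - 1)).

Section poisson_rate.
Context {R : realType} (q : nat -> R).
Hypotheses (q0 : forall k, 0 < q k) (qs : cvgn (series q)).
Implicit Types (x y : ell1 R) (k K : nat) (th : nat -> R).

(** The terms of the defining series have no fixed sign. Adding q k makes each of them nonnegative,
    and since the sum of the q k is finite it can be taken out again without meeting an
    indeterminate form. *)
Lemma poisson_rateE x : (forall k, 0 <= x k) ->
  poisson_rate q x = (\sum_(0 <= k <oo) (entropy (q k) (x k))%:E)%E.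
Proof.
move=> x0; rewrite /poisson_rate asboolT//.
have cT : cvgn (fun n => (\sum_(0 <= k < n) (entropy (q k) (x k))%:E)%E).
  by apply: is_cvg_nneseries => n _ _; rewrite lee_fin entropy_ge0.
have cQ : (fun n => (series q n)%:E) @ \oo --> (limn (series q))%:E.
  by apply: cvg_EFin; [exact: nearW|exact: qs].
have -> : (fun n => \sum_(0 <= k < n) (x k * (ln (x k / q k) - 1))%:E)%E =
   (fun n => (\sum_(0 <= k < n) (entropy (q k) (x k))%:E) - (series q n)%:E)%E.
  apply/funext => n; rewrite !sumEFin -EFinB; congr (_%:E).
  by rewrite /series /= -sumrB; apply: eq_bigr => k _; rewrite /entropy addrK.
rewrite (cvg_lim _ (cvgeB _ cT cQ))//; last by rewrite fin_num_adde_defl.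
by rewrite subeK.
Qed.

Lemma poisson_rate_ge0 x : (0 <= poisson_rate q x)%E.
Proof.
have [x0|nx0] := pselect (forall k, 0 <= x k).
  by rewrite poisson_rateE// nneseries_ge0// => n _ _; rewrite lee_fin entropy_ge0.
by rewrite /poisson_rate asboolF.
Qed.

Lemma legendre_continuous th K : continuous (legendre q th K).
Proof.
move=> x; have FF := nbhs_filter x.
elim: K => [|K IH].
  rewrite (_ : legendre q th 0 = cst 0); first exact: cvg_cst.
  by apply/funext => y; rewrite /legendre big_geq.
rewrite (_ : legendre q th K.+1 = (fun y : ell1 R => legendre q th K y +
    (th K * y K - q K * (expR (th K) - 1)))); last first.
  by apply/funext => y; rewrite /legendre big_nat_recr.
apply: cvgD => //; apply: cvgB; last exact: cvg_cst.
by apply: cvgMr; exact: coord_continuous.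
Qed.

Lemma legendre_le_rate th K x : ((legendre q th K x)%:E <= poisson_rate q x)%E.
Proof.
have [x0|nx0] := pselect (forall k, 0 <= x k); last first.
  by rewrite /poisson_rate asboolF// leey.
rewrite poisson_rateE//.
apply: le_trans (nneseries_lim_ge K _); last first.
  by move=> n _ _; rewrite lee_fin entropy_ge0.
by rewrite sumEFin lee_fin ler_sum// => k _; exact: entropy_ge.
Qed.

(** A partial sum of entropies already exceeds m, and each of its terms is nearly attained by some
    slope. If an entry is negative, a slope at that index alone suffices. *)
Lemma lt_poisson_rate x (m : R) : (m%:E < poisson_rate q x)%E ->
  exists th K, m < legendre q th K x.
Proof.
have [x0|/existsNP[k /negP]] := pselect (forall k, 0 <= x k); last first.
  rewrite -ltNge => xk _; have [t mt] := lt_neg_tilt m (q0 k) xk.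
  exists (fun j => if j == k then t else 0), k.+1.
  rewrite /legendre big_nat_recr//= eqxx big_nat big1 ?add0r// => i /andP[_ ik].
  by rewrite lt_eqF// expR0 mul0r subrr mulr0 subr0.
rewrite poisson_rateE// => hm.
have ent0 n : (0 <= (entropy (q n) (x n))%:E)%E by rewrite lee_fin entropy_ge0.
have [K hK] : exists K, (m%:E < \sum_(0 <= k < K) (entropy (q k) (x k))%:E)%E.
  apply: contrapT => /forallNP h.
  have : (\sum_(0 <= k <oo) (entropy (q k) (x k))%:E <= m%:E)%E.
    apply: lime_le; first by apply: is_cvg_nneseries => n _ _; exact: ent0.
    by near=> n; rewrite leNgt; apply/negP; exact: h.
  by rewrite leNgt hm.
rewrite sumEFin lte_fin in hK.
(* One share more than there are terms, so that the K losses do not use up the whole gap and K = 0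
   causes no division by zero. *)
pose g := (\sum_(0 <= k < K) entropy (q k) (x k) - m) / (K.+1)%:R.
have g0 : 0 < g by rewrite divr_gt0// subr_gt0.
have /choice[th hth] k : exists t, entropy (q k) (x k) - g <
    t * x k - q k * (expR t - 1).
  by apply: lt_entropy => //; rewrite ltrBlDr ltrDl.
exists th, K.
have : \sum_(0 <= k < K) (entropy (q k) (x k) - g) <= legendre q th K x.
  by apply: ler_sum => k _; exact: ltW.
apply: lt_le_trans; rewrite sumrB sumr_const_nat subn0.
have : g *+ K.+1 = \sum_(0 <= k < K) entropy (q k) (x k) - m.
  by rewrite -mulr_natr /g divfK// pnatr_eq0.
by rewrite mulrS; lra.
Unshelve. all: by end_near. Qed.

End poisson_rate.

Lemma lee_prod {R : realType} (I : Type) (s : seq I) (P : pred I) (F G : I -> \bar R) :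
  (forall i, P i -> (0 <= F i)%E) -> (forall i, P i -> (F i <= G i)%E) ->
  (\prod_(i <- s | P i) F i <= \prod_(i <- s | P i) G i)%E.
Proof.
move=> F0 FG.
suff /andP[] : (0 <= \prod_(i <- s | P i) F i <= \prod_(i <- s | P i) G i)%E by [].
apply: (big_ind2 (fun x y : \bar R => (0 <= x <= y)%E)).
- by rewrite lexx lee_fin ler01.
- move=> x1 x2 y1 y2 /andP[x0 xy] /andP[y0 yy].
  by rewrite mule_ge0//= lee_pmul.
- by move=> i Pi; rewrite F0// FG.
Qed.

Lemma lee_prod_nat {R : realType} m n (F G : nat -> \bar R) :
  (forall i, (m <= i < n)%N -> (0 <= F i)%E) ->
  (forall i, (m <= i < n)%N -> (F i <= G i)%E) ->
  (\prod_(m <= i < n) F i <= \prod_(m <= i < n) G i)%E.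
Proof.
by move=> F0 FG; rewrite big_nat [leRHS]big_nat; apply: lee_prod.
Qed.

(** * Random sequences with independent Poisson entries *)

Section poisson_sums.
Context {R : realType}.
Implicit Types a b lam : R.

Lemma poisson_prob1 lam s : 0 <= lam ->
  poisson_prob lam 0 [set s] = (expR (- lam) * (lam ^+ s / s`!%:R))%:E.
Proof.
rewrite le_eqVlt => /predU1P[<-|lam0]; rewrite /poisson_prob.
  rewrite ltxx oppr0 expR0 mul1r diracE; case: s => [|s].
    by rewrite expr0 fact0 divr1 mem_set.
  by rewrite expr0n mul0r memNset.
rewrite lam0 esum_set1 ?lee_fin ?poisson_pmf_ge0//.
by rewrite /poisson_pmf lam0 mulrC.
Qed.

Lemma poisson_convolution a b s : 0 <= a -> 0 <= b ->
  (\sum_(j < s.+1) poisson_prob a 0 [set (j : nat)] *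
     poisson_prob b 0 [set (s - j)%N] = poisson_prob (a + b) 0 [set s])%E.
Proof.
move=> a0 b0; rewrite poisson_prob1 ?addr_ge0// addrC exprDn.
under eq_bigr do rewrite !poisson_prob1// -EFinM.
rewrite sumEFin; congr (_%:E); rewrite mulr_suml mulr_sumr.
apply: eq_bigr => -[j js] _ /=; rewrite ltnS in js.
rewrite opprD expRD -(bin_fact js) !natrM.
have := bin_gt0 s j; rewrite js => C0.
rewrite -mulr_natr; field.
by rewrite !pnatr_eq0 -!lt0n C0 !fact_gt0.
Qed.

End poisson_sums.

Section cycle_law.
Context {R : realType} {dO} {O : measurableType dO} (P : probability O R).
Variables (v : R) (lam : nat -> R).
Variables (Nk : nat -> {mfun O >-> nat}) (X : {mfun O >-> ell1_borel R}).
Hypotheses (v0 : 0 < v) (lam0 : forall k, 0 <= lam k).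
Hypothesis indN : mutually_independent P (fun k => Nk k : O -> nat).
Hypothesis lawN : forall k A, distribution P (Nk k) A = poisson_prob (lam k) 0 A.
Hypothesis aeX : {ae P, forall w, forall k, (X w : ell1 R) k = (Nk k w)%:R / v}.

Let mN k (A : set nat) : measurable (Nk k @^-1` A).
Proof. by rewrite -[X in measurable X]setTI; exact: measurable_funPT. Qed.

Lemma cycle_counts_prod (J : seq nat) (A : nat -> set nat) : uniq J ->
  P (\bigcap_(i in [set` J]) (Nk i @^-1` A i)) =
  (\prod_(i <- J) poisson_prob (lam i) 0 (A i))%E.
Proof.
move=> uJ; rewrite indN//; apply: eq_bigr => i _.
exact: lawN.
Qed.

Definition cycle_count K M (w : O) : nat := (\sum_(K <= k < M) Nk k w)%N.

Lemma measurable_cycle_count K M (A : set nat) :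
  measurable (cycle_count K M @^-1` A).
Proof.
rewrite -[X in measurable X]setTI.
suff h : measurable_fun setT (cycle_count K M) by exact: (h measurableT A).
rewrite /cycle_count; elim: (index_iota K M) => [|k s IH].
  by under eq_fun do rewrite big_nil; exact: measurable_cst.
under eq_fun do rewrite big_cons.
by apply: measurable_fun_addn => //; exact: measurable_funPT.
Qed.

(** The counts indexed by J are carried along for the induction: after fixing the value j of the
    shorter sum, the last summand must equal s - j and joins J. The convolution formula then adds up
    over j. *)
Lemma cycle_count_law_joint K n (J : seq nat) (A : nat -> set nat) s :
  uniq J -> (forall i, i \in J -> (K + n <= i)%N) ->
  P ([set w | cycle_count K (K + n) w = s] `&`
      \bigcap_(i in [set` J]) (Nk i @^-1` A i)) =
  (poisson_prob (\sum_(K <= k < K + n) lam k)%R 0 [set s] *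
   \prod_(i <- J) poisson_prob (lam i) 0 (A i))%E.
Proof.
elim: n J A s => [|n IH] J A s uJ hJ.
  rewrite addn0 [in RHS]big_geq// poisson_prob1//.
  rewrite oppr0 expR0 mul1r; case: s => [|s].
    rewrite expr0 fact0 divr1 mul1e -cycle_counts_prod//; congr (P _).
    by apply/seteqP; split => w /= => [[]//|h]; split => //; rewrite /cycle_count big_geq.
  rewrite expr0n mul0r mul0e (_ : _ `&` _ = set0) ?measure0//.
  by apply/seteqP; split => w //= -[]; rewrite /cycle_count big_geq.
pose A' j i := if i == (K + n)%N then [set (s - j)%N] else A i.
pose F (j : nat) := [set w | cycle_count K (K + n) w = j] `&`
  \bigcap_(i in [set` ((K + n)%N :: J)]) (Nk i @^-1` A' j i).
have nJ : (K + n)%N \notin J.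
  by apply/negP => /hJ; rewrite addnS ltnn.
have uJ' : uniq ((K + n)%N :: J) by rewrite /= nJ.
have hJ' i : i \in ((K + n)%N :: J) -> (K + n <= i)%N.
  by rewrite inE => /predU1P[->//|/hJ]; rewrite addnS => /ltnW.
have mF j : measurable (F j).
  apply: measurableI; last first.
    by apply: fin_bigcap_measurable => // i _; exact: mN.
  exact: (measurable_cycle_count K (K + n) [set j]).
have tF : trivIset setT F.
  by move=> i j _ _ [w [[/= <- _] [/= <- _]]].
have -> : [set w | cycle_count K (K + n.+1) w = s] `&`
    \bigcap_(i in [set` J]) (Nk i @^-1` A i) = \big[setU/set0]_(j < s.+1) F j.
  rewrite -bigcup_mkord; apply/seteqP; split => w /=.
    rewrite /cycle_count addnS big_nat_recr/= ?leq_addr// => -[ws wJ].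
    exists (cycle_count K (K + n) w); first by rewrite /= ltnS -ws leq_addr.
    split => //= i /=; rewrite inE => /predU1P[->|iJ].
      by rewrite /A' /= eqxx /= -ws /cycle_count addKn.
    rewrite /A'; case: eqP => [iE|_]; last exact: wJ.
    by move: iJ; rewrite iE (negbTE nJ).
  move=> [j /= js [wj wJ]]; split.
    rewrite /cycle_count addnS big_nat_recr/= ?leq_addr//.
    have /= := wJ (K + n)%N; rewrite /A' eqxx inE eqxx => /(_ isT) /= ->.
    by rewrite -[X in (X + _)%N]/(cycle_count K (K + n) w) wj subnKC.
  move=> i /= iJ; have /= := wJ i; rewrite /A' inE iJ orbT => /(_ isT).
  by case: eqP => [iE|//]; move: iJ; rewrite iE (negbTE nJ).
have PF j : P (F j) = (poisson_prob (\sum_(K <= k < K + n) lam k)%R 0 [set j] *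
    poisson_prob (lam (K + n)%N) 0 [set (s - j)%N] *
    \prod_(i <- J) poisson_prob (lam i) 0 (A i))%E.
  rewrite /F IH// big_cons {1}/A' eqxx muleA; congr (_ * _)%E.
  apply: eq_big_seq => i iJ; rewrite /A'; case: eqP => // iE.
  by move: iJ; rewrite iE (negbTE nJ).
rewrite measure_bigsetU//.
rewrite (eq_bigr _ (fun (j : 'I_s.+1) _ => PF j)).
rewrite addnS big_nat_recr ?leq_addr//= -poisson_convolution//; last exact: sumr_ge0.
by rewrite ge0_sume_distrl// => j _; rewrite mule_ge0.
Qed.

Lemma cycle_count_law K M (A : set nat) : (K <= M)%N ->
  P (cycle_count K M @^-1` A) = poisson_prob (\sum_(K <= k < M) lam k) 0 A.
Proof.
move=> /subnKC <-; set S := \sum_(_ <= _ < _) _.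
have E (mu : {measure set nat -> \bar R}) :
    mu A = (\sum_(i <oo | i \in A) mu [set i])%E.
  rewrite -measure_bigcup//; last by move=> i j _ _ [k [/= -> ->]].
  congr (mu _); apply/seteqP; split => i /=; first by exists i.
  by move=> [j Aj ->].
rewrite (E (poisson_prob S 0)) [LHS](_ : _ =
    (\sum_(i <oo | i \in A) P (cycle_count K (K + (M - K)) @^-1` [set i]))%E).
  apply: eq_eseriesr => i _.
  have := @cycle_count_law_joint K (M - K) [::] (fun=> setT) i isT.
  rewrite big_nil mule1 set_nil bigcap_set0 setIT => -> //.
rewrite -measure_bigcup//.
- congr (P _); apply/seteqP; split => w /= => [Aw|[j Aj /= ->//]].
  by exists (cycle_count K (K + (M - K)) w).
- by move=> i _; exact: (measurable_cycle_count K (K + (M - K)) [set i]).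
- by move=> i j _ _ [w [/= -> ->]].
Qed.

(** Transfers events about X to events about the counts; the null set where X is not the rescaled
    sequence of counts is added to F. *)
Lemma cycle_density_le (E : set (ell1_borel R)) (F : set O) :
  measurable E -> measurable F ->
  (forall w, (forall k, (X w : ell1 R) k = (Nk k w)%:R / v) -> E (X w) -> F w) ->
  (distribution P X E <= P F)%E.
Proof.
move=> mE mF EF; case: aeX => Z [mZ PZ hZ].
have mXE : measurable (X @^-1` E).
  by rewrite -[X in measurable X]setTI; exact: measurable_funPT.
apply: (@le_trans _ _ (P (F `|` Z))); last first.
  by rewrite (le_trans (measureU2 _ mF mZ))//= [X in (_ + X)%E]PZ adde0.
apply: (le_measure P); rewrite ?inE//; first exact: measurableU.
move=> w /= Ew; have [h|h] := pselect (forall k, (X w : ell1 R) k = (Nk k w)%:R / v).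
  by left; exact: EF.
by right; apply: hZ.
Qed.

Lemma cycle_density_ge (E : set (ell1_borel R)) (F : set O) :
  measurable E -> measurable F ->
  (forall w, (forall k, (X w : ell1 R) k = (Nk k w)%:R / v) -> F w -> E (X w)) ->
  (P F <= distribution P X E)%E.
Proof.
move=> mE mF FE; case: aeX => Z [mZ PZ hZ].
have mXE : measurable (X @^-1` E).
  by rewrite -[X in measurable X]setTI; exact: measurable_funPT.
apply: (@le_trans _ _ (P (X @^-1` E `|` Z))); last first.
  by rewrite (le_trans (measureU2 _ mXE mZ))//= [X in (_ + X)%E]PZ adde0.
apply: le_measure; rewrite ?inE//; first exact: measurableU.
move=> w /= Fw; have [h|h] := pselect (forall k, (X w : ell1 R) k = (Nk k w)%:R / v).
  by left; exact: FE.
by right; apply: hZ.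
Qed.

Lemma cycle_density_cylinder_le K (c del b : nat -> R) (E : set (ell1_borel R)) :
  measurable E ->
  E `<=` [set x : ell1 R | forall k, (k < K)%N -> `|x k - c k| < del k] ->
  (forall k, (k < K)%N -> (poisson_prob (lam k) 0
      [set n : nat | (`|n%:R / v - c k| < del k)%R] <= (b k)%:E)%E) ->
  (distribution P X E <= (\prod_(0 <= k < K) b k)%:E)%E.
Proof.
move=> mE EK hb.
pose A k := [set n : nat | (`|n%:R / v - c k| < del k)%R].
have uK : uniq (index_iota 0 K) by exact: iota_uniq.
apply: (@le_trans _ _ (P (\bigcap_(i in [set` index_iota 0 K]) (Nk i @^-1` A i)))).
  apply: cycle_density_le => //.
    by apply: fin_bigcap_measurable => // i _; exact: mN.
  move=> w wX /EK /= h k /=; rewrite mem_index_iota /= => kK.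
  by rewrite /A /= -wX; exact: h.
rewrite cycle_counts_prod// -prodEFin.
apply: lee_prod_nat => // k /= kK; exact: hb.
Qed.

(** For fixed j the bad events increase with M and are bounded by b j for every M, so their union
    costs nothing by continuity from below; only the union over j costs a sum. Negative entries
    cannot occur for rescaled counts. *)
Lemma cycle_density_tail_le (K : nat -> nat) (r b : nat -> R) (E : set (ell1_borel R)) :
  measurable E ->
  E `<=` [set x : ell1 R | (exists k, x k < 0) \/
    exists j M, (K j <= M)%N /\ r j < \sum_(K j <= k < M) x k] ->
  (forall j, exists2 th, 0 <= th &
     forall M, (\sum_(K j <= k < M) lam k) * (expR th - 1) - th * (r j * v) <= ln (b j)) ->
  (forall j, 0 < b j) ->
  (distribution P X E <= \sum_(0 <= j <oo) (b j)%:E)%E.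
Proof.
move=> mE EK hb b0.
pose G j M := cycle_count (K j) (K j + M) @^-1` [set n : nat | r j * v < n%:R].
pose F j := \bigcup_M G j M.
have mG j M : measurable (G j M) by exact: measurable_cycle_count.
have mF j : measurable (F j) by exact: bigcupT_measurable.
have sumX w M j : (forall k, (X w : ell1 R) k = (Nk k w)%:R / v) ->
    \sum_(j <= k < M) (X w : ell1 R) k = (cycle_count j M w)%:R / v.
  move=> h; rewrite /cycle_count natr_sum mulr_suml.
  by apply: eq_bigr.
apply: (@le_trans _ _ (P (\bigcup_j F j))).
  apply: cycle_density_le => //; first exact: bigcupT_measurable.
  move=> w wX /EK /= [[k]|[j [M [KM]]]].
    by rewrite wX ltNge divr_ge0// ltW.
  rewrite sumX// ltr_pdivlMr// => h.
  by exists j => //; exists (M - K j)%N => //; rewrite /G /= subnKC.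
apply: (@le_trans _ _ (\sum_(0 <= j <oo) P (F j))%E).
  by apply: measure_sigma_subadditive => //; exact: bigcupT_measurable.
apply: lee_nneseries => // j _.
have ndG : {homo G j : n m / (n <= m)%N >-> (n <= m)%O}.
  move=> n m nm; apply/subsetPset => w; rewrite /G /= => /lt_le_trans; apply.
  rewrite ler_nat /cycle_count [leqRHS](big_cat_nat (n := K j + n))//= ?leq_add2l// ?leq_addr//.
have cG : P \o G j @ \oo --> P (F j) by apply: (nondecreasing_cvg_mu (mG j) (mF j) ndG).
rewrite -(cvg_lim _ cG)//; apply: lime_le.
  by apply/cvg_ex; exists (P (F j)).
apply: nearW => M /=; rewrite /G cycle_count_law ?leq_addr//.
have [th th0 hth] := hb j.
apply: (le_trans (@poisson_tilt_le _ _ th (th * (r j * v)) _ _ _)).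
- by rewrite sumr_ge0.
- by move=> n /= /ltW rn; rewrite ler_wpM2l.
by rewrite lee_fin -[leRHS]lnK ?posrE// ler_expR.
Qed.

(** Forcing every entry beyond K to vanish costs only exp of minus the total tail mean. This
    infinite intersection is reached from finite ones by continuity from above. *)
Lemma cycle_density_cylinder_ge K (c del b : nat -> R) (L : R) (E : set (ell1_borel R)) :
  measurable E ->
  [set x : ell1 R | (forall k, (k < K)%N -> `|x k - c k| < del k) /\
      (forall k, (K <= k)%N -> x k = 0)] `<=` E ->
  (forall k, (k < K)%N -> 0 <= b k) ->
  (forall k, (k < K)%N -> ((b k)%:E <= poisson_prob (lam k) 0
      [set n : nat | (`|n%:R / v - c k| < del k)%R])%E) ->
  (forall M, \sum_(K <= k < M) lam k <= L) ->
  ((\prod_(0 <= k < K) b k * expR (- L))%:E <= distribution P X E)%E.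
Proof.
move=> mE EK b0 hb hL.
pose A k := if (k < K)%N then [set n : nat | (`|n%:R / v - c k| < del k)%R]
            else [set 0%N].
pose G M := \bigcap_(i in [set` index_iota 0 (K + M)]) (Nk i @^-1` A i).
have mG M : measurable (G M).
  by apply: fin_bigcap_measurable => // i _; exact: mN.
have mG' : measurable (\bigcap_M G M) by exact: bigcapT_measurable.
have niG : {homo G : n m / (n <= m)%N >-> (m <= n)%O}.
  move=> n m nm; apply/subsetPset => w h k /= kn; apply: h => /=.
  by move: kn; rewrite !mem_index_iota /= => /leq_trans; apply; rewrite leq_add2l.
have PGoo : (P (G 0%N) < +oo)%E by rewrite ltey_eq fin_num_measure.
have cG : P \o G @ \oo --> P (\bigcap_M G M) by apply: nonincreasing_cvg_mu.
apply: (@le_trans _ _ (P (\bigcap_M G M))); last first.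
  apply: cycle_density_ge => // w wX h; apply: EK => /=; split => k kK.
    have := h 0%N I k; rewrite /= mem_index_iota /= addn0 => /(_ kK).
    by rewrite /A kK wX.
  have := h k.+1 I k; rewrite /= mem_index_iota /= addnS ltnS leq_addl => /(_ isT).
  by rewrite /A ltnNge kK /= wX => ->; rewrite mul0r.
rewrite -(cvg_lim _ cG)//; apply: lime_ge.
  by apply/cvg_ex; exists (P (\bigcap_M G M)).
apply: nearW => M /=; rewrite /G cycle_counts_prod ?iota_uniq//.
rewrite [leRHS](big_cat_nat (n := K))//= ?leq_addr// EFinM.
apply: lee_pmul; rewrite ?lee_fin ?expR_ge0//.
- by rewrite big_nat prodr_ge0// => k /andP[_]; exact: b0.
- rewrite -prodEFin; apply: lee_prod_nat => k /= kK; first by rewrite lee_fin b0.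
  by rewrite /A kK hb.
- apply: (@le_trans _ _ (\prod_(K <= k < K + M) (expR (- lam k))%:E)%E).
    rewrite prodEFin -expR_sum lee_fin ler_expR sumrN lerN2.
    exact: hL.
  apply: lee_prod_nat => k /andP[kK _]; first by rewrite lee_fin expR_ge0.
  rewrite /A ltnNge kK /= poisson_prob1//.
  by rewrite expr0 fact0 divr1 mulr1.
Qed.

End cycle_law.

(* The family of tail constraints makes these sets totally bounded in norm. *)
Definition ell1_tight {R : realType} (K : nat -> nat) (r : nat -> R) : set (ell1 R) :=
  [set x | (forall k, 0 <= x k) /\
    forall j M, \sum_(K j <= k < M) x k <= r j].

(** Compactness gives a cluster point, and a cluster point of an ultrafilter is a limit: otherwise
    the complement of the preimage of some neighbourhood would belong to F. *)
Lemma ultra_cvg_segment {R : realType} {T : Type} (F : set_system T) (f : T -> R)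
    (a b : R) : UltraFilter F -> F [set x | a <= f x <= b] ->
  exists l : R, f @ F --> l.
Proof.
move=> UF Fab.
have PF : ProperFilter (f @ F) by exact: fmap_proper_filter.
have : (f @ F) `[a, b]%classic.
  by rewrite /fmap /=; apply: filterS Fab => x /=; rewrite in_itv.
move=> /(@segment_compact R a b _ PF)[l [_ cl]].
exists l => A Al.
have [//|FC] := in_ultra_setVsetC (f @^-1` A) UF.
by have [y [/= h1 h2]] := cl (~` A) A FC Al.
Qed.

(** Since K 0 = 0, the constraint at j = 0 bounds the norm, so every coordinate converges along an
    ultrafilter. The constraints pass to the limit through finite sums, and the tail bounds r j
    upgrade coordinatewise convergence to convergence in norm. *)
Lemma ell1_tight_compact {R : realType} (K : nat -> nat) (r : nat -> R) :
  K 0%N = 0%N -> r @ \oo --> 0 -> compact (ell1_tight K r).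
Proof.
move=> K0 r0; rewrite compact_ultra => F UF FC.
have PF : ProperFilter F by exact: ultra_proper.
have /choice[l hl] k : exists l : R, (fun x : ell1 R => x k) @ F --> l.
  apply: (@ultra_cvg_segment _ _ _ _ 0 (r 0%N)).
  apply: filterS FC => x [x0 xr]; rewrite /= x0/=.
  apply: le_trans (xr 0%N k.+1); rewrite K0 big_nat_recr//= lerDr.
  by rewrite sumr_ge0.
have l0 k : 0 <= l k.
  by apply: (cvgr_to_ge (hl k)); apply: filterS FC => x [].
have lr j M : \sum_(K j <= k < M) l k <= r j.
  apply: (@cvgr_to_le _ F _ _ (fun x : ell1 R => \sum_(K j <= k < M) x k)).
    by apply: cvg_big => //; exact: add_continuous.
  by apply: filterS FC => x [].
have lell : (l : nat -> R) \in in_ell1.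
  apply/in_ell1P; apply: nondecreasing_is_cvgn.
    exact: nondecreasing_series.
  exists (r 0%N) => _ [n _ <-]; rewrite /series /=.
  under eq_bigr do rewrite ger0_norm//.
  by rewrite -{1}K0.
pose x0 := Ell1 lell; exists x0; split; first by split.
change (id @ F --> x0).
apply: (proj2 (@cvgrPdist_lt _ (ell1 R) _ F _ id x0)) => e e0.
have [j hj] : exists j, r j < e / 4.
  have : \forall j \near \oo, r j < e / 4.
    by apply: (cvgr_lt 0) => //; rewrite divr_gt0.
  by move=> [j _ hj]; exists j; apply: hj => /=.
have hd : \forall x \near F, \sum_(0 <= k < K j) `|l k - (x : ell1 R) k| < e / 4.
  apply: (cvgr_lt 0); last by rewrite divr_gt0.
  rewrite [X in _ --> X](_ : 0 = \sum_(0 <= k < K j) (`|l k - l k| : R)); last first.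
    by rewrite big1// => k _; rewrite subrr normr0.
  apply: cvg_big => [|k _]; first exact: add_continuous.
  by apply: cvg_norm; apply: cvgB; [exact: cvg_cst|exact: hl].
apply: filterS2 FC hd => x [xge xr] hx /=.
apply: (@le_lt_trans _ _ (e / 4 + r j + r j)); last by lra.
apply: ell1_norm_le => M.
have tail : \sum_(K j <= k < M) `|l k - x k| <= r j + r j.
  apply: le_trans (lerD (lr j M) (xr j M)).
  rewrite -big_split /=; apply: ler_sum => k _.
  by rewrite (le_trans (ler_normB _ _))// !ger0_norm.
have [MK|KM] := leqP M (K j).
  apply: (@le_trans _ _ (e / 4 + 0)); last first.
    by rewrite -addrA lerD2l addr_ge0// (le_trans _ (lr j 0%N))// sumr_ge0.
  rewrite addr0; apply: le_trans (ltW hx).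
  by rewrite [leRHS](big_cat_nat (n := M))//= lerDl sumr_ge0.
rewrite (big_cat_nat (n := K j))//=; last exact: ltnW.
by rewrite -addrA lerD// ltW.
Qed.

(** * Large deviations of tilted laws *)

Section ell1_borel.
Context {R : realType}.
Implicit Types (f : ell1 R -> R) (E : set (ell1 R)).

Lemma open_ell1_measurable E : open E -> measurable (E : set (ell1_borel R)).
Proof. by move=> oE; apply: sub_sigma_algebra. Qed.

Lemma closed_ell1_measurable E : closed E -> measurable (E : set (ell1_borel R)).
Proof.
move=> cE; rewrite -(setCK E); apply: (@measurableC _ (ell1_borel R)).
by apply: open_ell1_measurable; exact: closed_openC.
Qed.

Lemma continuous_ell1_measurable f : continuous f ->
  measurable_fun [set: ell1_borel R] (f : ell1_borel R -> R).
Proof.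
move=> cf; apply: (measurability _ (RGenOpens.measurableE R)) => //.
move=> _ [_ [x [y ->]] <-]; rewrite setTI; apply: open_ell1_measurable.
by apply: open_comp => [z _|]; [exact: cf|exact: interval_open].
Qed.

End ell1_borel.

Lemma mem_In (T : eqType) (x : T) (s : seq T) : x \in s -> List.In x s.
Proof.
elim: s => //= y s IH; rewrite inE => /predU1P[->|/IH]; [by left|by right].
Qed.

Section tilted.
Context {R : realType} (phi : ell1 R -> R) (mu : probability (ell1_borel R) R).
Variable v : R.
Hypotheses (cphi : continuous phi) (phi0 : forall x, 0 <= phi x) (v0 : 0 <= v).
Implicit Types (E F : set (ell1_borel R)) (b c : R).

Definition tilted_mass E : \bar R := (\int[mu]_(x in E) (expR (- (v * phi x)))%:E)%E.

Let mtilt E : measurable_fun E (fun x : ell1_borel R => (expR (- (v * phi x)))%:E).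
Proof.
apply: measurable_funTS; apply/measurable_EFinP; apply: measurableT_comp => //.
apply: measurableT_comp => //; apply: measurable_funM => //.
exact: continuous_ell1_measurable.
Qed.

Let tilt0 (x : ell1_borel R) : (0 <= (expR (- (v * phi x)))%:E)%E.
Proof. by rewrite lee_fin expR_ge0. Qed.

Lemma tilted_mass_ge0 E : (0 <= tilted_mass E)%E.
Proof. by apply: integral_ge0. Qed.

Lemma tilted_mass_le E c : measurable E -> (forall x, E x -> c <= phi x) ->
  (tilted_mass E <= (expR (- (v * c)))%:E * mu E)%E.
Proof.
move=> mE Ec; rewrite -integral_cst//; apply: ge0_le_integral => //.
by move=> x Ex; rewrite lee_fin ler_expR lerN2 ler_wpM2l// Ec.
Qed.

Lemma tilted_mass_ge E c : measurable E -> (forall x, E x -> phi x <= c) ->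
  ((expR (- (v * c)))%:E * mu E <= tilted_mass E)%E.
Proof.
move=> mE Ec; rewrite -integral_cst//; apply: ge0_le_integral => //.
  by move=> x _; rewrite lee_fin expR_ge0.
by move=> x Ex; rewrite lee_fin ler_expR lerN2 ler_wpM2l// Ec.
Qed.

Lemma tilted_mass_le1 E : measurable E -> (tilted_mass E <= mu E)%E.
Proof.
move=> mE; rewrite -[leRHS]mul1e.
have := @tilted_mass_le E 0 mE (fun x _ => phi0 x).
by rewrite mulr0 oppr0 expR0.
Qed.

Lemma tilted_mass_mono E F : measurable E -> measurable F -> E `<=` F ->
  (tilted_mass E <= tilted_mass F)%E.
Proof. by move=> mE mF EF; apply: ge0_subset_integral. Qed.

(** The bound is assumed for all measurable subsets of the U i, so they can be removed from F one
    after the other and the integral splits over disjoint pieces. The last piece lies outside all of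
    them. *)
Lemma tilted_mass_cover (I : Type) (s : seq I) (U : I -> set (ell1_borel R)) F b :
  measurable F -> (forall i, measurable (U i)) ->
  (forall i E, List.In i s -> measurable E -> E `<=` U i -> (tilted_mass E <= b%:E)%E) ->
  (forall E, measurable E -> E `<=` F ->
     (forall i, List.In i s -> E `&` U i = set0) -> (tilted_mass E <= b%:E)%E) ->
  (tilted_mass F <= ((size s).+1%:R * b)%:E)%E.
Proof.
move=> + mU; elim: s F => [|i s IH] F mF hU hF.
  by rewrite mul1r; apply: hF.
have -> : F = (F `&` U i) `|` (F `\` U i) by rewrite setUIDK.
have m1 : measurable (F `&` U i) by exact: measurableI.
have m2 : measurable (F `\` U i) by exact: measurableD.
rewrite /tilted_mass ge0_integral_setU//; last first.
  by apply/disj_setPS => x [[_ ?] [_ ?]].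
rewrite mulrS mulrDl mul1r EFinD; apply: leeD.
  by apply: (hU i) => //; left.
apply: IH => // [j E js|E mE EF hE]; first by apply: hU; right.
apply: hF => //; first by move=> x /EF[].
move=> j [<-|js]; last exact: hE.
by apply/seteqP; split => // x [/EF[_ ?] ?].
Qed.

End tilted.

Lemma series_tail_lt {R : realType} (q : nat -> R) (e : R) :
  (forall k, 0 < q k) -> cvgn (series q) -> 0 < e ->
  exists K, forall M, \sum_(K <= k < M) q k < e.
Proof.
move=> q0 qs e0.
have nd : nondecreasing_seq (series q).
  by apply: nondecreasing_series => k _ _; exact: ltW.
have : \forall K \near \oo, limn (series q) - e < series q K.
  by apply: (cvgr_gt (limn (series q))) => //; rewrite ltrBlDr ltrDl.
move=> [K _ hK]; exists K => M; have [MK|KM] := leqP M K.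
  by rewrite big_geq.
have := nondecreasing_cvgn_le nd qs M; have := hK K (leqnn K).
rewrite /series /= (big_cat_nat (n := K) (p := M))//=; last exact: ltnW.
by lra.
Qed.

Lemma limn_esup_le_near {R : realType} (u : nat -> \bar R) (c : \bar R) :
  (\forall n \near \oo, (u n <= c)%E) -> (limn_esup u <= c)%E.
Proof.
move=> h; apply: (@le_trans _ _ (ereal_sup (u @` [set n | (u n <= c)%E]))).
  by apply: ereal_inf_lbound; exists [set n | (u n <= c)%E].
by apply: ge_ereal_sup => _ [n /= hn <-].
Qed.

Lemma limn_einf_ge_near {R : realType} (u : nat -> \bar R) (c : \bar R) :
  (\forall n \near \oo, (c <= u n)%E) -> (c <= limn_einf u)%E.
Proof.
move=> h; rewrite /limn_einf leeNr; apply: limn_esup_le_near.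
by apply: filterS h => n; rewrite leeN2.
Qed.

(** The bounds on z keep it finite and positive, so that the quotient is a real one. The numerator
    may vanish, in which case [lne] is minus infinity. *)
Lemma lne_ratio_le {R : realType} (a z : \bar R) (v m1 m2 m : R) :
  0 < v -> (0 <= a)%E -> (a <= (expR (- (v * m1)))%:E)%E ->
  ((expR (- (v * m2)))%:E <= z)%E -> (z <= 1)%E -> m1 - m2 = m ->
  ((v^-1)%:E * lne (a / z) <= (- m)%:E)%E.
Proof.
move=> v0; case: a => [a| |]; case: z => [z| |]; rewrite ?leye_eq ?leNye_eq//=.
rewrite !lee_fin => a0 am zm z1 <-.
have z0 : 0 < z by rewrite (lt_le_trans _ zm)// expR_gt0.
rewrite inver gt_eqF// -EFinM lee_pdivrMl//.
move: a0; rewrite le_eqVlt => /predU1P[<-|a0].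
  by rewrite mul0r /= lexx leNye.
rewrite lne_EFin ?divr_gt0// -EFinM lee_fin -ler_expR lnK ?posrE ?divr_gt0//.
rewrite opprB mulrBr expRD expRN ler_pdivrMr//.
apply: (le_trans am); rewrite mulrAC -expRN -[leLHS]mul1r ler_pM2r ?expR_gt0//.
by rewrite -(mulrV (x := expR (v * m2))) ?unitfE ?gt_eqF ?expR_gt0// ler_pM2l ?expR_gt0// -expRN.
Qed.

Lemma lne_ratio_ge {R : realType} (a z : \bar R) (v m1 m2 m : R) :
  0 < v -> ((expR (- (v * m1)))%:E <= a)%E -> (a <= 1)%E ->
  (0 < z)%E -> (z <= (expR (- (v * m2)))%:E)%E -> m1 - m2 = m ->
  ((- m)%:E <= (v^-1)%:E * lne (a / z))%E.
Proof.
move=> v0; case: a => [a| |]; case: z => [z| |]; rewrite ?leye_eq ?leNye_eq//=.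
rewrite !lee_fin lte_fin => am a1 z0 zm <-.
have a0 : 0 < a by rewrite (lt_le_trans _ am)// expR_gt0.
rewrite inver gt_eqF// -EFinM lee_pdivlMl//.
rewrite lne_EFin ?divr_gt0// -EFinM lee_fin -ler_expR lnK ?posrE ?divr_gt0//.
rewrite opprB mulrBr expRD ler_pdivlMr//.
apply: le_trans am; rewrite mulrAC -[leRHS]mul1r ler_pM2r ?expR_gt0//.
by rewrite -(expRxMexpNx_1 (v * m2)) ler_pM2l ?expR_gt0.
Qed.

Lemma lte_real_between {R : realType} (a : R) (x : \bar R) : (a%:E < x)%E ->
  exists2 m, a < m & (m%:E < x)%E.
Proof.
case: x => [r||]; rewrite ?lte_fin ?ltNge ?leNye//.
  by rewrite -ltNge => ar; exists ((a + r) / 2); rewrite ?lte_fin; lra.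
by move=> _; exists (a + 1); rewrite ?ltry//; lra.
Qed.

Lemma lee_real_below {R : realType} (x y : \bar R) :
  (forall m : R, (m%:E < x)%E -> (m%:E <= y)%E) -> (x <= y)%E.
Proof.
move=> h; case: y h => [s||] h; rewrite ?leey//.
  rewrite leNgt; apply/negP => /lte_real_between[m sm /h].
  by rewrite lee_fin leNgt sm.
case: x h => [r||] h //; last by have := h 0 (ltry _).
by have := h (r - 1); rewrite lte_fin => /(_ ltac:(lra)).
Qed.

Lemma lee_real_above {R : realType} (x y : \bar R) :
  (forall m : R, (x < m%:E)%E -> (y <= m%:E)%E) -> (y <= x)%E.
Proof.
move=> h; rewrite -leeN2; apply: lee_real_below => m; rewrite lteNr => /h.
by rewrite leeNr.
Qed.

Lemma divnS_mulrn_le {R : realFieldType} (g : R) K : 0 <= g -> g / K.+1%:R *+ K <= g.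
Proof.
move=> g0; rewrite -[leLHS]mulr_natr -mulrA ler_piMr//.
by rewrite mulrC ler_pdivrMr// mul1r ler_nat.
Qed.

Definition scaled_poisson_law {R : realType} (v : R) (lam : nat -> R)
    (nu : probability (ell1_borel R) R) :=
  exists dO (O : measurableType dO) (P : probability O R)
    (Nk : nat -> {mfun O >-> nat}) (X : {mfun O >-> ell1_borel R}),
  [/\ mutually_independent P (fun k => Nk k : O -> nat),
      forall k A, distribution P (Nk k) A = poisson_prob (lam k) 0 A,
      {ae P, forall w, forall k, (X w : ell1 R) k = (Nk k w)%:R / v}
    & forall A, measurable A -> nu A = distribution P X A].

Section tilted_ldp.
Context {R : realType} (q : nat -> R) (qN : nat -> nat -> R) (v : nat -> R).
Variables (C : R) (nu : nat -> probability (ell1_borel R) R) (phi : ell1 R -> R).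
Hypotheses (q0 : forall k, 0 < q k) (qs : cvgn (series q)).
Hypotheses (vy : v @ \oo --> +oo) (C0 : 0 <= C).
Hypothesis qNb : \forall N \near \oo, forall k, 0 <= qN N k <= C * q k.
Hypothesis qNq : forall k, qN ^~ k @ \oo --> q k.
Hypothesis law : \forall N \near \oo,
  scaled_poisson_law (v N) (fun k => v N * qN N k) (nu N).
Hypotheses (cphi : continuous phi) (phi0 : forall x, 0 <= phi x).
Implicit Types (x y : ell1 R) (m : R) (E F G : set (ell1_borel R)).

Local Notation mass N := (tilted_mass phi (nu N) (v N)).

Let v_gt0 : \forall N \near \oo, 0 < v N.
Proof. by move/cvgryPgt : vy; exact. Qed.

(** The neighbourhood restricts only phi and the K entries seen by a Legendre functional that
    already exceeds m - phi x. Of the gap g, one quarter pays for the variation of phi and one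
    quarter is shared by the K windows. The quantifier on E comes after the one on N, as needed for
    the cover. *)
Lemma tilted_local_upper x m :
  (m%:E < (phi x)%:E + poisson_rate q x)%E ->
  exists U : set (ell1 R), [/\ open U, U x &
    \forall N \near \oo, forall E, measurable E -> E `<=` U ->
      (mass N E <= (expR (- (v N * m)))%:E)%E].
Proof.
move=> mJ; have : ((m - phi x)%:E < poisson_rate q x)%E by rewrite EFinB lteBlDl.
move=> /(lt_poisson_rate q0 qs)[th [K hK]].
have [g g0 gE] : exists2 g, 0 < g & m = legendre q th K x + phi x - g.
  by exists (legendre q th K x + phi x - m); lra.
pose mk k := th k * x k - q k * (expR (th k) - 1) - g / 4 / K.+1%:R.
have hk k : exists del : R, 0 < del /\ \forall N \near \oo,
    (poisson_prob (v N * qN N k) 0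
       [set n : nat | (`|n%:R / v N - x k| < del)%R]
      <= (expR (- (v N * mk k)))%:E)%E.
  have [|del d0 hd] := @poisson_local_upper _ (q k) (qN ^~ k) v (q0 k) (@qNq k) vy
    (x k) (th k) (mk k); last by exists del.
  by rewrite /mk ltrBlDr ltrDl !divr_gt0.
have [del hdel] := choice hk.
pose U0 := [set y : ell1 R | phi x - g / 4 < phi y /\
  forall k : 'I_K, `|y k - x k| < del k].
have nU0 : nbhs x U0.
  have FF := nbhs_filter x.
  apply: filterI.
    by apply: (@cvgr_gt _ _ (nbhs x) FF phi (phi x) (@cphi x)); rewrite ltrBlDr ltrDl divr_gt0.
  apply: (@filter_forall (ell1 R) 'I_K (fun k y => `|y k - x k| < del k)
    (nbhs x) FF) => k; have [dk _] := hdel k.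
  have h := (proj1 (@cvgrPdist_lt _ _ _ (nbhs x) FF _ (x k))
    (@coord_continuous R k x)) _ dk.
  by apply: filterS h => y; rewrite distrC.
exists (interior U0); split => //; first exact: open_interior.
have hN : \forall N \near \oo, forall k : 'I_K,
    (poisson_prob (v N * qN N k) 0
       [set n : nat | (`|n%:R / v N - x k| < del k)%R]
      <= (expR (- (v N * mk k)))%:E)%E.
  by apply: filter_forall => k; have [] := hdel k.
near=> N => E mE EU.
have vN : 0 < v N by near: N.
have EU0 : E `<=` U0 by move=> y /EU; exact: interior_subset.
have hc y : E y -> phi x - g / 4 <= phi y by move=> /EU0[/ltW].
apply: (le_trans (tilted_mass_le (nu N) cphi (ltW vN) mE hc)).
have : scaled_poisson_law (v N) (fun k => v N * qN N k) (nu N) by near: N.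
move=> [dO [Om [P [Nk [X [ind lawN aeX nuE]]]]]].
have lam0 k : 0 <= v N * qN N k.
  have h : forall k, 0 <= qN N k <= C * q k by near: N.
  by rewrite mulr_ge0 ?(ltW vN)//; have /andP[] := h k.
have := @cycle_density_cylinder_le _ _ _ P (v N) _ Nk X ind lawN aeX
  K x del (fun k => expR (- (v N * mk k))) E mE.
rewrite -nuE// => hE.
have {}hE : (nu N E <= (expR (- (v N * \sum_(0 <= k < K) mk k)))%:E)%E.
  rewrite mulr_sumr -sumrN expR_sum; apply: hE.
    by move=> y /EU0[_ hy] k kK; exact: (hy (Ordinal kK)).
  move=> k kK; have h : forall k : 'I_K,
    (poisson_prob (v N * qN N k) 0
       [set n : nat | (`|n%:R / v N - x k| < del k)%R]
      <= (expR (- (v N * mk k)))%:E)%E by near: N.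
  exact: (h (Ordinal kK)).
apply: (@le_trans _ _ ((expR (- (v N * (phi x - g / 4))))%:E *
    (expR (- (v N * \sum_(0 <= k < K) mk k)))%:E)%E).
  by rewrite lee_pmul2l ?lte_fin ?expR_gt0.
rewrite -EFinM lee_fin -expRD ler_expR -opprD -mulrDr lerN2 ler_pM2l//.
have -> : \sum_(0 <= k < K) mk k = legendre q th K x - (g / 4 / K.+1%:R) *+ K.
  by rewrite /mk sumrB sumr_const_nat subn0.
have : (g / 4 / K.+1%:R) *+ K <= g / 4.
  by apply: divnS_mulrn_le; rewrite divr_ge0 ?(ltW g0).
by rewrite gE; move: (_ *+ K) => T hT; lra.
Unshelve. all: by end_near. Qed.

Lemma exponential_tightness m : exists K r, [/\ K 0%N = 0%N, r @ \oo --> (0 : R) &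
  \forall N \near \oo, forall E, measurable E -> E `&` ell1_tight K r = set0 ->
    (nu N E <= (expR (- (v N * m)))%:E)%E].
Proof.
pose Q := limn (series q).
have Q0 : 0 <= Q.
  by apply: limr_ge => //; apply: nearW => n; apply: sumr_ge0 => k _; exact: ltW.
have Qle M : \sum_(0 <= k < M) q k <= Q.
  apply: (nondecreasing_cvgn_le _ qs M).
  by apply: nondecreasing_series => k _ _; exact: ltW.
(* Against the tail level 1 / j the slope j (|m| + j + 2) gains |m| + j + 2. One unit is given back
   to the term in exp(th), because K j is chosen after th j with a tail of q below 1 / ((C + 1)
   exp(th j)). What remains is m + j + 1, summable over j. At j = 0 no cut-off is possible, and r 0
   is taken large instead. *)
pose th (j : nat) : R := if j is j'.+1 then (`|m| + j'.+1%:R + 2) * j'.+1%:R else 1.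
have th0 j : 0 <= th j.
  by case: j => [|j] //=; rewrite mulr_ge0// !addr_ge0.
pose r (j : nat) : R := if j is j'.+1 then j'.+1%:R^-1
  else C * Q * (expR 1 - 1) + `|m| + 1.
have e1 : 0 <= expR 1 - 1 :> R by rewrite subr_ge0 -expR0 ler_expR.
have r0 j : 0 <= r j by case: j => [|j] //=; rewrite !addr_ge0// !mulr_ge0.
have hK j : exists K, (j = 0%N -> K = 0%N) /\ forall M,
    C * (\sum_(K <= k < M) q k) * (expR (th j) - 1) - th j * r j <= - (m + j.+1%:R).
  case: j => [|j].
    exists 0%N; split => // M; rewrite /th /r mul1r.
    have : C * (\sum_(0 <= k < M) q k) * (expR 1 - 1) <= C * Q * (expR 1 - 1).
      by rewrite ler_wpM2r// ler_wpM2l.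
    by have := ler_norm m; lra.
  have [|K hK] := @series_tail_lt _ q ((C + 1) * expR (th j.+1))^-1 q0 qs _.
    by rewrite invr_gt0 mulr_gt0 ?expR_gt0// ltr_wpDl.
  exists K; split => // M; have := hK M.
  set T := \sum_(K <= k < M) q k => hT.
  have T0 : 0 <= T by apply: sumr_ge0 => k _; exact: ltW.
  have E0 := expR_gt0 (th j.+1).
  have : T * ((C + 1) * expR (th j.+1)) < 1.
    by rewrite -ltr_pdivlMr ?div1r// mulr_gt0// ltr_wpDl.
  have -> : th j.+1 * r j.+1 = `|m| + j.+1%:R + 2 by rewrite /th /r mulfK.
  have : 0 <= C * T by rewrite mulr_ge0.
  have : 0 <= T * expR (th j.+1) by rewrite mulr_ge0 ?expR_ge0.
  have := ler_norm m; rewrite [X in _ -> _ -> _ -> _ -> _ <= - (_ + X)]mulrS.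
  by lra.
have [K hK'] := choice hK.
exists K, r; split; first exact: (proj1 (hK' 0%N)).
  by apply/cvgrPdist_lt => e e0; near=> j; near: j; rewrite near_simpl;
   have := @cvg_harmonic R; move=> /cvgrPdist_lt /(_ e e0) [j0 _ hj0];
   exists j0.+1 => // -[//|j] /= jj; exact: (hj0 j).
have v1 : \forall N \near \oo, 1 <= v N by move/cvgryPge : vy; exact.
near=> N => E mE ET.
have vN : 0 < v N by near: N.
have vN1 : 1 <= v N by near: N.
have : scaled_poisson_law (v N) (fun k => v N * qN N k) (nu N) by near: N.
move=> [dO [Om [P [Nk [X [ind lawN aeX nuE]]]]]].
have hq : forall k, 0 <= qN N k <= C * q k by near: N.
have lam0 k : 0 <= v N * qN N k.
  by rewrite mulr_ge0 ?(ltW vN)//; have /andP[] := hq k.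
pose b (j : nat) := expR (- (v N * (m + j.+1%:R))).
rewrite nuE//.
have := @cycle_density_tail_le _ _ _ P (v N) _ Nk X vN lam0 ind lawN aeX
  K r b E mE.
move=> h; apply: (le_trans (h _ _ _)) => {h}.
- move=> x Ex; have : ~ ell1_tight K r x.
    by move=> tx; have : (E `&` ell1_tight K r) x by []; rewrite ET.
  move=> /not_andP[/existsNP[k /negP]|/existsNP[j /existsNP[M /negP]]].
    by rewrite -ltNge; left; exists k.
  rewrite -ltNge => hM; right; exists j, M; split => //.
  rewrite leqNgt; apply/negP => /ltnW MK.
  by move: hM; rewrite big_geq// ltNge r0.
- move=> j; exists (th j) => // M.
  rewrite /b expRK -[leRHS]mulrN; apply: (@le_trans _ _ (v N * (C * (\sum_(K j <= k < M) q k) *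
      (expR (th j) - 1) - th j * r j))); last first.
    by rewrite ler_pM2l//; exact: (proj2 (hK' j)).
  have h1 : \sum_(K j <= k < M) qN N k <= C * \sum_(K j <= k < M) q k.
    by rewrite mulr_sumr; apply: ler_sum => k _; have /andP[] := hq k.
  have h2 : 0 <= expR (th j) - 1 by rewrite subr_ge0 -expR0 ler_expR.
  have := ler_wpM2l (ltW vN) (ler_wpM2r h2 h1); rewrite -mulr_sumr.
  by move: (\sum_(_ <= _ < _) _) => T1; move: (\sum_(_ <= _ < _) _) => T2; lra.
- by move=> j; exact: expR_gt0.
(* As v >= 1 >= ln 2, the factor exp(- v (j + 1)) is at most 2^-(j + 1). *)
apply: le_trans (epsilon_trick0 xpredT (expR_ge0 (- (v N * m)))).
apply: lee_nneseries => j _; first by rewrite lee_fin expR_ge0.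
rewrite lee_fin /b mulrDr opprD expRD ler_pM2l ?expR_gt0//.
rewrite -[leRHS]lnK ?posrE ?invr_gt0 ?ltr0n ?expn_gt0// ler_expR.
rewrite lnV ?posrE ?ltr0n ?expn_gt0// lerN2 natrX lnXn// -[leLHS]mulr_natr.
rewrite ler_wpM2r//; apply: le_trans vN1.
rewrite -[leRHS]expRK ler_ln ?posrE ?expR_gt0//.
exact: expR_ge1Dx.
Unshelve. all: by end_near. Qed.

(** The loss e absorbs the number of sets in the finite cover, a constant below exp(v e) for N
    large. *)
Lemma tilted_upper (F : set (ell1 R)) m e : 0 < e -> closed F ->
  (forall x, F x -> (m%:E < (phi x)%:E + poisson_rate q x)%E) ->
  \forall N \near \oo, (mass N F <= (expR (- (v N * (m - e))))%:E)%E.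
Proof.
move=> e0 cF Fm.
have [K [r [K0 r0 htight]]] := exponential_tightness m.
have hU x : exists U : set (ell1 R), [/\ open U, F x -> U x &
    \forall N \near \oo, forall E, measurable E -> E `<=` U ->
      (mass N E <= (expR (- (v N * m)))%:E)%E].
  have [Fx|nFx] := pselect (F x).
    by have [U [oU Ux bU]] := tilted_local_upper (Fm x Fx); exists U.
  (* A dummy value outside F, since [choice] asks for a set at every x. *)
  exists set0; split => //.
  apply: nearW => N E mE; rewrite subset0 => ->.
  by rewrite /tilted_mass integral_set0 lee_fin expR_ge0.
have [U {}hU] := choice hU.
have : compact (ell1_tight K r `&` F).
  by apply: compact_closedI => //; exact: ell1_tight_compact.
rewrite compact_cover => /(_ (ell1 R) F U)[||D _ hD].
- by move=> x _; have [] := hU x.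
- by move=> x [_ Fx]; exists x => //; have [_ h _] := hU x; exact: h.
pose s : seq (ell1 R) := finmap.enum_fset D.
have bs : \forall N \near \oo, forall x, List.In x s ->
    forall E, measurable E -> E `<=` U x -> (mass N E <= (expR (- (v N * m)))%:E)%E.
  elim: s => [|x s IH]; first exact: nearW.
  have [_ _ hx] := hU x; apply: filterS2 hx IH => N h1 h2 y /= [<-//|]; exact: h2.
have vbig : \forall N \near \oo, ln (size s).+1%:R / e <= v N.
  by move/cvgryPge : vy; exact.
near=> N.
have vN : 0 < v N by near: N.
apply: (@le_trans _ _ ((size s).+1%:R * expR (- (v N * m)))%:E).
  apply: (@tilted_mass_cover _ phi (nu N) (v N) cphi _ s U).
  - exact: closed_ell1_measurable.
  - by move=> x; apply: open_ell1_measurable; have [] := hU x.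
  - move=> x E xs mE EU; have h : forall x, List.In x s ->
      forall E, measurable E -> E `<=` U x ->
        (mass N E <= (expR (- (v N * m)))%:E)%E by near: N.
    exact: (h x).
  move=> E mE EF hE.
  apply: (le_trans (tilted_mass_le1 (nu N) cphi phi0 (ltW vN) mE)).
  have ET : E `&` ell1_tight K r = set0.
    apply/seteqP; split => // x [Ex Tx].
    have [i iD Ui] := hD x (conj Tx (EF x Ex)).
    rewrite -(hE i)//.
    exact/mem_In/iD.
  have h : forall E, measurable E -> E `&` ell1_tight K r = set0 ->
    (nu N E <= (expR (- (v N * m)))%:E)%E by near: N.
  exact: h.
rewrite lee_fin (_ : - (v N * (m - e)) = v N * e - v N * m); last by ring.
rewrite expRD ler_pM2r ?expR_gt0//.
rewrite -[leLHS]lnK ?posrE// ler_expR -ler_pdivrMr//.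
by near: N.
Unshelve. all: by end_near. Qed.

(** The event used is that the first K entries are close to those of x and the others are zero. K is
    large for two reasons: cutting x at K must stay within the ball of radius e, and the empty tail
    must cost at most v g / 4. Two further quarters of g pay for phi and for the windows. *)
Lemma tilted_lower (G : set (ell1 R)) x m : open G -> G x ->
  ((phi x)%:E + poisson_rate q x < m%:E)%E ->
  \forall N \near \oo, ((expR (- (v N * m)))%:E <= mass N G)%E.
Proof.
move=> oG Gx hm.
have x0 k : 0 <= x k.
  rewrite leNgt; apply/negP => xk; move: hm; rewrite /poisson_rate asboolF//.
  by move=> /(_ k); rewrite leNgt xk.
have [rho rhoE] : exists rho, poisson_rate q x = rho%:E.
  exists (fine (poisson_rate q x)); rewrite fineK// ge0_fin_numE ?poisson_rate_ge0//.
  by move: hm; case: (poisson_rate q x) => [l|//|//]; rewrite ltry.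
rewrite rhoE -EFinD lte_fin in hm.
have [g g0 gE] : exists2 g, 0 < g & m = phi x + rho + g.
  by exists (m - (phi x + rho)); lra.
have [e [e0 heG]] : exists e : R, 0 < e /\ forall y, `|x - y| < e ->
    G y /\ phi y < phi x + g / 4.
  have FF := nbhs_filter x.
  have : nbhs x (G `&` [set y | phi y < phi x + g / 4]).
    apply: filterI; first exact: open_nbhs_nbhs.
    by apply: (@cvgr_lt _ _ (nbhs x) FF phi (phi x) (@cphi x)); rewrite ltrDl divr_gt0.
  by rewrite -nbhs_ballE => -[e /= e0 he]; exists e; split => // y xy; apply: he;
     rewrite -ball_normE.
have [K1 hK1] : exists K, forall K' M, (K <= K')%N -> \sum_(K' <= k < M) x k < e / 2.
  have cx := @ell1_sum_cvg _ x.
  have nd : nondecreasing_seq (series x) by exact: nondecreasing_series.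
  have : \forall K \near \oo, limn (series x) - e / 2 < series x K.
    by apply: (cvgr_gt (limn (series x))) => //; rewrite ltrBlDr ltrDl divr_gt0.
  move=> [K _ hK]; exists K => K' M KK'; have [MK|KM] := leqP M K'.
    by rewrite big_geq// divr_gt0.
  have := nondecreasing_cvgn_le nd cx M; have := hK K' KK'.
  rewrite /series /= (big_cat_nat (n := K') (p := M))//=; last exact: ltnW.
  by lra.
have [|K2 hK2] := @series_tail_lt _ q (g / 4 / (C + 1)) q0 qs _.
  by rewrite !divr_gt0// ltr_wpDl.
pose K := maxn K1 K2.
pose del : R := e / 4 / K.+1%:R.
have del0 : 0 < del by rewrite !divr_gt0.
pose mk k := entropy (q k) (x k) + g / 4 / K.+1%:R.
have hN : \forall N \near \oo, forall k : 'I_K,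
    ((expR (- (v N * mk k)))%:E <= poisson_prob (v N * qN N k) 0
       [set n : nat | (`|n%:R / v N - x k| < del)%R])%E.
  apply: filter_forall => k.
  apply: (@poisson_local_lower _ (q k) (qN ^~ k) v (q0 k) (@qNq k) vy) => //.
  by rewrite /mk ltrDl !divr_gt0.
pose E := [set y : ell1 R | `|x - y| < e].
have mE : measurable (E : set (ell1_borel R)).
  apply: open_ell1_measurable.
  by rewrite (_ : E = ball x e) ?ball_normE//; exact: ball_open.
have mG : measurable (G : set (ell1_borel R)) by exact: open_ell1_measurable.
near=> N.
have vN : 0 < v N by near: N.
have : scaled_poisson_law (v N) (fun k => v N * qN N k) (nu N) by near: N.
move=> [dO [Om [P [Nk [X [ind lawN aeX nuE]]]]]].
have hq : forall k, 0 <= qN N k <= C * q k by near: N.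
have lam0 k : 0 <= v N * qN N k.
  by rewrite mulr_ge0 ?(ltW vN)//; have /andP[] := hq k.
apply: (@le_trans _ _ (mass N E)); last first.
  by apply: (@tilted_mass_mono _ phi (nu N) (v N) cphi E G mE mG) => y /heG[].
apply: (le_trans _ (@tilted_mass_ge _ phi (nu N) (v N) cphi (ltW vN) E (phi x + g / 4) mE _)); last first.
  by move=> y /heG[_ /ltW].
have hE : ((expR (- (v N * (rho + g / 4 + g / 4))))%:E <= nu N E)%E.
  rewrite nuE//.
  have := @cycle_density_cylinder_ge _ _ _ P (v N) _ Nk X lam0 ind lawN aeX
    K x (fun=> del) (fun k => expR (- (v N * mk k))) (v N * (g / 4)) E mE.
  move=> h; apply: le_trans (h _ _ _ _) => {h}.
  - rewrite -expR_sum -expRD lee_fin ler_expR sumrN -mulr_sumr -opprD lerN2.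
    rewrite -mulrDr ler_pM2l// lerD2r.
    rewrite /mk big_split /= sumr_const_nat subn0; apply: lerD.
      rewrite -lee_fin -rhoE poisson_rateE// -sumEFin.
      by apply: nneseries_lim_ge => k _ _; rewrite lee_fin entropy_ge0.
    by apply: divnS_mulrn_le; rewrite divr_ge0 ?(ltW g0).
  - move=> y [yK y0]; rewrite /E /=.
    apply: (@le_lt_trans _ _ (del *+ K + e / 2)); last first.
      have : del *+ K <= e / 4 by apply: divnS_mulrn_le; rewrite divr_ge0 ?(ltW e0).
      by move: e0; move: (_ *+ K) => t; lra.
    apply: ell1_norm_le => M.
    have hle : \sum_(0 <= k < K) `|(x - y) k| <= del *+ K.
      rewrite -[X in _ *+ X]subn0 -sumr_const_nat big_nat [leRHS]big_nat.
      apply: ler_sum => k /andP[_ kK]; rewrite distrC; exact: ltW (yK k kK).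
    have tail : \sum_(K <= k < M) `|(x - y) k| <= e / 2.
      apply: le_trans (ltW (hK1 K M (leq_maxl _ _))).
      rewrite big_nat [leRHS]big_nat; apply: ler_sum => k /andP[kK _].
      by rewrite -[(x - y) k]/(x k - y k) (y0 k kK) subr0 ger0_norm.
    have [MK|KM] := leqP M K.
      apply: (@le_trans _ _ (del *+ K + 0)); last by rewrite lerD2l divr_ge0// ltW.
      rewrite addr0; apply: le_trans hle.
      by rewrite [leRHS](big_cat_nat (n := M))//= lerDl sumr_ge0.
    by rewrite (big_cat_nat (n := K))//=; [exact: lerD|exact: ltnW].
  - by move=> k _; exact: expR_ge0.
  - move=> k kK; have h : forall k : 'I_K,
      ((expR (- (v N * mk k)))%:E <= poisson_prob (v N * qN N k) 0
       [set n : nat | (`|n%:R / v N - x k| < del)%R])%E by near: N.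
    exact: (h (Ordinal kK)).
  - move=> M; rewrite -mulr_sumr ler_pM2l//.
    have h1 : \sum_(K <= k < M) qN N k <= C * \sum_(K <= k < M) q k.
      by rewrite mulr_sumr; apply: ler_sum => k _; have /andP[] := hq k.
    have h2 : \sum_(K <= k < M) q k <= \sum_(K2 <= k < M) q k.
      have [MK|KM] := leqP M K.
        by rewrite big_geq// sumr_ge0// => k _; exact: ltW.
      rewrite [leRHS](big_cat_nat (n := K))//=; [|exact: leq_maxr|exact: ltnW].
      by rewrite lerDr sumr_ge0// => k _; exact: ltW.
    have h3 := hK2 M; rewrite ltr_pdivlMr ?ltr_wpDl// in h3.
    have : 0 <= \sum_(K2 <= k < M) q k by apply: sumr_ge0 => k _; exact: ltW.
    have := ler_wpM2l C0 h2; move: h1 h3.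
    by move: (\sum_(_ <= _ < _) _) (\sum_(_ <= _ < _) _) (\sum_(_ <= _ < _) _) => a b c; lra.
apply: (@le_trans _ _ ((expR (- (v N * (phi x + g / 4))))%:E *
    (expR (- (v N * (rho + g / 4 + g / 4))))%:E)%E); last first.
  by rewrite lee_pmul2l ?lte_fin ?expR_gt0.
rewrite -EFinM lee_fin -expRD ler_expR -opprD -mulrDr lerN2 ler_pM2l// gE; lra.
Unshelve. all: by end_near. Qed.

Local Notation J x := ((phi x)%:E + poisson_rate q x)%E.

Let J_ge0 x : (0 <= J x)%E.
Proof. by rewrite adde_ge0 ?lee_fin ?poisson_rate_ge0. Qed.

Lemma tilted_rate_lsc x m : (m%:E < J x)%E ->
  exists2 V, nbhs x V & forall y, V y -> (m%:E < J y)%E.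
Proof.
move=> mJ; have : ((m - phi x)%:E < poisson_rate q x)%E by rewrite EFinB lteBlDl.
move=> /(lt_poisson_rate q0 qs)[th [K hK]].
have FF := nbhs_filter x.
exists [set y | m < phi y + legendre q th K y].
  have cL : (fun y => phi y + legendre q th K y) @ nbhs x --> phi x + legendre q th K x.
    by apply: cvgD; [exact: cphi|exact: legendre_continuous].
  by apply: (@cvgr_gt _ _ (nbhs x) FF _ _ cL); lra.
move=> y /= my; apply: (@lt_le_trans _ _ (phi y + legendre q th K y)%:E).
  by rewrite lte_fin.
by rewrite EFinD leeD2l// legendre_le_rate.
Qed.

Lemma poisson_rate_0_lty : (poisson_rate q (0%R : ell1 R) < +oo)%E.
Proof.
rewrite /poisson_rate asboolT; last by move=> k; rewrite lexx.
rewrite eseries0 ?add0e ?ltry// => k _ _.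
by rewrite mul0r.
Qed.

Lemma tilted_ldp :
  large_deviation_principle (fun N (E : set (ell1 R)) => mass N E / mass N setT)%E v
    (fun x => J x - ereal_inf [set J y | y in [set: ell1 R]])%E.
Proof.
set j := ereal_inf _.
have jJ x : (j <= J x)%E by apply: ereal_inf_lbound; exists x.
have j0 : (0 <= j)%E by apply: le_ereal_inf_tmp => _ [y _ <-].
have jfin : j \is a fin_num.
  rewrite ge0_fin_numE//; apply: le_lt_trans (jJ 0%R) _.
  by rewrite lte_add_pinfty ?ltry ?poisson_rate_0_lty.
have [j' jE] : exists j', j = j'%:E by exists (fine j); rewrite fineK.
have Ij0 x : (0 <= J x - j)%E by rewrite sube_ge0 ?jJ// jfin ?orbT.
have mass1 N (E : set (ell1_borel R)) : (0 < v N) -> measurable E -> (mass N E <= 1)%E.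
  move=> vN mE; apply: (le_trans (tilted_mass_le1 (nu N) cphi phi0 (ltW vN) mE)).
  exact: probability_le1.
have Zge e : 0 < e -> \forall N \near \oo,
    ((expR (- (v N * (j' + e))))%:E <= mass N setT)%E.
  move=> e0; have : (j < (j' + e)%:E)%E by rewrite jE lte_fin ltrDl.
  move=> /ereal_inf_lt[_ [x _ <-] hx].
  by apply: (tilted_lower (x := x) openT).
have Zle e : 0 < e -> \forall N \near \oo,
    (mass N setT <= (expR (- (v N * (j' - e))))%:E)%E.
  move=> e0; have := @tilted_upper setT (j' - e / 2) (e / 2) _ closedT _.
  have -> : j' - e / 2 - e / 2 = j' - e by lra.
  apply; first by rewrite divr_gt0.
  move=> x _; apply: lt_le_trans (jJ x).
  by rewrite jE lte_fin ltrBlDr ltrDl divr_gt0.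
split => //.
- split=> [x|x a]; first exact: Ij0.
  rewrite jE lteBrDr// -EFinD => /tilted_rate_lsc[V nV hV].
  by exists V => // y /hV; rewrite lteBrDr// EFinD.
- move=> F cF; set I := ereal_inf _.
  have I0 : (0 <= I)%E by apply: le_ereal_inf_tmp => _ [y _ <-]; exact: Ij0.
  suff h (m : R) : (m%:E < I)%E -> (limn_esup (fun n => ((v n)^-1)%:E *
      lne (mass n F / mass n setT)) <= (- m)%:E)%E.
    by rewrite leeNr; apply: lee_real_below => m /h; rewrite leeNr.
  move=> mI; have [m' mm' m'I] : exists2 m' : R, m < m' & (m'%:E < I)%E.
    exact: lte_real_between.
  (* One e is lost in the upper bound for the numerator, the other in the lower bound for the
     normaliser. *)
  pose e := (m' - m) / 2.
  have e0 : 0 < e by rewrite /e divr_gt0// subr_gt0.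
  apply: limn_esup_le_near.
  have hF : \forall N \near \oo, (mass N F <= (expR (- (v N * (m' + j' - e))))%:E)%E.
    apply: tilted_upper => // x Fx.
    rewrite EFinD -lteBrDr// -jE; apply: lt_le_trans m'I _.
    by apply: ereal_inf_lbound; exists x.
  have hZ := Zge e e0.
  near=> N; have vN : 0 < v N by near: N.
  apply: (@lne_ratio_le _ _ _ (v N) (m' + j' - e) (j' + e)) => //.
  + exact: tilted_mass_ge0.
  + by near: N.
  + by near: N.
  + by apply: mass1 => //; exact: measurableT.
  + by rewrite /e; lra.
- move=> G oG; rewrite leeNl; apply: le_ereal_inf_tmp => _ [x Gx <-].
  suff h (m : R) : (J x - j < m%:E)%E -> ((- m)%:E <= limn_einf (fun n => ((v n)^-1)%:E *
      lne (mass n G / mass n setT)))%E.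
    by apply: lee_real_above => m /h; rewrite leeNl.
  move=> hm; have [m' mm' hm'] : exists2 m' : R, m' < m & (J x - j < m'%:E)%E.
    have : ((- m)%:E < - (J x - j))%E by rewrite EFinN lteN2.
    move=> /lte_real_between[m' h1 h2]; exists (- m'); first by rewrite ltrNl.
    by rewrite EFinN lteNr.
  pose e := m - m'.
  have e0 : 0 < e by rewrite /e subr_gt0.
  apply: limn_einf_ge_near.
  have hG : \forall N \near \oo, ((expR (- (v N * (m' + j'))))%:E <= mass N G)%E.
    by apply: (tilted_lower (x := x)) => //; rewrite EFinD -lteBlDr// -jE.
  have hZ := Zle e e0; have hZ' := Zge e e0.
  near=> N; have vN : 0 < v N by near: N.
  apply: (@lne_ratio_ge _ _ _ (v N) (m' + j') (j' - e)) => //.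
  + by near: N.
  + by apply: mass1 => //; exact: open_ell1_measurable.
  + apply: (@lt_le_trans _ _ (expR (- (v N * (j' + e))))%:E).
      by rewrite lte_fin expR_gt0.
    by near: N.
  + by near: N.
  + by rewrite /e; lra.
Unshelve. all: by end_near. Qed.

End tilted_ldp.

(** * Free and periodic weights *)

Section free_weights.
Context {R : realType}.
Variables (d : nat) (beta mu : R).
Hypotheses (d0 : (0 < d)%N) (b0 : 0 < beta) (mu0 : mu <= 0).

(** With a and b the two square roots, b^2 - a^2 = 1, and the claim becomes b (a + b) <= 4 a^2,
    which follows from b^2 = a^2 + 1 <= 2 a^2. The power 3/2 is the exponent 1 + d / 2 in the worst
    case d = 1. *)
Lemma inv_pow32_le_telescope (n : nat) : (0 < n)%N ->
  (n%:R * Num.sqrt n%:R)^-1 <=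
  4 * ((Num.sqrt n%:R)^-1 - (Num.sqrt n.+1%:R)^-1) :> R.
Proof.
move=> n0; set a := Num.sqrt n%:R; set b := Num.sqrt n.+1%:R.
have a1 : 1 <= a by rewrite -[leLHS]sqrtr1 ler_wsqrtr// ler1n.
have a2 : n%:R = a ^+ 2 by rewrite sqr_sqrtr.
have b2 : b ^+ 2 = a ^+ 2 + 1 by rewrite sqr_sqrtr// -a2 -natr1.
have b1 : 0 < b by rewrite sqrtr_gt0.
have a0 : 0 < a by lra.
have ab : a < b by rewrite -(ltr_pXn2r (n := 2))// ?nnegrE ?ltW// b2; lra.
have -> : a^-1 - b^-1 = (b - a) / (a * b) by field; rewrite !gt_eqF.
rewrite a2 -subr_ge0.
have -> : 4 * ((b - a) / (a * b)) - (a ^+ 2 * a)^-1 =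
   (4 * a ^+ 2 * (b - a) - b) / (a ^+ 3 * b) by field; rewrite !gt_eqF.
rewrite divr_ge0 ?mulr_ge0 ?exprn_ge0 ?(ltW a0) ?(ltW b1)// subr_ge0.
rewrite -(ler_pM2r (x := b + a)); last by lra.
have -> : 4 * a ^+ 2 * (b - a) * (b + a) = 4 * a ^+ 2 * (b ^+ 2 - a ^+ 2) by ring.
have -> : b ^+ 2 - a ^+ 2 = 1 by rewrite b2; ring.
have := sqr_ge0 (b - a); have : 1 <= a ^+ 2 by rewrite exprn_ege1.
by nra.
Qed.

Let pib : 0 < 4 * pi * beta :> R.
Proof. by rewrite !mulr_gt0// pi_gt0. Qed.

Lemma free_weight_gt0 k : 0 < free_weight d beta mu k.+1.
Proof. by rewrite divr_gt0 ?expR_gt0// mulr_gt0// powR_gt0. Qed.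

(** The form comparable with [loop_weight]: the last factor is the Gaussian kernel on the diagonal
    at time (k + 1) beta. *)
Lemma free_weightE k : free_weight d beta mu k.+1 =
  expR (beta * mu * k.+1%:R) / k.+1%:R * (4 * pi * (k.+1%:R * beta)) `^ (- (d%:R / 2)).
Proof.
rewrite /free_weight powRN.
rewrite (_ : 4 * pi * (k.+1%:R * beta) = (4 * pi * beta) * k.+1%:R); last by ring.
rewrite (@powRM _ _ k.+1%:R) ?(ltW pib)// (@powRD _ k.+1%:R); last first.
  by apply/implyP => _; rewrite pnatr_eq0.
by rewrite (@powRr1 _ k.+1%:R)//; field; rewrite nat1r pnatr_eq0 !gt_eqF ?powR_gt0.
Qed.

Lemma free_weight_summable : cvgn (series (fun k => free_weight d beta mu k.+1)).
Proof.
set c := (4 * pi * beta) `^ (d%:R / 2).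
have c0 : 0 < c by exact: powR_gt0.
have le k : free_weight d beta mu k.+1 <= c^-1 * 4 *
    ((Num.sqrt k.+1%:R)^-1 - (Num.sqrt k.+2%:R)^-1).
  apply: (@le_trans _ _ (c^-1 * (k.+1%:R * Num.sqrt k.+1%:R)^-1)); last first.
    by rewrite -mulrA ler_pM2l ?invr_gt0//; exact: inv_pow32_le_telescope.
  rewrite /free_weight -/c invfM mulrCA ler_pM2l ?invr_gt0//.
  rewrite -[leRHS]mul1r ler_pM ?invr_ge0 ?powR_ge0 ?expR_ge0//.
    by rewrite expR_le1 mulr_le0_ge0// pmulr_rle0.
  rewrite lef_pV2 ?posrE ?powR_gt0 ?mulr_gt0 ?sqrtr_gt0//.
  rewrite -powR12_sqrt// -{1}[k.+1%:R in leLHS]powRr1//.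
  rewrite -powRD; last by apply/implyP => _; rewrite pnatr_eq0.
  rewrite ler_powR ?ler1n// lerD2l ler_peMl ?invr_ge0//.
  by rewrite ler1n.
apply: nondecreasing_is_cvgn.
  by apply: nondecreasing_series => k _ _; exact/ltW/free_weight_gt0.
exists (c^-1 * 4) => _ [n _ <-].
apply: (@le_trans _ _ (c^-1 * 4 * (1 - (Num.sqrt n.+1%:R)^-1))); last first.
  by rewrite ler_piMr ?mulr_ge0 ?invr_ge0 ?(ltW c0)// gerBl invr_ge0 sqrtr_ge0.
elim: n => [|n IH].
  by rewrite /series /= big_geq// sqrtr1 invr1 subrr mulr0.
rewrite /series /= big_nat_recr//=; have := le n; move: IH.
rewrite /series /=; set A := \sum_(_ <= _ < _) _.
move: (c^-1 * 4) (_^-1) (_^-1) (free_weight _ _ _ _) => x y z t.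
by rewrite !mulrBr !mulr1; lra.
Qed.

End free_weights.

Section boxes.
Context {R : realType}.

Lemma measurable_tuple_box n (A : 'I_n -> set R) : (forall i, measurable (A i)) ->
  measurable [set x : n.-tuple R | forall i, A i (tnth x i)].
Proof.
move=> mA.
rewrite (_ : [set x | _] = \bigcap_(i in [set: 'I_n]) ((@tnth n R)^~ i @^-1` A i)).
  apply: fin_bigcap_measurable => // i _; rewrite -[X in measurable X]setTI.
  exact: measurable_tnth.
by apply/seteqP; split => x /= h i; [move=> _; exact: h|exact: (h i I)].
Qed.

Lemma lebesgue_tuple_prod n (A : 'I_n -> set R) : (forall i, measurable (A i)) ->
  @lebesgue_tuple R n [set x | forall i, A i (tnth x i)] =
  (\prod_(i < n) (@lebesgue_measure R (A i)))%E.
Proof.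
elim: n A => [|n IH] A mA.
  by rewrite big_ord0 /= diracE mem_set//= => -[].
pose B := [set x : n.-tuple R | forall i, A (lift ord0 i) (tnth x i)].
have mB : measurable B.
  by apply: (@measurable_tuple_box n (fun i => A (lift ord0 i))) => i; exact: mA.
rewrite big_ord_recl -IH//.
rewrite /= /pushforward.
rewrite (_ : _ @^-1` _ = A ord0 `*` B).
  have := @product_measure1E _ _ (measurableTypeR R) (n.-tuple R) R
    (@lebesgue_measure R) (@lebesgue_tuple R n) (A ord0) B (mA ord0) mB.
  by [].
apply/seteqP; split => -[x y] /=.
  move=> h; split; first by have := h ord0; rewrite tnth0.
  by move=> i; have := h (lift ord0 i); rewrite tnthS.
by move=> [hx hy] i; case: (unliftP ord0 i) => [j|] ->; rewrite ?tnthS ?tnth0.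
Qed.

Lemma measurable_tuple_itv d (a b : 'I_d -> R) :
  measurable [set x : d.-tuple R | forall i, a i <= tnth x i <= b i].
Proof.
rewrite (_ : [set x | _] = [set x : d.-tuple R | forall i, [set` `[a i, b i]] (tnth x i)]).
  by apply: (@measurable_tuple_box d (fun i => [set` `[a i, b i]])) => i; exact: measurable_itv.
by apply/seteqP; split => x /= h i; have := h i; rewrite /= in_itv.
Qed.

Lemma measurable_box d N : measurable (box N : set (d.-tuple R)).
Proof. exact: (@measurable_tuple_itv d (fun=> - N%:R) (fun=> N%:R)). Qed.

Lemma lebesgue_tuple_itv d (a b : 'I_d -> R) : (forall i, a i <= b i) ->
  @lebesgue_tuple R d [set x | forall i, a i <= tnth x i <= b i] =
  (\prod_(i < d) (b i - a i))%:E.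
Proof.
move=> ab; rewrite [X in lebesgue_tuple X](_ : _ =
    [set x : d.-tuple R | forall i, [set` `[a i, b i]] (tnth x i)]).
  rewrite (@lebesgue_tuple_prod d (fun i => [set` `[a i, b i]])) -?prodEFin.
    apply: eq_bigr => i _; rewrite lebesgue_measure_itv/= lte_fin.
    case: ltP => // ba; rewrite (_ : a i = b i) ?subrr//.
    by apply/eqP; rewrite eq_le ab.
  by move=> i; exact: measurable_itv.
by apply/seteqP; split => x /= h i; have := h i; rewrite /= in_itv.
Qed.

Lemma lebesgue_tuple_box d N : @lebesgue_tuple R d (box N) = (volume d N)%:E.
Proof.
rewrite (@lebesgue_tuple_itv d (fun=> - N%:R) (fun=> N%:R)).
  by rewrite prodr_const card_ord /volume opprK mulr_natl mulr2n.
by move=> _; rewrite lerNl ?lerN10 (le_trans _ (ler0n _ _))// oppr_le0.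
Qed.

End boxes.

Section integral_bounds.
Context d (T : measurableType d) (R : realType) (m : {measure set T -> \bar R}).
Implicit Types (D E : set T) (f : T -> R).

(* The integral of a nonnegative function is a supremum over simple functions,
   so no measurability is needed for these bounds. *)
Lemma ge0_integral_le_cst D f c : measurable D ->
  (forall x, D x -> 0 <= f x <= c) ->
  (\int[m]_(x in D) (f x)%:E <= c%:E * m D)%E.
Proof.
move=> mD fc; rewrite -integral_cst//.
rewrite !ge0_integralE; last 2 first.
- by move=> x /fc/andP[f0 fx]; rewrite lee_fin (le_trans f0).
- by move=> x /fc/andP[f0 fx]; rewrite lee_fin.
apply: ge_ereal_sup => _ [h /= hf <-]; apply: ereal_sup_ubound; exists h => // x /=.
apply: (le_trans (hf x)); rewrite /patch; case: ifPn => // /set_mem Dx.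
by rewrite lee_fin; have /andP[] := fc x Dx.
Qed.

Lemma ge0_integral_ge_cst D E f c : measurable E -> E `<=` D -> 0 <= c ->
  (forall x, D x -> 0 <= f x) -> (forall x, E x -> c <= f x) ->
  (c%:E * m E <= \int[m]_(x in D) (f x)%:E)%E.
Proof.
move=> mE ED c0 f0 fc; rewrite -integral_cst//.
rewrite !ge0_integralE//.
apply: ge_ereal_sup => _ [h /= hf <-]; apply: ereal_sup_ubound; exists h => // x /=.
apply: (le_trans (hf x)); rewrite /patch; case: ifPn => [/set_mem Ex|_].
  by rewrite mem_set ?lee_fin; [exact: fc|exact: ED].
by case: ifPn => // /set_mem Dx; rewrite lee_fin f0.
Qed.

End integral_bounds.

Section esum_products.
Context {R : realType}.

Lemma esumZl_le (T : choiceType) (A : set T) (c : R) (f : T -> \bar R) :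
  0 <= c -> (forall x, (0 <= f x)%E) ->
  (\esum_(x in A) (c%:E * f x) <= c%:E * \esum_(x in A) f x)%E.
Proof.
move=> c0 f0; apply: ge_ereal_sup => _ [X [fX XA] <-].
rewrite fsbig_finite//= -ge0_sume_distrr//.
by rewrite lee_wpmul2l ?lee_fin// -fsbig_finite//=; apply: esum_ge; exists X.
Qed.

Lemma esum_tuple_prod_le (T : choiceType) n (f : T -> R) (c : R) :
  (forall x, 0 <= f x) -> (\esum_(x in [set: T]) (f x)%:E <= c%:E)%E ->
  (\esum_(z in [set: n.-tuple T]) (\prod_(i < n) f (tnth z i))%:E <= (c ^+ n)%:E)%E.
Proof.
move=> f0 fc.
have c0 : 0 <= c.
  by rewrite -lee_fin; apply: le_trans fc; apply: esum_ge0 => x _; rewrite lee_fin.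
elim: n => [|n IH].
  rewrite (_ : [set: _] = [set [tuple]]); last first.
    by apply/seteqP; split => // x _; apply/val_inj; rewrite /= tuple0.
  rewrite esum_set1; last by rewrite lee_fin prodr_ge0.
  by rewrite big_ord0.
pose e (p : T * n.-tuple T) : n.+1.-tuple T := [tuple of p.1 :: p.2].
have be : set_bij ([set: T] `*`` (fun=> [set: n.-tuple T])) [set: n.+1.-tuple T] e.
  split => //.
    move=> [x y] [x' y'] _ _ /(congr1 val) [-> /val_inj ->] //.
  move=> z _; case/tupleP: z => x y; by exists (x, y).
rewrite (reindex_esum _ _ _ _ be).
rewrite -(@esum_esum _ _ _ [set: T] (fun=> setT)
    (fun x y => (\prod_(i < n.+1) f (tnth (e (x, y)) i))%:E)); last first.
  by move=> x y; rewrite lee_fin prodr_ge0.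
apply: (@le_trans _ _ (\esum_(x in [set: T]) ((c ^+ n)%:E * (f x)%:E))%E).
  apply: le_esum => x _.
  under eq_esum => y _.
    rewrite big_ord_recl tnth0.
    under eq_bigr do rewrite tnthS.
    rewrite EFinM; over.
  apply: (le_trans (esumZl_le _ (f0 x) _)).
    by move=> y; rewrite lee_fin prodr_ge0.
  by rewrite muleC lee_wpmul2r ?lee_fin.
apply: (le_trans (esumZl_le _ (exprn_ge0 n c0) _)).
  by move=> x; rewrite lee_fin.
by rewrite exprSr EFinM lee_wpmul2l ?lee_fin ?exprn_ge0.
Qed.

(** Since r^(n^2) <= r^n and r <= 1/2, each half-line is dominated by a geometric series. The
    negative integers contribute 2 r; the positive ones are bounded by 4 r, because their series is
    indexed from 1 and loses a factor 2 against [epsilon_trick0]. *)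
Lemma esum_int_gauss_le (r : R) : 0 <= r <= 2^-1 ->
  (\esum_(z in [set: int]) (r ^+ (`|z| ^ 2)%N)%:E <= (1 + 6 * r)%:E)%E.
Proof.
move=> /andP[r0 r2].
have rn0 n : (0 <= (r ^+ n)%:E)%E by rewrite lee_fin exprn_ge0.
have rexp n : r ^+ (n.+1 ^ 2) <= 2 * r / (2 ^ n.+1)%:R.
  apply: (@le_trans _ _ (r ^+ n.+1)).
    rewrite ler_wiXn2l//; first lra.
    by rewrite expnS expn1 leq_pmulr.
  rewrite exprS expnS natrM natrX.
  have -> : 2 * r / (2 * 2 ^+ n) = r * 2^-1 ^+ n.
    by rewrite exprVn; field; rewrite expf_neq0.
  by rewrite ler_wpM2l// lerXn2r ?nnegrE ?invr_ge0.
have tail : (\sum_(0 <= n <oo) (r ^+ (n.+1 ^ 2))%:E <= (2 * r)%:E)%E.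
  apply: le_trans (epsilon_trick0 xpredT _); last by rewrite mulr_ge0.
  by apply: lee_nneseries => // n _; rewrite lee_fin.
rewrite (esumID (range Posz)); last by move=> z _.
rewrite setTI (_ : ~` range Posz = range Negz) ?setTI; last first.
  apply/seteqP; split => z /=; case: z => n //.
  - by move=> []; exists n.
  - by move=> _; exists n.
  - by move=> [].
  - by move=> _ [].
rewrite !esum_image//; last 2 first.
- by move=> m n _ _ [].
- by move=> m n _ _ [].
rewrite -!nneseries_esumT//.
rewrite nneseries_recl//= expr0 (_ : 1 + 6 * r = 1 + 4 * r + 2 * r); last by lra.
rewrite !EFinD; apply: leeD => //; rewrite leeD2l// eseries_cond.
apply: le_trans (epsilon_trick0 (fun n => (1 <= n)%N) _); last by rewrite mulr_ge0.
apply: lee_nneseries => // -[//|n] _; rewrite lee_fin; apply: (le_trans (rexp n)).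
rewrite [in leRHS]expnS natrM invfM mulrA ler_wpM2r ?invr_ge0//.
by lra.
Qed.

End esum_products.

Section loop_weights.
Context {R : realType}.
Variables (d : nat) (beta mu : R).
Hypothesis b0 : 0 < beta.

Local Notation peak t := ((4 * pi * t) `^ (- (d%:R / 2)) : R).

Lemma volume_gt0 N : (0 < N)%N -> 0 < volume d N :> R.
Proof. by move=> N0; rewrite exprn_gt0// mulr_gt0// ltr0n. Qed.

Lemma loop_weight_le N (g : R -> d.-tuple R -> d.-tuple R -> R) k C :
  (0 < N)%N -> 0 <= C ->
  (forall x, box N x -> 0 <= g (k.+1%:R * beta) x x <= C * peak (k.+1%:R * beta)) ->
  0 <= loop_weight beta mu N g k.+1 <= C * free_weight d beta mu k.+1.
Proof.
move=> N0 C0 hg; have V0 := volume_gt0 N0.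
rewrite /loop_weight; case: ifP => _; last first.
  by rewrite lexx mulr_ge0// ltW// free_weight_gt0.
have h1 : (\int[@lebesgue_tuple R d]_(x in box N) (g (k.+1%:R * beta) x x)%:E <=
    (C * peak (k.+1%:R * beta))%:E * (volume d N)%:E)%E.
  rewrite -(@lebesgue_tuple_box R d N).
  exact: (ge0_integral_le_cst (@lebesgue_tuple R d) (@measurable_box R d N) hg).
move: h1.
have : (0 <= \int[@lebesgue_tuple R d]_(x in box N) (g (k.+1%:R * beta) x x)%:E)%E.
  by apply: integral_ge0 => x /hg/andP[]; rewrite lee_fin.
rewrite /Rintegral; case: (integral _ _ _) => [s| |] //=.
rewrite !lee_fin => s0 sC.
rewrite mulr_ge0//=; last by rewrite divr_ge0 ?expR_ge0// mulr_ge0 ?(ltW V0).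
rewrite free_weightE// -subr_ge0.
have -> : C * (expR (beta * mu * k.+1%:R) / k.+1%:R * peak (k.+1%:R * beta)) -
    expR (beta * mu * k.+1%:R) / (k.+1%:R * volume d N) * s =
  expR (beta * mu * k.+1%:R) / (k.+1%:R * volume d N) *
    (C * peak (k.+1%:R * beta) * volume d N - s).
  by field; rewrite nat1r pnatr_eq0 gt_eqF.
by rewrite mulr_ge0 ?divr_ge0 ?expR_ge0 ?mulr_ge0 ?(ltW V0)// subr_ge0.
Qed.

(** The upper bound on the kernel keeps the integral finite: the real-valued integral of a function
    of infinite integral would be 0. *)
Lemma loop_weight_ge N (g : R -> d.-tuple R -> d.-tuple R -> R) k C c
    (E : set (d.-tuple R)) (e : R) :
  (0 < N)%N -> (k.+1 <= N)%N -> 0 <= c -> measurable E -> E `<=` box N ->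
  @lebesgue_tuple R d E = e%:E ->
  (forall x, box N x -> 0 <= g (k.+1%:R * beta) x x <= C * peak (k.+1%:R * beta)) ->
  (forall x, E x -> c * peak (k.+1%:R * beta) <= g (k.+1%:R * beta) x x) ->
  c * (e / volume d N) * free_weight d beta mu k.+1 <= loop_weight beta mu N g k.+1.
Proof.
move=> N0 kN c0 mE EN Ee hg hc; have V0 := volume_gt0 N0.
rewrite /loop_weight kN.
have h1 : (\int[@lebesgue_tuple R d]_(x in box N) (g (k.+1%:R * beta) x x)%:E <=
    (C * peak (k.+1%:R * beta))%:E * (volume d N)%:E)%E.
  rewrite -(@lebesgue_tuple_box R d N).
  exact: (ge0_integral_le_cst (@lebesgue_tuple R d) (@measurable_box R d N) hg).
have g0 x : box N x -> 0 <= g (k.+1%:R * beta) x x by move=> /hg/andP[].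
have cp : 0 <= c * peak (k.+1%:R * beta) by rewrite mulr_ge0 ?powR_ge0.
have : ((c * peak (k.+1%:R * beta))%:E * e%:E <=
    \int[@lebesgue_tuple R d]_(x in box N) (g (k.+1%:R * beta) x x)%:E)%E.
  by rewrite -Ee; exact: (ge0_integral_ge_cst (@lebesgue_tuple R d) mE EN cp g0 hc).
move: h1; rewrite /Rintegral; case: (integral _ _ _) => [s| |] //=.
rewrite !lee_fin => _ se.
rewrite free_weightE// -subr_ge0.
have -> : expR (beta * mu * k.+1%:R) / (k.+1%:R * volume d N) * s -
    c * (e / volume d N) * (expR (beta * mu * k.+1%:R) / k.+1%:R * peak (k.+1%:R * beta)) =
  expR (beta * mu * k.+1%:R) / (k.+1%:R * volume d N) *
    (s - c * peak (k.+1%:R * beta) * e).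
  by field; rewrite nat1r pnatr_eq0 gt_eqF.
by rewrite mulr_ge0 ?divr_ge0 ?expR_ge0 ?mulr_ge0 ?(ltW V0)// subr_ge0.
Qed.

(** The image at 2 N z lies at squared distance 4 N^2 |z|^2, so relative to z = 0 it contributes the
    product over i of r^(z_i^2). The lattice sum is thus controlled by the d-th power of a sum over
    the integers; the term z = 0 alone gives the lower bound. *)
Lemma periodic_kernel_bounds N t (x : d.-tuple R) :
  let r := expR (- (N%:R ^+ 2 / t)) in 0 < t -> r <= 2^-1 ->
  peak t <= periodic_kernel N t x x <= (1 + 6 * r) ^+ d * peak t.
Proof.
move=> r t0 r2.
have r0 : 0 <= r by exact: expR_ge0.
have gE (z : d.-tuple int) : gauss_kernel t x
    (translate x [tuple 2 * N%:R * (tnth z i)%:~R | i < d]) =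
    peak t * \prod_(i < d) r ^+ (`|tnth z i| ^ 2)%N.
  rewrite /gauss_kernel; congr (_ * _).
  rewrite /r; under [RHS]eq_bigr do rewrite -expRM_natr.
  rewrite -expR_sum; congr expR; rewrite -sumrN mulr_suml; apply: eq_bigr => i _.
  rewrite /translate !tnth_mktuple natrX natr_absz.
  rewrite intr_norm real_normK ?num_real//.
  by field; rewrite gt_eqF.
have S1 := esum_tuple_prod_le d (fun z : int => exprn_ge0 (`|z| ^ 2)%N r0)
   (esum_int_gauss_le (introT andP (conj r0 r2))).
set S := (\esum_(_ in _) _)%E in S1.
have S0 : (1 <= S)%E.
  apply: esum_ge; exists [set [tuple 0%R | i < d]].
    by split; [exact: finite_set1|move=> z].
  rewrite fsbig_set1 big1// => i _.
  by rewrite tnth_mktuple absz0.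
have p0 : 0 <= peak t by exact: powR_ge0.
have up : (\esum_(z in [set: d.-tuple int]) (gauss_kernel t x
    (translate x [tuple (2 * N%:R * (tnth z i)%:~R)%R | i < d]))%:E <=
    (peak t)%:E * S)%E.
  under eq_esum do rewrite gE EFinM.
  by apply: esumZl_le => // z; rewrite lee_fin prodr_ge0// => i _; rewrite exprn_ge0.
have lo : ((peak t)%:E <= \esum_(z in [set: d.-tuple int]) (gauss_kernel t x
    (translate x [tuple (2 * N%:R * (tnth z i)%:~R)%R | i < d]))%:E)%E.
  apply: esum_ge; exists [set [tuple 0%R | i < d]].
    by split; [exact: finite_set1|move=> z].
  rewrite fsbig_set1 gE big1 ?mulr1// => i _.
  by rewrite tnth_mktuple absz0.
rewrite /periodic_kernel; move: up lo.
have fS : S = (fine S)%:E.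
  by rewrite fineK// ge0_fin_numE ?(le_lt_trans S1) ?ltry// (le_trans _ S0).
move: S1; rewrite fS lee_fin => S1; case: (esum _ _) => [s| |] //=.
rewrite !lee_fin => up ->/=; apply: (le_trans up).
by rewrite mulrC ler_wpM2r.
Qed.

Lemma expR_Nnat_div_cvg : (fun N : nat => expR (- (N%:R / beta))) @ \oo --> (0 : R).
Proof.
have h : (fun N : nat => N%:R / beta) @ \oo --> +oo.
  apply/cvgryPge => A; near=> N; rewrite ler_pdivlMr//.
  by near: N; exact: nbhs_infty_ger.
apply: (@cvg_comp _ _ _ (fun N : nat => N%:R / beta) (fun x => expR (- x))) h _.
exact: cvgr_expR.
Unshelve. all: by end_near. Qed.

(** The cut-off k <= N turns N^2 / (k beta) into at least N / beta, an estimate uniform in k. Once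
    the resulting ratio is at most 1/2, the factor 1 + 6 r is at most 4. *)
Lemma periodic_weights (qN := fun N k => loop_weight beta mu N (@periodic_kernel R d N) k.+1) :
  (\forall N \near \oo, forall k, 0 <= qN N k <= 4 ^+ d * free_weight d beta mu k.+1) /\
  forall k, qN ^~ k @ \oo --> free_weight d beta mu k.+1.
Proof.
pose s N := expR (- (N%:R / beta)).
have s2 : \forall N \near \oo, s N <= 2^-1.
  by apply: (cvgr_le 0 expR_Nnat_div_cvg); rewrite invr_gt0.
have rs N k : (0 < N)%N -> (k.+1 <= N)%N -> expR (- (N%:R ^+ 2 / (k.+1%:R * beta))) <= s N.
  move=> N0 kN; rewrite ler_expR lerN2 invfM mulrA ler_pM2r ?invr_gt0//.
  by rewrite ler_pdivlMr// expr2 ler_wpM2l// ler_nat.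
have kb k : 0 < k.+1%:R * beta by rewrite mulr_gt0.
have bnd N k (x : d.-tuple R) : (0 < N)%N -> (k.+1 <= N)%N -> s N <= 2^-1 ->
    peak (k.+1%:R * beta) <= periodic_kernel N (k.+1%:R * beta) x x <=
    (1 + 6 * s N) ^+ d * peak (k.+1%:R * beta).
  move=> N0 kN sN; have h := rs N k N0 kN.
  have /andP[h1 h2] := @periodic_kernel_bounds N (k.+1%:R * beta) x (kb k) (le_trans h sN).
  rewrite h1 /=; apply: (le_trans h2); rewrite ler_wpM2r ?powR_ge0// lerXn2r ?nnegrE//.
  - by rewrite addr_ge0// mulr_ge0// expR_ge0.
  - by rewrite lerD2l ler_wpM2l.
have up N k : (0 < N)%N -> s N <= 2^-1 ->
   0 <= qN N k <= (1 + 6 * s N) ^+ d * free_weight d beta mu k.+1.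
  move=> N0 sN; have s0 : 0 <= s N by exact: expR_ge0.
  have c0 : 0 <= (1 + 6 * s N) ^+ d by rewrite exprn_ge0// addr_ge0// mulr_ge0.
  have [kN|Nk] := leqP k.+1 N; last first.
    rewrite /qN /loop_weight leqNgt Nk /= lexx mulr_ge0//.
    by rewrite ltW// free_weight_gt0.
  apply: loop_weight_le => // x _; have /andP[h1 h2] := bnd N k x N0 kN sN.
  by rewrite h2 andbT (le_trans _ h1)// powR_ge0.
split.
  near=> N => k.
  have N0 : (0 < N)%N by near: N; exact: nbhs_infty_gt.
  have sN : s N <= 2^-1 by near: N.
  have /andP[-> h] := up N k N0 sN.
  have f0 : 0 <= free_weight d beta mu k.+1 by rewrite ltW// free_weight_gt0.
  rewrite /=; apply: (le_trans h); rewrite ler_wpM2r// lerXn2r ?nnegrE//.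
    by rewrite addr_ge0// mulr_ge0// expR_ge0.
  by lra.
move=> k.
apply: (@squeeze_cvgr _ _ _ _ (fun=> free_weight d beta mu k.+1)
    (fun N => (1 + 6 * s N) ^+ d * free_weight d beta mu k.+1)).
- near=> N.
  have N0 : (0 < N)%N by near: N; exact: nbhs_infty_gt.
  have kN : (k.+1 <= N)%N by near: N; exact: nbhs_infty_ge.
  have sN : s N <= 2^-1 by near: N.
  have /andP[_ ->] := up N k N0 sN; rewrite andbT.
  have := @loop_weight_ge N (@periodic_kernel R d N) k ((1 + 6 * s N) ^+ d) 1 (box N)
    (volume d N) N0 kN ler01 (@measurable_box R d N) (@subset_refl _ _) (@lebesgue_tuple_box R d N).
  rewrite !mul1r divff ?mul1r ?gt_eqF ?volume_gt0//; apply=> x _.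
    have /andP[h1 ->] := bnd N k x N0 kN sN; rewrite andbT.
    by rewrite (le_trans _ h1)// powR_ge0.
  by have /andP[] := bnd N k x N0 kN sN.
- exact: cvg_cst.
- rewrite -[X in _ --> X]mul1r; apply: cvgM; last exact: cvg_cst.
  rewrite -[X in _ --> X](expr1n _ d).
  have h : (fun N => 1 + 6 * s N) @ \oo --> (1 : R).
    rewrite -[X in _ --> X]addr0 -[X in _ --> _ + X](mulr0 6).
    by apply: cvgD; [exact: cvg_cst|apply: cvgMr; exact: expR_Nnat_div_cvg].
  apply: (@cvg_comp _ _ _ (fun N => 1 + 6 * s N) (fun x : R => x ^+ d)); first exact: h.
  exact: exprn_continuous.
Unshelve. all: by end_near. Qed.

End loop_weights.

(** * Brownian motion in a box *)

Lemma measurable_norm_gt {R : realType} (u : R) : measurable [set x : R | u < `|x|].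
Proof.
rewrite (_ : [set x : R | u < `|x|] = `]-oo, (- u)[ `|` `]u, +oo[).
  by apply: measurableU; exact: measurable_itv.
apply/seteqP; split => x /=; rewrite !in_itv /= andbT lter_normr ltrNr.
  by move=> /orP[]; [right|left].
by move=> [->|->//]; rewrite orbT.
Qed.

Section normal_bounds.
Context {R : realType}.
Implicit Types (s u a b rho : R).

Lemma normal_prob_itv_le s a b : s != 0 -> a <= b ->
  (normal_prob 0 s `[a, b] <= ((b - a) * normal_peak s)%:E)%E.
Proof.
move=> s0 ab; apply: (@le_trans _ _
    (\int[@lebesgue_measure R]_(x in `[a, b]) (cst (normal_peak s)%:E) x)%E).
  apply: ge0_le_integral => //.
  - by move=> x _; rewrite lee_fin normal_pdf_ge0.
  - apply/measurable_EFinP; apply: measurable_funTS; exact: measurable_normal_pdf.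
  - by move=> x _; rewrite lee_fin normal_pdf_ub.
rewrite integral_cst//= lebesgue_measure_itv/= lte_fin.
case: ltP => [_|ba]; first by rewrite -EFinM mulrC.
by rewrite mule0 lee_fin mulr_ge0 ?subr_ge0 ?normal_peak_ge0.
Qed.

Lemma normal_prob_itv_ge s a b rho : s != 0 -> a <= b ->
  (forall x, a <= x <= b -> `|x| <= rho) ->
  (((b - a) * (normal_peak s * expR (- (rho ^+ 2 / (s ^+ 2 *+ 2)))))%:E
    <= normal_prob 0 s `[a, b])%E.
Proof.
move=> s0 ab hr; set c := normal_peak s * _.
have c0 : 0 <= c by rewrite mulr_ge0 ?normal_peak_ge0 ?expR_ge0.
apply: (@le_trans _ _
    (\int[@lebesgue_measure R]_(x in `[a, b]) (cst c%:E) x)%E).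
  rewrite integral_cst//= lebesgue_measure_itv/= lte_fin.
  case: ltP => [_|ba]; first by rewrite -EFinM mulrC.
  by rewrite (_ : b = a) ?subrr ?mul0r ?mule0//; apply/eqP; rewrite eq_le ab ba.
apply: ge0_le_integral => //.
- apply/measurable_EFinP; apply: measurable_funTS; exact: measurable_normal_pdf.
- move=> x /=; rewrite in_itv/= => /hr xr.
  rewrite lee_fin normal_pdfE// /c ler_wpM2l ?normal_peak_ge0// ler_expR.
  rewrite subr0 mulNr lerN2 ler_wpM2r ?invr_ge0 ?mulrn_wge0 ?sqr_ge0//.
  by rewrite -[leLHS]real_normK ?num_real// lerXn2r// nnegrE (le_trans _ xr).
Qed.

(* Beyond distance [u] the density is dominated by a small multiple of the
   Gaussian density with doubled variance. *)
Lemma normal_prob_tail_le s u : 0 < s -> 0 <= u ->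
  (normal_prob 0 s [set x : R | (u < `|x|)%R]
    <= (Num.sqrt 2 * expR (- (u ^+ 2 / (4 * s ^+ 2))))%:E)%E.
Proof.
move=> s0 u0; set c := Num.sqrt 2 * _.
pose s' := Num.sqrt 2 * s.
have s'0 : 0 < s' by rewrite mulr_gt0// sqrtr_gt0.
have s'2 : s' ^+ 2 = 2 * s ^+ 2 by rewrite exprMn sqr_sqrtr.
have c0 : 0 <= c by rewrite mulr_ge0 ?sqrtr_ge0 ?expR_ge0.
have mA := measurable_norm_gt u.
apply: (@le_trans _ _ (\int[@lebesgue_measure R]_(x in [set x : R | (u < `|x|)%R])
     (c%:E * (normal_pdf 0 s' x)%:E))%E).
  apply: ge0_le_integral => //.
  - by move=> x _; rewrite lee_fin normal_pdf_ge0.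
  - apply/measurable_EFinP; apply: measurable_funTS; exact: measurable_normal_pdf.
  - apply/measurable_EFinP; apply: measurable_funTS.
    by apply: measurable_funM => //; exact: measurable_normal_pdf.
  move=> x /= ux; rewrite -EFinM lee_fin !normal_pdfE ?gt_eqF//.
  have -> : normal_peak s' = (Num.sqrt 2)^-1 * normal_peak s.
    by rewrite /normal_peak s'2 -mulrA -mulrnAr sqrtrM// invfM.
  have -> : c * ((Num.sqrt 2)^-1 * normal_peak s * normal_fun 0 s' x) =
     normal_peak s * (expR (- (u ^+ 2 / (4 * s ^+ 2))) * normal_fun 0 s' x).
    by rewrite /c; field; rewrite gt_eqF// sqrtr_gt0.
  rewrite ler_wpM2l ?normal_peak_ge0// /normal_fun !subr0 -expRD ler_expR s'2.
  have x2 : u ^+ 2 <= x ^+ 2.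
    by rewrite -[leRHS]real_normK ?num_real// lerXn2r// ?nnegrE// ltW.
  have -> : - x ^+ 2 / (s ^+ 2 *+ 2) = - (x ^+ 2 / (4 * s ^+ 2)) - (x ^+ 2 / (4 * s ^+ 2)).
    by rewrite -mulr_natl; field; rewrite gt_eqF.
  have -> : - x ^+ 2 / ((2 * s ^+ 2) *+ 2) = - (x ^+ 2 / (4 * s ^+ 2)).
    by rewrite -mulr_natl; field; rewrite gt_eqF.
  by rewrite lerD2r lerN2 ler_wpM2r// invr_ge0 mulr_ge0// sqr_ge0.
rewrite ge0_integralZl//; last 2 first.
- apply/measurable_EFinP; apply: measurable_funTS; exact: measurable_normal_pdf.
- by move=> x _; rewrite lee_fin normal_pdf_ge0.
rewrite -[leRHS]mule1 lee_wpmul2l ?lee_fin//.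
exact: (@probability_le1 _ _ _ (normal_prob 0 s')).
Qed.

End normal_bounds.

Section small_cells.
Context {R : realType} (h : R).
Hypothesis h0 : 0 < h.

(* The cells [k h, (k + 1) h[ are numbered by [pickle], so that sums over them
   are series. *)
Definition cell (n : nat) : set R := [set x | pickle (Num.floor (x / h)) = n].

Lemma cellP n : cell n = set0 \/ exists k : int, cell n = `[k%:~R * h, (k + 1)%:~R * h[%classic.
Proof.
have [[k <-]|nk] := pselect (exists k : int, pickle k = n); [right|left].
  exists k; apply/seteqP; split => x; rewrite /cell /= in_itv/=.
    move=> /(pcan_inj pickleK) <-.
    by rewrite -ler_pdivlMr// -ltr_pdivrMr// floor_itv ?num_real.
  rewrite -ler_pdivlMr// -ltr_pdivrMr// => /floor_def ->//.
by apply/seteqP; split => x // hx; apply: nk; exists (Num.floor (x / h)).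
Qed.

Lemma measurable_cell n : measurable (cell n).
Proof. by have [->|[k ->]] := cellP n; [exact: measurable0|exact: measurable_itv]. Qed.

End small_cells.

Section grouped_independence.
Context {dO} {O : measurableType dO} {R : realType} (P : probability O R).
Context {d : nat} (X : nat * 'I_d -> O -> R).
Hypothesis mX : forall l, measurable_fun setT (X l).
Hypothesis indX : mutually_independent P X.

Let mXA l (A : set R) : measurable A -> measurable (X l @^-1` A).
Proof. by move=> mA; rewrite -[X in measurable X]setTI; exact: mX. Qed.

Variables (p0 : nat) (c : R) (J : seq (nat * 'I_d)).
Hypotheses (c0 : 0 <= c) (uJ : uniq J) (J0 : forall l, l \in J -> l.1 != p0).
Hypothesis Xp0 : forall i a b, a <= b ->
  (P (X (p0, i) @^-1` `[a, b]) <= (c * (b - a))%:E)%E.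

Let past (A : nat * 'I_d -> set R) := \bigcap_(l in [set` J]) (X l @^-1` A l).

Let row_sum s i w := X (p0, i) w + \sum_(l <- s | l.2 == i) X l w.

Let mpast A : (forall l, measurable (A l)) -> measurable (past A).
Proof. by move=> mA; apply: fin_bigcap_measurable => // l _; exact: mXA. Qed.

Let mrow s (a b : 'I_d -> R) :
  measurable [set w | forall i, a i <= row_sum s i w <= b i].
Proof.
rewrite (_ : [set w | _] = \bigcap_(i in [set: 'I_d]) ((row_sum s i) @^-1` `[a i, b i])).
  apply: fin_bigcap_measurable => // i _; rewrite -[X in measurable X]setTI.
  suff m : measurable_fun setT (row_sum s i) by apply: m => //; exact: measurable_itv.
  apply: measurable_funD => //; elim: s => [|l s IH].
    by under eq_fun do rewrite big_nil; exact: measurable_cst.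
  case li : (l.2 == i); last by under eq_fun do rewrite big_cons li.
  by under eq_fun do rewrite big_cons li; exact: measurable_funD.
by apply/seteqP; split => w /= hw i; [move=> _|]; have := hw i; rewrite /= in_itv//=; exact.
Qed.

(* Independence is only available as a product formula for rectangles. It is
   enough: the other increments are confined one at a time to cells of size [h],
   which moves the bounds on the row sum by [h], and then [h] tends to 0. *)
Lemma row_sum_density_le s (A : nat * 'I_d -> set R) (a b : 'I_d -> R) :
  {subset s <= J} -> (forall l, measurable (A l)) -> (forall i, a i <= b i) ->
  (P ([set w | forall i, (a i <= row_sum s i w <= b i)%R] `&` past A)
    <= (\prod_(i < d) (c * (b i - a i)))%:E * P (past A))%E.
Proof.
elim: s A a b => [|l s IH] A a b sJ mA ab.
  pose A' l := if l.1 == p0 then `[a l.2, b l.2]%classic else A l.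
  have mA' l : measurable (A' l).
    by rewrite /A'; case: ifP => _; [exact: measurable_itv|exact: mA].
  pose row := [seq (p0, i) | i <- enum 'I_d].
  have uJ' : uniq (J ++ row).
    rewrite cat_uniq uJ /= map_inj_uniq ?enum_uniq ?andbT//; last by move=> i j [].
    by apply/hasPn => _ /mapP[i _ ->]; apply/negP => /J0; rewrite eqxx.
  rewrite (_ : _ `&` _ = \bigcap_(l in [set` J ++ row]) (X l @^-1` A' l)); last first.
    apply/seteqP; split => w /=.
      move=> [hw hp] l /=; rewrite mem_cat /A' => /orP[lJ|/mapP[i _ ->]] /=.
        by rewrite (negbTE (J0 lJ)); exact: hp.
      by rewrite eqxx /= in_itv /=; have := hw i; rewrite /row_sum big_nil addr0.
    move=> hw; split=> [i|l /= lJ].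
      have := hw (p0, i); rewrite /= mem_cat /A' /= eqxx /= in_itv/= /row_sum big_nil addr0.
      by apply; apply/orP; right; apply: map_f; rewrite mem_enum.
    by have := hw l; rewrite /= mem_cat lJ /A' (negbTE (J0 lJ)); exact.
  rewrite indX// /past indX// big_cat/= muleC; apply: lee_pmul => //.
  - by apply: prode_ge0.
  - by apply: prode_ge0.
  - rewrite big_map big_enum /= -prodEFin.
    by apply: lee_prod => // i _; rewrite /A' /= eqxx; exact: Xp0.
  - rewrite (eq_big_seq (fun l => P (X l @^-1` A l)))// => l lJ.
    by rewrite /A' (negbTE (J0 lJ)).
have [lJ sJ'] : l \in J /\ {subset s <= J}.
  by split; [apply: sJ; exact: mem_head|move=> x xs; apply: sJ; rewrite inE xs orbT].
set G := _ `&` past A.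
have mG : measurable G by apply: measurableI; [exact: mrow|exact: mpast].
have split_cells (E : set O) h : 0 < h -> measurable E ->
    P E = (\sum_(0 <= n <oo) P (E `&` (X l @^-1` cell h n)))%E.
  move=> h0 mE; rewrite {1}(_ : E = \bigcup_n (E `&` (X l @^-1` cell h n))).
    rewrite measure_bigcup//.
    - by apply: eq_eseriesl => n; rewrite in_setT.
    - by move=> n _; apply: measurableI => //; apply: mXA; exact: measurable_cell.
    - by move=> m n _ _ [w [[_ <-] [_ <-]]].
  apply/seteqP; split => w => [Ew|[n _ []//]].
  by exists (pickle (Num.floor (X l w / h))).
have main h : 0 < h -> (P G <= (\prod_(i < d) (c * (b i - a i + (if i == l.2 then h else 0))))%:E
    * P (past A))%E.
  move=> h0; rewrite (split_cells G h h0 mG) (split_cells _ h h0 (mpast mA)).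
  rewrite -nneseriesZl//.
  apply: lee_nneseries => // n _.
  have [->|[k Ck]] := cellP h0 n.
    by rewrite preimage_set0 !setI0 measure0 mule0.
  (* The cell of X l is recorded in the constraint set of l. There X l lies between k h and (k + 1)
     h, so it leaves the row sum at the price of widening the window of coordinate [l.2] by h. This
     is why the induction is over all A, a and b. *)
  pose A1 l' := if l' == l then A l `&` cell h n else A l'.
  have mA1 l' : measurable (A1 l').
    by rewrite /A1; case: ifP => // _; apply: measurableI => //; exact: measurable_cell.
  pose a1 i := a i - (if i == l.2 then (k + 1)%:~R * h else 0).
  pose b1 i := b i - (if i == l.2 then k%:~R * h else 0).
  have ba1 i : b1 i - a1 i = b i - a i + (if i == l.2 then h else 0).
    by rewrite /b1 /a1; case: ifP => _; rewrite ?intrD; ring.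
  have ab1 i : a1 i <= b1 i.
    by rewrite -subr_ge0 ba1 addr_ge0 ?subr_ge0//; case: ifP => // _; exact: ltW.
  have pA1 : past A1 = past A `&` (X l @^-1` cell h n).
    apply/seteqP; split => w /=.
      move=> hw; split => [l' /= l'J|]; last first.
        by have := hw l lJ; rewrite /= /A1 eqxx => -[].
      by have := hw l' l'J; rewrite /= /A1; case: eqP => [->[]|].
    move=> [hw hn] l' /= l'J; rewrite /A1; case: eqP => [->|_]; last exact: hw.
    by split => //; exact: hw.
  have := IH A1 a1 b1 sJ' mA1 ab1; rewrite pA1.
  under eq_bigr do rewrite ba1; apply: le_trans.
  apply: le_measure; rewrite ?inE.
  - by apply: measurableI => //; apply: mXA; exact: measurable_cell.
  - apply: measurableI; first exact: mrow.
    by rewrite -pA1; exact: mpast.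
  move=> w [[hw hp] hn]; split => //= i; have := hw i.
  rewrite /row_sum big_cons eq_sym /a1 /b1; case: ifP => _; last by rewrite !subr0.
  move: hn; rewrite /= Ck /= in_itv/= => /andP[k1 k2].
  by move=> /andP[h1 h2]; apply/andP; split; lra.
have fA : P (past A) \is a fin_num by rewrite fin_num_measure//; exact: mpast.
have fG : P G \is a fin_num by rewrite fin_num_measure.
rewrite -(fineK fA) -(fineK fG) -EFinM lee_fin.
have := main; rewrite -(fineK fA) -(fineK fG) => {}main.
pose B := \prod_(i < d | i != l.2) (c * (b i - a i)).
have B0 : 0 <= B by apply: prodr_ge0 => i _; rewrite mulr_ge0// subr_ge0.
have A0 : 0 <= fine (P (past A)) by rewrite fine_ge0.
apply/ler_addgt0Pr => e e0.
(* Widening by h raises the bound by c h B P(past A), which is at most e for h = e / K. *)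
pose K := c * B * fine (P (past A)) + 1.
have K0 : 0 < K by rewrite ltr_wpDl// !mulr_ge0.
have := main (e / K); rewrite divr_gt0// => /(_ isT).
rewrite -EFinM lee_fin (bigD1 l.2)//= eqxx (bigD1 (l.2 : 'I_d) (P := xpredT))//= => hle.
apply: (le_trans hle).
rewrite (eq_bigr (fun i => c * (b i - a i))); last by move=> i /negbTE ->; rewrite addr0.
rewrite -/B.
have -> : c * (b l.2 - a l.2 + e / K) * B * fine (P (past A)) =
    c * (b l.2 - a l.2) * B * fine (P (past A)) + (c * B * fine (P (past A))) / K * e.
  by field; rewrite gt_eqF.
rewrite lerD2l ger_pMl// ler_pdivrMr// mul1r /K lerDl//.
Qed.

End grouped_independence.

Section brownian_increments.
Context {dO} {O : measurableType dO} {R : realType} (P : probability O R).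
Context {d : nat} (W : R -> O -> d.-tuple R).
Hypothesis bmW : brownian_motion P W.

Let mW s i : 0 <= s -> measurable_fun setT (fun w => tnth (W s w) i).
Proof.
move=> s0; have [mW _ _ _] := bmW.
by apply: (measurableT_comp (measurable_tnth i)); exact: mW.
Qed.

Lemma brownian_start w i : tnth (W 0 w) i = 0.
Proof. by have [_ + _ _] := bmW; exact. Qed.

(** The position at time tau m is the sum of the increments. Those of row p0 supply the bounded
    density of the endpoint whatever the others are, and the large increment of row p1 is one of
    these others, so both factors survive. *)
Lemma brownian_increment_density (tau : nat -> R) (m p0 p1 : nat) (i0 : 'I_d)
    (a b : 'I_d -> R) (u : R) :
  let v p := Num.sqrt (2 * (tau p.+1 - tau p)) in
  tau 0%N = 0 -> (forall j, tau j < tau j.+1) -> (p0 < m)%N -> (p1 < m)%N ->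
  p1 != p0 -> (forall i, a i <= b i) -> 0 <= u ->
  (P ([set w | forall i, (a i <= tnth (W (tau m) w) i <= b i)%R] `&`
      [set w | (u < `|tnth (W (tau p1.+1) w) i0 - tnth (W (tau p1) w) i0|)%R]) <=
  (\prod_(i < d) (normal_peak (v p0) * (b i - a i)) *
   (Num.sqrt 2 * expR (- (u ^+ 2 / (4 * v p1 ^+ 2)))))%:E)%E.
Proof.
move=> v t0 tS p0m p1m p10 ab u0.
have [_ _ _ /(_ tau)] := bmW; rewrite t0 => /(_ (lexx _) tS) [ind law].
set X : nat * 'I_d -> O -> R := fun p w => _ in ind law.
have tge j : 0 <= tau j.
  by elim: j => [|j IH]; [rewrite t0|exact: ltW (le_lt_trans IH (tS j))].
have v0 p : 0 < v p by rewrite sqrtr_gt0 mulr_gt0// subr_gt0.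
have mX l : measurable_fun setT (X l) by apply: measurable_funB; exact: mW.
pose J := [seq l <- allpairs pair (iota 0 m) (enum 'I_d) | l.1 != p0].
have uJ : uniq J.
  apply/filter_uniq/allpairs_uniq; rewrite ?iota_uniq ?enum_uniq//.
  by move=> [x1 y1] [x2 y2] _ _ /=.
have J0 l : l \in J -> l.1 != p0 by rewrite mem_filter => /andP[].
have q0J : (p1, i0) \in J.
  by rewrite mem_filter/= p10/=; apply/allpairsP; exists (p1, i0); rewrite mem_iota mem_enum.
have Xp0 i (x y : R) : x <= y ->
    (P (X (p0, i) @^-1` `[x, y]) <= (normal_peak (v p0) * (y - x))%:E)%E.
  move=> xy; rewrite law; last exact: measurable_itv.
  by rewrite (mulrC (normal_peak _)); apply: normal_prob_itv_le => //; rewrite gt_eqF //=; exact: v0.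
pose A l := if l == (p1, i0) then [set x : R | u < `|x|] else setT.
have mabs := measurable_norm_gt u.
have mA l : measurable (A l) by rewrite /A; case: ifP.
have := @row_sum_density_le _ _ _ P _ X mX ind p0 (normal_peak (v p0)) J
  (normal_peak_ge0 _) uJ J0 Xp0 J A a b (fun _ => id) mA ab.
have pastE : \bigcap_(l in [set` J]) (X l @^-1` A l) = X (p1, i0) @^-1` [set x | u < `|x|].
  apply/seteqP; split => w /=.
    by move=> /(_ _ q0J); rewrite /A eqxx.
  by move=> h l _; rewrite /A /=; case: eqP => [->|].
have sumE w i : X (p0, i) w + \sum_(l <- J | l.2 == i) X l w = tnth (W (tau m) w) i.
  rewrite /J big_filter_cond big_mkcond big_allpairs_dep /=.
  rewrite (eq_bigr (fun p => if p != p0 then X (p, i) w else 0)); last first.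
    move=> p _; rewrite -big_mkcond /= big_enum_cond /=; case: (p != p0) => /=.
      by rewrite big_pred1_eq.
    by rewrite big_pred0.
  rewrite -big_mkcond /= -(bigD1_seq (r := iota 0 m) p0 (F := fun p => X (p, i) w))/=.
  - rewrite -{1}[m]subn0 -/(index_iota 0 m) /X /=.
    rewrite telescope_sumr//.
    by rewrite t0 brownian_start subr0.
  - by rewrite mem_iota.
  - exact: iota_uniq.
rewrite pastE => h; apply: le_trans (_ : _ <= (\prod_(i < d) (normal_peak (v p0) * (b i - a i)))%:E *
   P (X (p1, i0) @^-1` [set x | (u < `|x|)%R]))%E _.
  apply: le_trans h; rewrite le_eqVlt; apply/orP; left; apply/eqP; congr (P _).
  by apply/seteqP; split => w /= [h1 h2]; split => // i; have := h1 i; rewrite sumE.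
rewrite EFinM lee_wpmul2l//; last by rewrite law//; exact: (normal_prob_tail_le (v0 p1) u0).
by rewrite lee_fin prodr_ge0// => i _; rewrite mulr_ge0 ?normal_peak_ge0// subr_ge0.
Qed.

Lemma brownian_marginal t (A : 'I_d -> set R) : 0 < t -> (forall i, measurable (A i)) ->
  P [set w | forall i, A i (tnth (W t w) i)] =
  (\prod_(i < d) normal_prob 0 (Num.sqrt (2 * t)) (A i))%E.
Proof.
move=> t0 mA; pose tau (j : nat) : R := j%:R * t.
have tS j : tau j < tau j.+1 by rewrite /tau ltr_pM2r// ltr_nat.
have [_ _ _ /(_ tau)] := bmW; rewrite {1}/tau mul0r => /(_ (lexx _) tS) [ind law].
set X : nat * 'I_d -> O -> R := fun p w => _ in ind law.
pose J := [seq (0%N, i) | i <- enum 'I_d].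
have uJ : uniq J by rewrite map_inj_uniq ?enum_uniq// => i j [].
have XE i w : X (0%N, i) w = tnth (W t w) i.
  by rewrite /X /= /tau mul1r mul0r brownian_start subr0.
rewrite (_ : [set w | _] = \bigcap_(l in [set` J]) (X l @^-1` A l.2)); last first.
  apply/seteqP; split => w /= h.
    by move=> l /= /mapP[i _ ->]; rewrite /= XE.
  by move=> i; rewrite -XE; apply: (h (0%N, i)) => /=; apply: map_f; rewrite mem_enum.
rewrite ind// big_map big_enum /=; apply: eq_bigr => i _.
have -> : 2 * t = 2 * (tau 1%N - tau 0%N) by rewrite /tau mul1r mul0r subr0.
exact: (law (0%N, i) (A i) (mA i)).
Qed.

End brownian_increments.

Section dyadic_paths.
Context {R : realType} (t : R) (f : R -> R).
Hypothesis t0 : 0 < t.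

Definition dyadic n j : R := j%:R * (t / 2 ^+ n).

(** Rounding s down to the dyadic grids gives times that tend to s, and non-strict bounds pass to
    the limit by continuity. *)
Lemma dyadic_path_bounds a b : {within [set s | 0 <= s], continuous f} ->
  (forall n j, (j <= 2 ^ n)%N -> a <= f (dyadic n j) <= b) ->
  forall s, 0 <= s <= t -> a <= f s <= b.
Proof.
move=> /subspace_continuousP cf hab s /andP[s0 st].
have /cvgrPdist_lt cs := cf s s0.
have close e : 0 < e -> a - e <= f s <= b + e.
  move=> e0; have := cs e e0.
  move=> /nbhs_ballP[del /= del0 hdel].
  have [n hn] : exists n, t / 2 ^+ n < del.
    have : \forall n \near \oo, t * 2^-1 ^+ n < del.
      apply: (cvgr_lt 0) => //; rewrite -[X in _ --> X](mulr0 t).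
      apply: cvgMr; apply: cvg_expr; rewrite ger0_norm ?invr_ge0//.
      by rewrite invf_lt1// ltr1n.
    by move=> [n _ /(_ n (leqnn n))]; rewrite /= exprVn; exists n.
  have q0 : 0 < t / 2 ^+ n by rewrite divr_gt0// exprn_gt0.
  pose j := Num.truncn (s / (t / 2 ^+ n)).
  have sq0 : 0 <= s / (t / 2 ^+ n) by rewrite divr_ge0// ltW.
  have /andP[j1 j2] := Num.Theory.truncn_itv sq0; rewrite -/j in j1 j2.
  rewrite ler_pdivlMr// in j1; rewrite ltr_pdivrMr// in j2.
  have jn : (j <= 2 ^ n)%N.
    rewrite -(ler_nat R) -(ler_pM2r q0); apply: (le_trans j1).
    by rewrite natrX mulrC divfK// gt_eqF// exprn_gt0.
  have /andP[h1 h2] := hab n j jn.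
  have d0 : 0 <= dyadic n j by rewrite mulr_ge0// ltW.
  have := hdel (dyadic n j) _ d0; rewrite /ball /= => hd.
  have {hd} : `|f s - f (dyadic n j)| < e.
    apply: hd; rewrite /dyadic ger0_norm ?subr_ge0//.
    by move: j2; rewrite -natr1 mulrDl mul1r; lra.
  by rewrite ltr_norml => /andP[h3 h4]; apply/andP; split; lra.
by apply/andP; split; apply/ler_addgt0Pr => e /close /andP[]; lra.
Qed.

(** An odd j at level n + 1 is one increment away from an even one, which belongs to level n. At
    level 0 the only positive time is t, reached by two increments of level 1, whence the term 2 u
    0. *)
Lemma dyadic_chaining (u : nat -> R) : f 0 = 0 -> (forall n, 0 <= u n) ->
  (forall n j, (j < 2 ^ n.+1)%N ->
    `|f (dyadic n.+1 j.+1) - f (dyadic n.+1 j)| <= u n) ->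
  forall n j, (j <= 2 ^ n)%N -> `|f (dyadic n j)| <= 2 * u 0%N + \sum_(0 <= k < n) u k.
Proof.
move=> f0 u0 hu; elim=> [|n IH] j jn.
  rewrite big_geq// addr0; case: j jn => [|[|//]] _.
    by rewrite /dyadic mul0r f0 normr0 mulr_ge0.
  have -> : dyadic 0 1 = dyadic 1 2.
    by rewrite /dyadic expr0 expr1; field.
  have h1 := hu 0%N 0%N isT; have h2 := hu 0%N 1%N isT.
  have -> : f (dyadic 1 2) = (f (dyadic 1 2) - f (dyadic 1 1)) +
      (f (dyadic 1 1) - f (dyadic 1 0)).
    by rewrite (_ : dyadic 1 0 = 0) ?f0; [ring|rewrite /dyadic mul0r].
  by apply: (le_trans (ler_normD _ _)); lra.
have even k : dyadic n.+1 k.*2 = dyadic n k.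
  by rewrite /dyadic -mul2n natrM exprS; field; rewrite expf_neq0.
have half : (j./2 <= 2 ^ n)%N.
  by rewrite -(doubleK (2 ^ n)%N) half_leq// -mul2n -expnS.
rewrite big_nat_recr//= addrA.
have [jo|je] := boolP (odd j); last first.
  have -> : j = j./2.*2 by rewrite -[LHS]odd_double_half (negbTE je).
  by rewrite even; apply: le_trans (IH j./2 half) _; rewrite lerDl.
have jE : j = j./2.*2.+1 by rewrite -[LHS]odd_double_half jo.
have jn' : (j./2.*2 < 2 ^ n.+1)%N by rewrite -jE.
have -> : f (dyadic n.+1 j) = (f (dyadic n.+1 j) - f (dyadic n.+1 j./2.*2)) + f (dyadic n j./2).
  by rewrite even; ring.
apply: (le_trans (ler_normD _ _)); rewrite addrC; apply: lerD.
  by rewrite {1}jE; exact: hu.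
exact: IH.
Qed.

End dyadic_paths.

Lemma measure_bigcup_seq_le {dO} {O : measurableType dO} {R : realType}
    (P : {measure set O -> \bar R}) (I : eqType) (s : seq I) (A : I -> set O) :
  (forall l, measurable (A l)) ->
  (P (\bigcup_(l in [set` s]) A l) <= \sum_(l <- s) P (A l))%E.
Proof.
move=> mA; elim: s => [|l s IH].
  by rewrite big_nil set_nil bigcup_set0 measure0.
rewrite big_cons; apply: le_trans (leeD2l _ IH).
rewrite (_ : \bigcup_(_ in _) _ = A l `|` \bigcup_(l in [set` s]) A l); last first.
  apply/seteqP; split => w /=.
    by move=> [k /=]; rewrite inE => /predU1P[->|ks]; [left|right; exists k].
  by move=> [h|[k /= ks h]]; [exists l|exists k]; rewrite //= inE ?eqxx ?ks ?orbT.
by apply: measureU2 => //; apply: fin_bigcup_measurable.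
Qed.

Section brownian_exit.
Context {dO} {O : measurableType dO} {R : realType} (P : probability O R).
Context {d : nat} (W : R -> O -> d.-tuple R).
Hypothesis bmW : brownian_motion P W.
Variable t : R.
Hypothesis t0 : 0 < t.

Let mW s i : 0 <= s -> measurable_fun setT (fun w => tnth (W s w) i).
Proof.
move=> s0; have [mW _ _ _] := bmW.
by apply: (measurableT_comp (measurable_tnth i)); exact: mW.
Qed.

Let dyadic_ge0 n j : 0 <= dyadic t n j.
Proof. by rewrite mulr_ge0// divr_ge0 ?(ltW t0)// exprn_ge0. Qed.

Definition jump n (l : nat * 'I_d) (u : R) : set O :=
  [set w | u < `|tnth (W (dyadic t n l.1.+1) w) l.2 - tnth (W (dyadic t n l.1) w) l.2|].

Definition endpoint (a b : 'I_d -> R) : set O :=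
  [set w | forall i, a i <= tnth (W t w) i <= b i].

Lemma measurable_jump n l u : measurable (jump n l u).
Proof.
have m : measurable_fun setT
    (fun w => tnth (W (dyadic t n l.1.+1) w) l.2 - tnth (W (dyadic t n l.1) w) l.2).
  by apply: measurable_funB; exact: mW.
rewrite -[X in measurable X]setTI.
exact: (m measurableT _ (measurable_norm_gt u)).
Qed.

Lemma measurable_endpoint a b : measurable (endpoint a b).
Proof.
rewrite (_ : endpoint a b = \bigcap_(i in [set: 'I_d])
    ((fun w => tnth (W t w) i) @^-1` `[a i, b i])).
  apply: fin_bigcap_measurable => // i _; rewrite -[X in measurable X]setTI.
  exact: (mW i (ltW t0) measurableT (measurable_itv _)).
by apply/seteqP; split => w /= hw i; [move=> _|]; have := hw i; rewrite /= in_itv//=; exact.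
Qed.

(* The path is cut into one dyadic increment and its complement, which contains
   an independent Gaussian increment over a time [t / 2]. *)
Lemma endpoint_jump_le n l a b u : (l.1 < 2 ^ n.+1)%N -> (forall i, a i <= b i) -> 0 <= u ->
  (P (endpoint a b `&` jump n.+1 l u) <=
   (\prod_(i < d) (normal_peak (Num.sqrt t) * (b i - a i)) *
    (Num.sqrt 2 * expR (- (u ^+ 2 * 2 ^+ n.+1 / (8 * t)))))%:E)%E.
Proof.
case: l => j i0 /= jn ab u0.
pose e := t / 2 ^+ n.+1.
have e0 : 0 < e by rewrite divr_gt0// exprn_gt0.
pose M := (2 ^ n)%N.
have ME : M%:R * e = t / 2.
  by rewrite /M /e natrX exprS; field; rewrite expf_neq0.
have v1 : Num.sqrt (2 * e) ^+ 2 = 2 * e by rewrite sqr_sqrtr// mulr_ge0// ltW.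
have expE : u ^+ 2 / (4 * (2 * e)) = u ^+ 2 * 2 ^+ n.+1 / (8 * t).
  by rewrite /e; field; rewrite expf_neq0// gt_eqF.
have [jM|Mj] := ltnP j M.
  (* The jump is in the first half: the grid is fine up to t / 2 and then makes the single step to t
     that smooths the endpoint. It continues beyond t because [brownian_motion] speaks of infinite
     increasing sequences. *)
  pose tau k : R := if (k <= M)%N then k%:R * e else t + (k - M.+1)%:R * e.
  have tauS k : tau k < tau k.+1.
    rewrite /tau; case: ltnP => [kM|Mk].
      by rewrite (ltnW kM) ltr_pM2r// ltr_nat.
    case: leqP => [kM|kM]; last first.
      by rewrite ltrD2l ltr_pM2r// ltr_nat ltn_sub2r.
    have -> : k = M by apply/eqP; rewrite eqn_leq kM Mk.
    by rewrite subnn mul0r addr0 ME ltr_pdivrMr// ltr_pMr// ltr1n.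
  have tau0 : tau 0%N = 0 by rewrite /tau mul0r.
  have tauM : tau M = t / 2 by rewrite /tau leqnn ME.
  have tauM1 : tau M.+1 = t by rewrite /tau ltnn subnn mul0r addr0.
  have tauj : tau j = dyadic t n.+1 j by rewrite /tau (ltnW jM).
  have tauj1 : tau j.+1 = dyadic t n.+1 j.+1 by rewrite /tau jM.
  have jM' : j != M by rewrite ltn_eqF.
  have := @brownian_increment_density _ _ _ P _ W bmW tau M.+1 M j i0 a b u
    tau0 tauS (leqnn _) (leqW jM) jM' ab u0.
  rewrite tauM1 tauM tauj tauj1 (_ : 2 * (t - t / 2) = t); last by field.
  rewrite (_ : dyadic t n.+1 j.+1 - dyadic t n.+1 j = e); last first.
    by rewrite /dyadic -/e -mulrBl -natrB// subSnn mul1r.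
  by rewrite v1 expE; exact.
(* The jump is in the second half: the smoothing step comes first, from 0 to t / 2. *)
pose tau k : R := if k is k'.+1 then t / 2 + k'%:R * e else 0.
have tauS k : tau k < tau k.+1.
  case: k => [|k] /=; first by rewrite mul0r addr0 divr_gt0.
  by rewrite ltrD2l ltr_pM2r// ltr_nat.
have jE : tau (j - M).+1 = dyadic t n.+1 j.
  by rewrite /tau natrB// mulrBl ME /dyadic -/e; ring.
have jE' : tau (j - M).+2 = dyadic t n.+1 j.+1.
  by rewrite /tau -subSn// natrB ?leqW// mulrBl ME /dyadic -/e; ring.
have h : ((j - M).+1 < M.+1)%N by rewrite ltnS ltn_subLR// addnn -mul2n -expnS.
have tau1 : tau 1%N = t / 2 by rewrite /= mul0r addr0.
have tauM1 : tau M.+1 = t by rewrite /tau ME; field.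
have := @brownian_increment_density _ _ _ P _ W bmW tau M.+1 0%N (j - M).+1 i0 a b u
  erefl tauS isT h isT ab u0.
rewrite jE jE' tauM1 tau1 subr0 (_ : 2 * (t / 2) = t); last by field.
rewrite (_ : dyadic t n.+1 j.+1 - dyadic t n.+1 j = e); last first.
  by rewrite /dyadic -/e -mulrBl -natrB// subSnn mul1r.
by rewrite v1 expE; exact.
Qed.

Definition stay N (x : d.-tuple R) : set O :=
  [set w | forall s, 0 <= s <= t -> box N (translate x (W s w))].

Let path_continuous w i : {within [set s | 0 <= s], continuous (fun s => tnth (W s w) i)}.
Proof. by have [_ _ + _] := bmW; exact. Qed.

Lemma box_translateP N (x y : d.-tuple R) : box N (translate x y) <->
  forall i, - N%:R - tnth x i <= tnth y i <= N%:R - tnth x i.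
Proof.
by split => h i; have := h i; rewrite tnth_mktuple => /andP[]; lra.
Qed.

(** Continuous paths and a closed box reduce uncountably many conditions to countably many, which
    makes [stay] measurable. *)
Lemma stay_dyadic N x :
  stay N x = \bigcap_n \bigcap_(j in `I_(2 ^ n).+1)
    [set w | box N (translate x (W (dyadic t n j) w))].
Proof.
apply/seteqP; split => w.
  move=> hw n _ j /=; rewrite ltnS => jn; apply: hw.
  rewrite dyadic_ge0 /dyadic mulrA ler_pdivrMr ?exprn_gt0// mulrC ler_pM2l//.
  by rewrite -natrX ler_nat.
move=> hw s st; apply/box_translateP => i.
apply: (@dyadic_path_bounds R t (fun s => tnth (W s w) i) t0 _ _
  (@path_continuous w i) _ s st) => n j jn.
have hb : box N (translate x (W (dyadic t n j) w)) by apply: (hw n I j); rewrite /= ltnS.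
exact: (proj1 (box_translateP _ _ _) hb i).
Qed.

Lemma measurable_stay N x : measurable (stay N x).
Proof.
rewrite stay_dyadic; apply: bigcapT_measurable => n.
apply: fin_bigcap_measurable => [|j _]; first exact: finite_II.
rewrite (_ : [set w | _] = \bigcap_(i in [set: 'I_d])
    (setT `&` (fun w => tnth (W (dyadic t n j) w) i) @^-1`
       `[- N%:R - tnth x i, N%:R - tnth x i])).
  apply: fin_bigcap_measurable => // i _.
  exact: (mW i (dyadic_ge0 n j) measurableT (measurable_itv _)).
apply/seteqP; split => w /=.
  by move=> /box_translateP h i _; split => //; have := h i; rewrite /= in_itv.
by move=> h; apply/box_translateP => i; have [_] := h i I; rewrite /= in_itv.
Qed.

(* The thresholds are summable, so that a path without big jump stays within [5 r]
   of its origin; they still decrease slowly enough (2 (3 / 4)^2 > 1) for the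
   Gaussian tails to beat the number [2 ^ n.+1] of dyadic increments. *)
Definition big_jump (r : R) : set O :=
  \bigcup_n \bigcup_(l in [set` allpairs pair (iota 0 (2 ^ n.+1)) (enum 'I_d)])
    jump n.+1 l (r * (3 / 4) ^+ n.+1).

Lemma measurable_big_jump r : measurable (big_jump r).
Proof.
apply: bigcupT_measurable => n; apply: fin_bigcup_measurable => // l _.
exact: measurable_jump.
Qed.

Lemma geometric_sum_le (r : R) n : 0 <= r ->
  \sum_(0 <= k < n) r * (3 / 4) ^+ k.+1 <= 3 * r.
Proof.
move=> r0; suff -> : \sum_(0 <= k < n) r * (3 / 4) ^+ k.+1 = 3 * r * (1 - (3 / 4) ^+ n).
  by rewrite ler_piMr ?mulr_ge0// gerBl exprn_ge0.
elim: n => [|n IH]; first by rewrite big_geq// expr0 subrr mulr0.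
by rewrite big_nat_recr//= IH exprS; field.
Qed.

Lemma no_big_jump_stay N x r : 0 <= r ->
  (forall i, `|tnth x i| <= N%:R - 5 * r) -> ~` big_jump r `<=` stay N x.
Proof.
move=> r0 xN w nw; rewrite stay_dyadic => n _ j /=.
rewrite ltnS => jn; apply/box_translateP => i.
pose f s := tnth (W s w) i.
have hf m k : (k < 2 ^ m.+1)%N ->
    `|f (dyadic t m.+1 k.+1) - f (dyadic t m.+1 k)| <= r * (3 / 4) ^+ m.+1.
  move=> km; rewrite leNgt; apply/negP => hlt; apply: nw.
  exists m => //; exists (k, i) => //=.
  by apply/allpairsP; exists (k, i); rewrite mem_iota/= mem_enum.
have u0 m : 0 <= r * (3 / 4) ^+ m.+1 by rewrite mulr_ge0// exprn_ge0.
have := dyadic_chaining (brownian_start bmW w i) u0 hf jn.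
have := geometric_sum_le n r0; set S := \sum_(_ <= _ < _) _.
(* Chaining gives at most 2 (3/4) r + 3 r = 9 r / 2, below the margin 5 r. *)
have := xN i; rewrite expr1 -/(f (dyadic t n j)) !ler_norml.
by move=> /andP[h1 h2] h3 /andP[h4 h5]; apply/andP; split; lra.
Qed.

Lemma pow_9_8_ge n : 1 + n%:R / 8 <= (9 / 8) ^+ n :> R.
Proof.
elim: n => [|n IH]; first by rewrite mul0r addr0 expr0.
rewrite exprS -natr1; have : 0 <= n%:R :> R by [].
by have := ler_wpM2l (_ : 0 <= 9 / 8 :> R) IH; lra.
Qed.

(** At level m = n + 1 the exponent is kap (9/8)^m >= kap + kap m / 8, as 9/8 = 2 (3/4)^2. The
    assumption kap >= 8 ln 4 turns the excess into a factor 4^-m: one 2^-m compensates the number of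
    increments, the other makes the levels summable. *)
Lemma endpoint_big_jump_le a b r : (forall i, a i <= b i) -> 0 <= r ->
  8 * ln 4 <= r ^+ 2 / (8 * t) ->
  (P (endpoint a b `&` big_jump r) <=
   (\prod_(i < d) (normal_peak (Num.sqrt t) * (b i - a i)) *
    (d%:R * Num.sqrt 2 * expR (- (r ^+ 2 / (8 * t)))))%:E)%E.
Proof.
move=> ab r0; set kap := r ^+ 2 / (8 * t) => hkap.
set B := \prod_(i < d) _.
have B0 : 0 <= B.
  by apply: prodr_ge0 => i _; rewrite mulr_ge0 ?normal_peak_ge0// subr_ge0.
pose u n : R := r * (3 / 4) ^+ n.+1.
pose s n := allpairs pair (iota 0 (2 ^ n.+1)) (enum 'I_d).
pose F n := \bigcup_(l in [set` s n]) (endpoint a b `&` jump n.+1 l (u n)).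
have mF n : measurable (F n).
  apply: fin_bigcup_measurable => // l _; apply: measurableI.
    exact: measurable_endpoint.
  exact: measurable_jump.
have FE : endpoint a b `&` big_jump r = \bigcup_n F n.
  rewrite /big_jump setI_bigcupr; apply: eq_bigcupr => n _.
  by rewrite setI_bigcupr.
rewrite FE; apply: (@le_trans _ _ (\sum_(0 <= n <oo) P (F n))%E).
  by apply: measure_sigma_subadditive => //; exact: bigcupT_measurable.
apply: le_trans (epsilon_trick0 xpredT _); last first.
  by rewrite !mulr_ge0 ?expR_ge0 ?sqrtr_ge0.
apply: lee_nneseries => // n _.
apply: (le_trans (measure_bigcup_seq_le P _ _)).
  by move=> l; apply: measurableI; [exact: measurable_endpoint|exact: measurable_jump].
apply: (@le_trans _ _ (\sum_(l <- s n)
   (B * (Num.sqrt 2 * expR (- (u n ^+ 2 * 2 ^+ n.+1 / (8 * t)))))%:E)%E).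
  rewrite big_seq [leRHS]big_seq; apply: lee_sum => l /allpairsP[[j i] /= [jn _ ->]].
  apply: endpoint_jump_le => //; first by move: jn; rewrite mem_iota.
  by rewrite mulr_ge0// exprn_ge0.
rewrite sumEFin lee_fin big_const_seq count_predT iter_addr_0 /s size_allpairs.
rewrite size_iota size_enum_ord -[leLHS]mulr_natr.
have uE : u n ^+ 2 * 2 ^+ n.+1 / (8 * t) = kap * (9 / 8) ^+ n.+1.
  have -> : (9 / 8 : R) = (3 / 4) ^+ 2 * 2 by field.
  rewrite /u /kap exprMn [in RHS]exprMn [in RHS]exprAC.
  by move: (_ ^+ n.+1) (2 ^+ n.+1) => y z; field; rewrite gt_eqF.
have key : expR (- (kap * (9 / 8) ^+ n.+1)) * (2 ^ n.+1)%:R <= expR (- kap) / (2 ^ n.+1)%:R.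
  have k0 : 0 <= kap by rewrite divr_ge0 ?sqr_ge0// mulr_ge0// ltW.
  have p2 : 0 < (2 ^ n.+1)%:R :> R by rewrite ltr0n expn_gt0.
  rewrite ler_pdivlMr// -mulrA -natrM -expnD addnn -muln2 mulnC expnM.
  rewrite natrX -[X in _ * X ^+ _](@lnK _ 4) ?posrE// -expRM_natr -expRD ler_expR.
  have := ler_wpM2l k0 (pow_9_8_ge n.+1).
  have := ler_wpM2r (ler0n R n.+1) hkap.
  by move: (ln 4) (_ ^+ n.+1) (n.+1%:R) => x y z; lra.
rewrite uE natrM.
have -> : B * (Num.sqrt 2 * expR (- (kap * (9 / 8) ^+ n.+1))) * ((2 ^ n.+1)%:R * d%:R) =
   B * (d%:R * Num.sqrt 2) * (expR (- (kap * (9 / 8) ^+ n.+1)) * (2 ^ n.+1)%:R) by ring.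
have -> : B * (d%:R * Num.sqrt 2 * expR (- kap)) / (2 ^ n.+1)%:R =
   B * (d%:R * Num.sqrt 2) * (expR (- kap) / (2 ^ n.+1)%:R) by ring.
by apply: ler_wpM2l key; rewrite !mulr_ge0 ?sqrtr_ge0.
Qed.

Lemma endpoint_stay_ge N x a b r : (forall i, a i <= b i) -> 0 <= r ->
  8 * ln 4 <= r ^+ 2 / (8 * t) -> (forall i, `|tnth x i| <= N%:R - 5 * r) ->
  (P (endpoint a b) <= P (endpoint a b `&` stay N x) +
   (\prod_(i < d) (normal_peak (Num.sqrt t) * (b i - a i)) *
    (d%:R * Num.sqrt 2 * expR (- (r ^+ 2 / (8 * t)))))%:E)%E.
Proof.
move=> ab r0 hr xN.
have m1 : measurable (endpoint a b) by exact: measurable_endpoint.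
have m2 : measurable (stay N x) by exact: measurable_stay.
have m3 : measurable (big_jump r) by exact: measurable_big_jump.
apply: (@le_trans _ _ (P (endpoint a b `&` stay N x) +
    P (endpoint a b `&` big_jump r))%E).
  apply: le_trans (measureU2 P _ _); try exact: measurableI.
  apply: le_measure; rewrite ?inE//; first by apply: measurableU; exact: measurableI.
  move=> w hw; have [hb|hb] := pselect (big_jump r w); [right|left]; split => //.
  exact: (no_big_jump_stay r0 xN hb).
by rewrite leeD2l// endpoint_big_jump_le.
Qed.

End brownian_exit.

(** * Dirichlet weights *)

Section killed_density_bounds.
Context {R : realType} {d : nat}.
Implicit Types (x y : d.-tuple R).

Lemma normal_peak_pow (t : R) : 0 < t ->
  normal_peak (Num.sqrt (2 * t)) ^+ d = (4 * pi * t) `^ (- (d%:R / 2)).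
Proof.
move=> t0; have p0 : 0 <= 4 * pi * t by rewrite !mulr_ge0 ?(ltW t0)// pi_ge0.
rewrite /normal_peak sqr_sqrtr ?mulr_ge0 ?(ltW t0)//.
rewrite (_ : 2 * t * pi *+ 2 = 4 * pi * t); last by rewrite -mulr_natl; ring.
by rewrite powRN (mulrC d%:R) powRrM powR12_sqrt// powR_mulrn ?sqrtr_ge0// exprVn.
Qed.

(* The cube is laid towards the origin, so that it does not leave the box when
   [y] is on the boundary. *)
Definition corner (y : d.-tuple R) (rho : R) (i : 'I_d) : R :=
  if tnth y i <= 0 then tnth y i else tnth y i - rho.

Definition cube (y : d.-tuple R) (rho : R) : set (d.-tuple R) :=
  [set z | forall i, corner y rho i <= tnth z i <= corner y rho i + rho].

Lemma cube_sub_box N y rho : box N y -> 0 <= rho <= N%:R -> cube y rho `<=` box N.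
Proof.
move=> yN /andP[r0 rN] z hz i; have := hz i; have := yN i; rewrite /corner.
by case: ifPn => [|/negP/negP]; rewrite -?ltNge => h /andP[h1 h2] /andP[h3 h4];
  apply/andP; split; lra.
Qed.

Lemma cube_near y rho z i : 0 <= rho -> cube y rho z -> `|tnth z i - tnth y i| <= rho.
Proof.
move=> r0 /(_ i); rewrite /corner ler_norml; case: ifP => _ /andP[h1 h2];
by apply/andP; split; lra.
Qed.

Lemma measurable_cube y rho : measurable (cube y rho).
Proof.
exact: (@measurable_tuple_itv R d (corner y rho) (fun i => corner y rho i + rho)).
Qed.

Lemma lebesgue_cube y rho : 0 <= rho ->
  @lebesgue_tuple R d (cube y rho) = (rho ^+ d)%:E.
Proof.
move=> r0; rewrite (@lebesgue_tuple_itv R d (corner y rho) (fun i => corner y rho i + rho)); last first.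
  by move=> i; rewrite lerDl.
under eq_bigr do rewrite addrAC subrr add0r.
by rewrite prodr_const card_ord.
Qed.

Lemma row_of_tupleK y : tuple_of_row (\row_i tnth y i) = y.
Proof.
by apply: eq_from_tnth => i; rewrite tnth_mktuple mxE.
Qed.

Variables (N : nat) (g : R -> d.-tuple R -> d.-tuple R -> R).
Hypotheses (N0 : (0 < N)%N) (hg : killed_density N g).
Variable t : R.
Hypothesis t0 : 0 < t.

Lemma killed_density_continuous x y (e : R) : box N x -> box N y -> 0 < e ->
  exists2 rho : R, 0 < rho &
    forall z, box N z -> (forall i, `|tnth z i - tnth y i| <= rho) ->
      `|g t x z - g t x y| < e.
Proof.
move=> xN yN e0; have [dO [Om [P [W [_ h]]]]] := hg.
have [/subspace_continuousP cg _] := h t t0.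
have := cg (\row_i tnth x i, \row_i tnth y i); rewrite /= !row_of_tupleK.
move=> /(_ (conj xN yN)) /cvgrPdist_lt /(_ e e0) /nbhs_ballP[del /= del0 hdel].
exists (del / 2); first by rewrite divr_gt0.
move=> z zN zy; rewrite distrC.
have := hdel (\row_i tnth x i, \row_i tnth z i).
rewrite /from_subspace /= !row_of_tupleK => h2; apply: h2 => //; split => /=.
  exact: ballxx.
split=> // i j; rewrite /ball /= !mxE distrC; apply: le_lt_trans (zy j) _.
by rewrite ltr_pdivrMr// ltr_pMr// ltr1n.
Qed.

Lemma killed_density_cube x y rho : box N x -> box N y -> 0 <= rho <= N%:R ->
  exists dO (O : measurableType dO) (P : probability O R) (W : R -> O -> d.-tuple R),
    brownian_motion P W /\
    P (endpoint W t (fun i => corner y rho i - tnth x i)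
        (fun i => corner y rho i + rho - tnth x i) `&` stay W t N x) =
    (\int[@lebesgue_tuple R d]_(z in cube y rho) (g t x z)%:E)%E.
Proof.
move=> xN yN rN; have [dO [Om [P [W [bm h]]]]] := hg.
exists dO, Om, P, W; split => //.
have [_ /(_ x (cube y rho) xN (measurable_cube _ _))] := h t t0.
rewrite setIidl; last exact: cube_sub_box.
move=> <-; congr (P _); apply/seteqP; split => w [h1 h2]; split => // i;
  have := h1 i; rewrite /endpoint /cube /= ?tnth_mktuple => /andP[h3 h4];
  by apply/andP; split; lra.
Qed.

(** If the value at y were negative, continuity would make the integral over a small cube at y
    negative, whereas it is a probability. *)
Lemma killed_density_ge0 x y : box N x -> box N y -> 0 <= g t x y.
Proof.
move=> xN yN; rewrite leNgt; apply/negP => g0.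
have e0 : 0 < - g t x y / 2 by rewrite divr_gt0// oppr_gt0.
have [r r0 hr] := killed_density_continuous xN yN e0.
pose rho := Num.min r 1.
have rho0 : 0 < rho by rewrite lt_min r0/=.
have rhoN : 0 <= rho <= N%:R.
  by rewrite (ltW rho0)/= (@le_trans _ _ 1)// ?ge_min ?lexx ?orbT// ler1n.
have [dO [Om [P [W [_ PE]]]]] := killed_density_cube xN yN rhoN.
have gz z : cube y rho z -> - g t x y / 2 <= - g t x z.
  move=> hz; have zN := cube_sub_box yN rhoN hz.
  have /(_ _) := hr z zN; rewrite ltr_norml => /(_ _)/andP[i|_].
    by apply: le_trans (cube_near i (ltW rho0) hz) _; rewrite ge_min lexx.
  by lra.
have : (0 <= \int[@lebesgue_tuple R d]_(z in cube y rho) (g t x z)%:E)%E.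
  by rewrite -PE.
rewrite (eq_integral (fun z => - (- g t x z)%:E)%E); last first.
  by move=> z _; rewrite EFinN oppeK.
have gz0 z : cube y rho z -> 0 <= - g t x z.
  by move=> /gz; apply: le_trans; exact: ltW.
rewrite integral_ge0N; last by move=> z /gz0; rewrite lee_fin.
rewrite oppe_ge0 leNgt => /negP; apply.
have : ((- g t x y / 2)%:E * (rho ^+ d)%:E <=
    \int[@lebesgue_tuple R d]_(z in cube y rho) (- g t x z)%:E)%E.
  rewrite -(lebesgue_cube y (ltW rho0)).
  exact: (ge0_integral_ge_cst (@lebesgue_tuple R d) (measurable_cube _ _)
    (@subset_refl _ _) (ltW e0) gz0 gz).
by apply: lt_le_trans; rewrite -EFinM lte_fin mulr_gt0// exprn_gt0.
Qed.

Lemma killed_density_cube_bounds x (e : R) : box N x -> 0 < e ->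
  exists2 r, 0 < r & forall rho, 0 < rho -> rho <= r -> rho <= 1 ->
   (((g t x x - e) * rho ^+ d)%:E <=
     \int[@lebesgue_tuple R d]_(z in cube x rho) (g t x z)%:E)%E /\
   (\int[@lebesgue_tuple R d]_(z in cube x rho) (g t x z)%:E <=
    ((g t x x + e) * rho ^+ d)%:E)%E.
Proof.
move=> xN e0; have [r r0 hr] := killed_density_continuous xN xN e0.
exists r => // rho rho0 rhor rho1.
have rhoN : 0 <= rho <= N%:R.
  by rewrite (ltW rho0)/= (le_trans rho1)// ler1n.
have gz z : cube x rho z -> g t x x - e <= g t x z <= g t x x + e.
  move=> hz; have zN := cube_sub_box xN rhoN hz.
  have : `|g t x z - g t x x| < e.
    by apply: hr => // i; apply: le_trans (cube_near i (ltW rho0) hz) _.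
  by rewrite ltr_norml => /andP[h1 h2]; apply/andP; split; lra.
have g0 z : cube x rho z -> 0 <= g t x z.
  by move=> hz; apply: killed_density_ge0 => //; exact: cube_sub_box hz.
split.
  have [ge|ge] := leP 0 (g t x x - e); last first.
    apply: (@le_trans _ _ 0%E); last by apply: integral_ge0 => z /g0; rewrite lee_fin.
    by rewrite lee_fin pmulr_lle0 ?exprn_gt0// ltW.
  rewrite EFinM -(lebesgue_cube x (ltW rho0)).
  apply: (ge0_integral_ge_cst (@lebesgue_tuple R d) (measurable_cube _ _)
    (@subset_refl _ _) ge g0) => z /gz/andP[]//.
rewrite EFinM -(lebesgue_cube x (ltW rho0)).
apply: (ge0_integral_le_cst (@lebesgue_tuple R d) (measurable_cube _ _)) => z hz.
by rewrite g0//=; have /andP[] := gz z hz.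
Qed.

Local Notation peak := ((4 * pi * t) `^ (- (d%:R / 2)) : R).

Let sq_neq0 : Num.sqrt (2 * t) != 0.
Proof. by rewrite gt_eqF// sqrtr_gt0 mulr_gt0. Qed.

Let corner_itv x rho i : 0 <= rho ->
  corner x rho i - tnth x i <= corner x rho i + rho - tnth x i.
Proof. by move=> r0; rewrite lerD2r lerDl. Qed.

(** Forgetting the condition to stay in the box leaves a Gaussian probability of a cube, at most the
    peak times rho^d. *)
Lemma killed_density_le_peak x : box N x -> g t x x <= peak.
Proof.
move=> xN; apply/ler_addgt0Pr => e e0.
have [r r0 hr] := killed_density_cube_bounds xN e0.
pose rho := Num.min r 1.
have rho0 : 0 < rho by rewrite lt_min r0/=.
have [||h _] := hr rho rho0; rewrite ?ge_min ?lexx ?orbT//.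
have rhoN : 0 <= rho <= N%:R.
  by rewrite (ltW rho0)/= (@le_trans _ _ 1)// ?ge_min ?lexx ?orbT// ler1n.
have [dO [Om [P [W [bm PE]]]]] := killed_density_cube xN xN rhoN.
rewrite -PE in h; rewrite -lerBlDr -(ler_pM2r (exprn_gt0 d rho0)) -lee_fin.
apply: (le_trans h); set a := (fun i => _); set b := (fun i => _).
have mE : measurable (endpoint W t a b) 
  by apply: (measurable_endpoint bm t0).
have mS : measurable (stay W t N x) by apply: (measurable_stay bm t0).
apply: (@le_trans _ _ (P (endpoint W t a b))).
  by apply: le_measure; rewrite ?inE//; exact: measurableI.
have := brownian_marginal bm (A := fun i => `[a i, b i]%classic) t0
  (fun i => measurable_itv _).
rewrite (_ : [set w | _] = endpoint W t a b); last first.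
  by apply/seteqP; split => w /= hw i; have := hw i; rewrite /= in_itv.
move=> ->; rewrite -normal_peak_pow// -exprMn -[X in _ ^+ X]card_ord -prodr_const -prodEFin.
apply: lee_prod => i _; first exact: measure_ge0.
have := normal_prob_itv_le sq_neq0 (corner_itv x i (ltW rho0)).
rewrite (_ : corner x rho i + rho - tnth x i - (corner x rho i - tnth x i) = rho); last by ring.
by rewrite (mulrC rho).
Qed.

(** The Gaussian probability of the cube is nearly the peak times rho^d, and the paths that leave
    the box are subtracted. Their bound carries the peak for variance t, from the smoothing step of
    length t / 2, and the same rho^d, which cancels. *)
Lemma killed_density_ge_peak x r : 0 <= r ->
  8 * ln 4 <= r ^+ 2 / (8 * t) -> (forall i, `|tnth x i| <= N%:R - 5 * r) ->
  peak - normal_peak (Num.sqrt t) ^+ d *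
    (d%:R * Num.sqrt 2 * expR (- (r ^+ 2 / (8 * t)))) <= g t x x.
Proof.
move=> r0 hr xr; set K := _ * (d%:R * _ * _).
have xN : box N x.
  by move=> i; have := xr i; rewrite ler_norml => /andP[h1 h2]; apply/andP; split; lra.
apply/ler_addgt0Pr => e e0.
have e2 : 0 < e / 2 by rewrite divr_gt0.
have [s s0 hs] := killed_density_cube_bounds xN e2.
(* On the cube the Gaussian density falls below its peak by at most the factor 1 - d rho^2 / (4 t);
   for rho <= 1 and rho q <= e / 2 this costs at most e / 2. *)
pose q := peak * d%:R / (4 * t) + 1.
have p0 : 0 <= peak by exact: powR_ge0.
have q0 : 0 < q by rewrite ltr_wpDl// divr_ge0 ?mulr_ge0 ?(ltW t0).
pose rho := Num.min s (Num.min 1 (e / 2 / q)).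
have rho0 : 0 < rho by rewrite !lt_min s0 ltr01 divr_gt0.
have rho1 : rho <= 1 by rewrite !ge_min lexx orbT.
have rhos : rho <= s by rewrite ge_min lexx.
have rhoq : rho * q <= e / 2.
  by rewrite -ler_pdivlMr// !ge_min lexx !orbT.
have [_ h] := hs rho rho0 rhos rho1.
have rhoN : 0 <= rho <= N%:R by rewrite (ltW rho0)/= (le_trans rho1)// ler1n.
have [dO [Om [P [W [bm PE]]]]] := killed_density_cube xN xN rhoN.
rewrite -PE in h.
have ab i := corner_itv x i (ltW rho0).
have := endpoint_stay_ge bm t0 ab r0 hr xr.
move=> /le_trans /(_ (leeD2r _ h)); set a := (fun i => _); set b := (fun i => _).
have baE i : b i - a i = rho by rewrite /a /b; ring.
under eq_bigr do rewrite baE.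
rewrite prodr_const card_ord exprMn -EFinD.
have := brownian_marginal bm (A := fun i => `[a i, b i]%classic) t0
  (fun i => measurable_itv _).
rewrite (_ : [set w | _] = endpoint W t a b); last first.
  by apply/seteqP; split => w /= hw i; have := hw i; rewrite /= in_itv.
move=> ->; pose c := normal_peak (Num.sqrt (2 * t)) * expR (- (rho ^+ 2 / (Num.sqrt (2 * t) ^+ 2 *+ 2))).
have low : (((rho * c) ^+ d)%:E <= \prod_(i < d) normal_prob 0 (Num.sqrt (2 * t)) `[a i, b i])%E.
  rewrite -[X in _ ^+ X]card_ord -prodr_const -prodEFin; apply: lee_prod => i _.
    by rewrite lee_fin !mulr_ge0 ?(ltW rho0) ?normal_peak_ge0 ?expR_ge0.
  have := @normal_prob_itv_ge R (Num.sqrt (2 * t)) (a i) (b i) rho sq_neq0 (ab i).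
  rewrite baE; apply => z; rewrite /a /b /corner ler_norml; case: ifP => _ /andP[h1 h2];
  by apply/andP; split; lra.
move=> /(le_trans low); rewrite lee_fin exprMn.
have rd := exprn_gt0 d rho0.
have -> : (g t x x + e / 2) * rho ^+ d + normal_peak (Num.sqrt t) ^+ d * rho ^+ d *
   (d%:R * Num.sqrt 2 * expR (- (r ^+ 2 / (8 * t)))) =
   rho ^+ d * (g t x x + e / 2 + K) by rewrite /K; ring.
rewrite ler_pM2l// /c exprMn normal_peak_pow// sqr_sqrtr ?mulr_ge0 ?(ltW t0)//.
rewrite -expRM_natl => hfin.
have : peak * (1 - d%:R * (rho ^+ 2 / (4 * t))) <= g t x x + e / 2 + K.
  apply: le_trans hfin; rewrite ler_wpM2l//.
  apply: le_trans (expR_ge1Dx _); rewrite mulrN.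
  by rewrite (_ : 2 * t *+ 2 = 4 * t)// -mulr_natl; ring.
have : peak * (d%:R * (rho ^+ 2 / (4 * t))) <= e / 2.
  apply: le_trans rhoq; rewrite (_ : peak * _ = rho * (rho * (q - 1))); last first.
    by rewrite /q; field; rewrite gt_eqF.
  rewrite ler_pM2l//.
  have q1 : 0 <= q - 1 by rewrite /q addrK divr_ge0 ?mulr_ge0 ?(ltW t0).
  by have := ler_wpM2r q1 rho1; lra.
by rewrite mulrBr mulr1; lra.
Qed.

End killed_density_bounds.

Section killed_weights.
Context {R : realType}.
Variables (d : nat) (beta mu : R).
Hypothesis b0 : 0 < beta.
Variable g : nat -> R -> d.-tuple R -> d.-tuple R -> R.
Hypothesis hg : forall N, (0 < N)%N -> killed_density N (g N).

Local Notation peak t := ((4 * pi * t) `^ (- (d%:R / 2)) : R).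

(** The margin depends on t and e but not on N, so the excluded share of the box vanishes in the
    limit. It is 5 n because the exit estimate is used with r = n. *)
Lemma killed_density_near_peak (t e : R) : 0 < t -> 0 < e -> exists n : nat,
  forall N x, (0 < N)%N -> (forall i, `|tnth x i| <= N%:R - n%:R) ->
    (1 - e) * peak t <= g N t x x.
Proof.
move=> t0 e0; pose K : R := normal_peak (Num.sqrt t) ^+ d * (d%:R * Num.sqrt 2).
have t8 : 0 < 8 * t by rewrite mulr_gt0.
have p0 : 0 < peak t by rewrite powR_gt0// !mulr_gt0// pi_gt0.
have cK : (fun n : nat => K * expR (- (n%:R / (8 * t)))) @ \oo --> (0 : R).
  by rewrite -[X in _ --> X](mulr0 K); apply: cvgMr; exact: expR_Nnat_div_cvg.
have hK : \forall n \near \oo, K * expR (- (n%:R / (8 * t))) <= e * peak t.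
  by apply: (cvgr_le 0 cK); rewrite mulr_gt0.
have hl : \forall n \near \oo, 8 * ln 4 * (8 * t) <= (n%:R : R) by exact: nbhs_infty_ger.
have [n [n0 nK nl]] : exists n : nat, [/\ (0 < n)%N,
    K * expR (- (n%:R / (8 * t))) <= e * peak t & 8 * ln 4 * (8 * t) <= n%:R].
  near \oo => n; exists n; split; near: n => //; exact: nbhs_infty_gt.
have n2 : n%:R / (8 * t) <= n%:R ^+ 2 / (8 * t).
  by rewrite ler_pM2r ?invr_gt0// -natrX ler_nat leq_pmulr.
exists (5 * n)%N => N x N0 xN.
have := killed_density_ge_peak N0 (hg N0) t0 (ler0n _ n) (x := x).
have nl2 : 8 * ln 4 <= n%:R ^+ 2 / (8 * t).
  by apply: le_trans n2; rewrite ler_pdivlMr.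
move=> /(_ nl2) h; apply: le_trans (h _); last by move=> i; rewrite -natrM.
rewrite mulrBl mul1r lerD2l lerN2; apply: le_trans nK.
rewrite [leLHS]mulrA -/K ler_wpM2l ?ler_expR ?lerN2//.
by rewrite !mulr_ge0 ?exprn_ge0 ?normal_peak_ge0.
Unshelve. all: by end_near. Qed.

Lemma killed_weights (qN := fun N k => loop_weight beta mu N (g N) k.+1) :
  (\forall N \near \oo, forall k, 0 <= qN N k <= 1 * free_weight d beta mu k.+1) /\
  forall k, qN ^~ k @ \oo --> free_weight d beta mu k.+1.
Proof.
have kb k : 0 < k.+1%:R * beta by rewrite mulr_gt0.
have bnd N k (x : d.-tuple R) : (0 < N)%N -> box N x ->
    0 <= g N (k.+1%:R * beta) x x <= 1 * peak (k.+1%:R * beta).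
  move=> N0 xN; rewrite mul1r; apply/andP; split.
    exact: (killed_density_ge0 N0 (hg N0) (kb k)).
  exact: (killed_density_le_peak N0 (hg N0) (kb k)).
have up N k : (0 < N)%N -> 0 <= qN N k <= 1 * free_weight d beta mu k.+1.
  by move=> N0; apply: loop_weight_le => // x; exact: bnd.
split; first by near=> N => k; apply: up; near: N; exact: nbhs_infty_gt.
move=> k; have f0 : 0 < free_weight d beta mu k.+1 by exact: free_weight_gt0.
apply/cvgrPdist_le => e e0.
(* On the box of half-side N - n the kernel is at least 1 - del times its peak, and the share of
   volume of this box eventually exceeds 1 - del as well. The weight then falls short of the free
   one by at most 2 del times the free weight, hence by at most e. *)
pose del := Num.min 1 (e / (2 * free_weight d beta mu k.+1)).
have del0 : 0 < del by rewrite lt_min ltr01 divr_gt0// mulr_gt0.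
have del1 : del <= 1 by rewrite ge_min lexx.
have dele : del * (2 * free_weight d beta mu k.+1) <= e.
  have f2 : 0 < 2 * free_weight d beta mu k.+1 by rewrite mulr_gt0.
  by rewrite -(ler_pdivlMr _ _ f2) ge_min lexx orbT.
have [n hn] := killed_density_near_peak (kb k) del0.
have cr : (fun N : nat => (1 - n%:R / N%:R) ^+ d) @ \oo --> (1 : R).
  rewrite -[X in _ --> X](expr1n _ d).
  have h : (fun N : nat => 1 - n%:R / N%:R) @ \oo --> (1 : R).
    rewrite -[X in _ --> X]subr0 -[X in _ --> _ - X](mulr0 n%:R).
    apply: cvgB; first exact: cvg_cst.
    apply: cvgMr; apply/gtr0_cvgV0; last exact: cvgr_idn.
    by near=> N; rewrite ltr0n; near: N; exact: nbhs_infty_gt.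
  apply: (@cvg_comp _ _ _ (fun N : nat => 1 - n%:R / N%:R) (fun x : R => x ^+ d)); first exact: h.
  exact: exprn_continuous.
have cr1 : \forall N \near \oo, 1 - del <= (1 - n%:R / N%:R) ^+ d.
  by apply: (cvgr_ge 1 cr); rewrite ltrBlDr ltrDl.
near=> N.
have N0 : (0 < N)%N by near: N; exact: nbhs_infty_gt.
have kN : (k.+1 <= N)%N by near: N; exact: nbhs_infty_ge.
have nN : (n <= N)%N by near: N; exact: nbhs_infty_ge.
have r1 : 1 - del <= (1 - n%:R / N%:R) ^+ d by near: N.
have /andP[q0] := up N k N0; rewrite mul1r => q1.
pose c : R := N%:R - n%:R.
have c0 : 0 <= c by rewrite subr_ge0 ler_nat.
pose E : set (d.-tuple R) := [set x | forall i, - c <= tnth x i <= c].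
have Ee : @lebesgue_tuple R d E = ((2 * c) ^+ d)%:E.
  rewrite (@lebesgue_tuple_itv R d (fun=> - c) (fun=> c)); last by move=> i; lra.
  by rewrite prodr_const card_ord opprK mulr_natl mulr2n.
have mE : measurable E by exact: (@measurable_tuple_itv R d (fun=> - c) (fun=> c)).
have EN : E `<=` box N.
  move=> x hx i; have := hx i; rewrite /c => /andP[h1 h2].
  by have n0 := ler0n R n; apply/andP; split; lra.
have dl : 0 <= 1 - del by rewrite subr_ge0.
have := loop_weight_ge mu b0 N0 kN dl mE EN Ee (fun x => bnd N k x N0).
rewrite -/(qN N k).
have -> : (2 * c) ^+ d / volume d N = (1 - n%:R / N%:R) ^+ d.
  rewrite /volume -expr_div_n; congr (_ ^+ _); rewrite /c; field.
  by rewrite pnatr_eq0 -lt0n.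
have lo : (1 - 2 * del) * free_weight d beta mu k.+1 <=
    (1 - del) * (1 - n%:R / N%:R) ^+ d * free_weight d beta mu k.+1.
  rewrite ler_pM2r//; apply: (@le_trans _ _ ((1 - del) * (1 - del))).
    by have := sqr_ge0 del; rewrite expr2; lra.
  by rewrite ler_wpM2l.
move=> h; rewrite ger0_norm ?subr_ge0//.
have : (1 - 2 * del) * free_weight d beta mu k.+1 <= qN N k.
  apply: (le_trans lo); apply: h => x xE.
  by apply: hn => // i; have := xE i; rewrite ler_norml.
by move: dele; rewrite mulrBl mul1r mulrCA mulrA; lra.
Unshelve. all: by end_near. Qed.

End killed_weights.

(** * All boundary conditions together, and the large deviation principle *)

Section boundary_weights.
Context {R : realType}.
Variables (d : nat) (beta mu : R) (bc : boundary).
Hypothesis b0 : 0 < beta.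
Variable gDir : nat -> R -> d.-tuple R -> d.-tuple R -> R.
Hypothesis hg : bc = Dir -> forall N, (0 < N)%N -> killed_density N (gDir N).

Lemma bc_weights (qN := fun N k => bc_weight beta mu bc gDir N k.+1) :
  (exists2 C : R, 0 <= C & \forall N \near \oo, forall k,
    0 <= qN N k <= C * free_weight d beta mu k.+1) /\
  forall k, qN ^~ k @ \oo --> free_weight d beta mu k.+1.
Proof.
rewrite {}/qN; case: bc hg => [_|_|/(_ erefl) kg] /=.
- split; last by move=> k; exact: cvg_cst.
  exists 1 => //; near=> N => k.
  by rewrite mul1r lexx andbT ltW// free_weight_gt0.
- have [h1 h2] := periodic_weights d mu b0; split => //.
  by exists (4 ^+ d).
- have [h1 h2] := killed_weights mu b0 kg; split => //.
  by exists 1.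
Unshelve. all: by end_near. Qed.

End boundary_weights.

Lemma volume_cvgy (R : realType) (d : nat) : (0 < d)%N ->
  (volume d : nat -> R) @ \oo --> +oo.
Proof.
move=> d0; apply/cvgryPge => A; near=> N.
have N0 : (0 < N)%N by near: N; exact: nbhs_infty_gt.
have N1 : 1 <= 2 * N%:R :> R by rewrite -natrM ler1n muln_gt0.
apply: (@le_trans _ _ (2 * N%:R)); last by rewrite /volume ler_eXnr.
apply: (@le_trans _ _ N%:R); first by near: N; exact: nbhs_infty_ger.
by rewrite ler_peMl// ler1n.
Unshelve. all: by end_near. Qed.

Theorem theorem1p3 (R : realType) (d : nat) (beta a mu : R) (bc : boundary)
    (gDir : nat -> R -> d.-tuple R -> d.-tuple R -> R)
    (nu : nat -> probability (ell1_borel R) R) :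
  (0 < d)%N -> 0 < beta -> 0 < a -> mu <= 0 ->
  (bc = Dir -> forall N, (0 < N)%N -> killed_density N (gDir N)) ->
  (forall N, (0 < N)%N ->
     cycle_density_law d (bc_weight beta mu bc gDir N) N (nu N)) ->
  large_deviation_principle
    (nu_CMF d beta a nu) (volume d) (rate_CMF d beta mu a).
Proof.
move=> d0 b0 a0 mu0 hg law.
have [[C C0 qNb] qNq] := bc_weights mu b0 hg.
pose phi (x : ell1 R) : R := beta * H_CMF a x.
have phi0 x : 0 <= phi x 
  by rewrite mulr_ge0 ?(ltW b0)// mulr_ge0 ?sqr_ge0// divr_ge0// ltW.
have cphi : continuous phi.
  have cpow : continuous (fun r : R => beta * (a / 2 * r ^+ 2)).
    by move=> r; apply: cvgMr; apply: cvgMr; exact: exprn_continuous.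
  move=> x; exact: (@cvg_comp _ _ _ ell1_sum (fun r : R => beta * (a / 2 * r ^+ 2))
    _ _ _ (@ell1_sum_continuous R x) (@cpow (ell1_sum x))).
have laws : \forall N \near \oo, scaled_poisson_law (volume d N)
    (fun k => volume d N * bc_weight beta mu bc gDir N k.+1) (nu N).
  by near=> N; apply: law; near: N; exact: nbhs_infty_gt.
have := tilted_ldp (fun k => free_weight_gt0 d mu b0 k)
  (@free_weight_summable _ _ _ _ d0 b0 mu0) (@volume_cvgy R d d0) C0 (@qNb) (@qNq)
  (@laws) (@cphi) phi0.
suff -> : nu_CMF d beta a nu = (fun N E => tilted_mass phi (nu N) (volume d N) E /
    tilted_mass phi (nu N) (volume d N) setT)%E by [].
apply/funext => N; apply/funext => A; rewrite /nu_CMF /tilted_mass /phi.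
by under eq_integral do rewrite -mulrA; under [X in (_ / X)%E]eq_integral do rewrite -mulrA.
Unshelve. all: by end_near. Qed.
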